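(* Suppose that $u\in H^1(\mathbb{R})$ with $u\not\equiv0$ solves $$Du-\Pi_+(|u|^2)\,u=0 .$$ Then $$u(x)=e^{i\theta}\lambda^{1/2}\,\mathcal{R}(\lambda x+y)$$ for some $\theta\in[0,2\pi)$, $\lambda>0$, $y\in\mathbb{R}$, where $\mathcal{R}(x)=\frac{\sqrt2}{x+i}$. As a consequence, all minimizers $u\in H^1(\mathbb{R})\setminus\{0\}$ of the energy $$E(u)=\frac12\int_{\mathbb{R}}\big|\partial_xu-i\,\Pi_+(|u|^2)u\big|^2\,dx$$ are of the form $u(x)=e^{i\theta}\lambda^{1/2}\mathcal{R}(\lambda x+y)$ with $\theta\in[0,2\pi)$, $\lambda>0$, $y\in\mathbb{R}$.
   Context: $D=-i\partial_x$. $H^1(\mathbb{R})$ is the usual Sobolev space of complex-valued functions. $\Pi_+$ is the orthogonal projection of $L^2(\mathbb{R})$ onto the Hardy space $L^2_+(\mathbb{R})=\{f\in L^2(\mathbb{R}):\operatorname{supp}\hat f\subset[0,\infty)\}$. *)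

(* Defs.v *)
From mathcomp Require Import all_boot all_order all_algebra.
From mathcomp Require Import all_classical all_reals all_analysis.
From mathcomp Require Export complex.
Import Order.TTheory GRing.Theory Num.Theory.
Import numFieldNormedType.Exports.
Import ComplexField.Normc.

Set Implicit Arguments.
Unset Strict Implicit.
Unset Printing Implicit Defensive.

Local Open Scope classical_set_scope.
Local Open Scope complex_scope.
Local Open Scope ring_scope.

(* Elements of L^2 and H^1 are represented by Borel functions R -> R[i];
   equality of classes is equality almost everywhere. *)

Section HardySobolev.
Context {R : realType}.
Local Notation C := R[i].
Local Notation leb := (@lebesgue_measure R).
Implicit Types (f g h p u v : R -> C) (phi : R -> R).

Definition integralC (D : set R) f : C :=
  (\int[leb]_(x in D) complex.Re (f x)) +i*
  (\int[leb]_(x in D) complex.Im (f x)).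

Definition L2 : set (R -> C) :=
  [set f | (fun x => complex.Re (f x)) \in Lfun leb 2%:E /\
           (fun x => complex.Im (f x)) \in Lfun leb 2%:E].

Definition L2norm_sqr f : \bar R :=
  (\int[leb]_x ((normc (f x)) ^+ 2)%:E)%E.

Definition L2dot f g : C := integralC setT (fun x => f x * ((g x)^*)%C).

Definition test_function phi : Prop :=
  (forall n x, derivable (derive1n n phi) x 1) /\
  compact (closure [set x | phi x != 0]).

(* Real-valued test functions suffice, by C-linearity. *)
Definition weak_derivative u : set (R -> C) :=
  [set v | forall phi, test_function phi ->
    integralC setT (fun x => u x * (derive1 phi x)%:C) =
    - integralC setT (fun x => v x * (phi x)%:C)].

Definition H1 : set (R -> C) :=
  [set u | L2 u /\ exists2 v, L2 v & weak_derivative u v].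

(* A representative of the weak derivative; it is unique almost everywhere,
   and the default value 0 is not reached when u is in H1. *)
Definition partial u : R -> C :=
  xget (cst 0) [set v | L2 v /\ weak_derivative u v].

Definition D u : R -> C := fun x => - 'i%C * partial u x.

Definition expi (t : R) : C := cos t +i* sin t.

(* The Fourier transform on L^2 is the L^2 limit of the Fourier integrals of
   the truncations to [-n, n]. *)
Definition fourier_truncated f (n : nat) : R -> C := fun xi =>
  integralC `[- n%:R, n%:R] (fun x => expi (- (x * xi)) * f x).

Definition is_fourier f g : Prop :=
  L2 g /\
  L2norm_sqr (fun xi => fourier_truncated f n xi - g xi) @[n --> \oo]
    --> (0 : \bar R).

Definition Hardy : set (R -> C) :=
  [set f | L2 f /\ exists2 g, is_fourier f g &
                   {ae leb, forall xi, xi < 0 -> g xi = 0}].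

(* The orthogonal projection onto Hardy, characterised by p in Hardy and
   f - p orthogonal to Hardy; it exists for every f in L2 and is unique
   almost everywhere, so that xget chooses a representative. *)
Definition Pi_plus f : R -> C :=
  xget (cst 0) [set p | Hardy p /\
                        forall h, Hardy h -> L2dot (fun x => f x - p x) h = 0].

Definition sqr_modulus u : R -> C := fun x => `|u x| ^+ 2.

Definition energy u : \bar R :=
  ((2^-1)%:E * L2norm_sqr
    (fun x => partial u x - 'i%C * Pi_plus (sqr_modulus u) x * u x)%R)%E.

Definition nonzero u : Prop := ~ {ae leb, forall x, u x = 0}.

Definition is_minimizer u : Prop :=
  [/\ H1 u, nonzero u &
      forall v, H1 v -> nonzero v -> (energy u <= energy v)%E].

Definition soliton (x : R) : C := (Num.sqrt 2)%:C / (x%:C + 'i%C).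

End HardySobolev.

(* Main.v *)
(* Let [w] be the projection of [rho = |u|^2]. As [rho] is real, [rho = w + conj w],
   and the equation reads [u' = i w u], so that [rho' = i (w^2 - conj w^2)]. For
   [t >= 0] the function [w (x + t) - w x - i \int_x^(x + t) w^2] therefore
   belongs to the Hardy space and is purely imaginary; since a product of two
   Hardy functions has integral 0, it vanishes. Hence [w' = i w^2], that is
   [w = 1 / (c - i x)], with [Re c > 0] because [rho >= 0], and [u (c - i x)] is
   constant. The soliton is itself a solution, with projection [i / (x + i)], so
   its energy is 0; minimizers then have energy 0, hence solve the equation. *)
Require Import Defs.
From mathcomp Require Import all_boot all_order all_algebra.
From mathcomp Require Import all_classical all_reals all_analysis.
From mathcomp Require Import measurable_realfun ring lra.
Import Order.TTheory GRing.Theory Num.Theory.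
Import numFieldNormedType.Exports.
Import ComplexField.Normc.

Set Implicit Arguments.
Unset Strict Implicit.
Unset Printing Implicit Defensive.

Local Open Scope classical_set_scope.
Local Open Scope ring_scope.

Local Notation "z ^*" := (conjc z) : ring_scope.

(** The obstacle is regularity. The projection [w] is known only as an element of L2, so [w^2] is
    merely integrable, and neither [w'] nor the membership of [w^2] in the Hardy space makes sense
    at first. Integrating [w^2] over windows of length [t] cures both: the window integral is
    bounded and integrable, hence in L2, and its spectrum is that of [w^2] times the transform of an
    indicator. The resulting identity holds outside a null set that depends on [t]; testing it on
    segments turns it into a differential equation for an absolutely continuous representative. The
    L2 theory works by duality instead of pointwise inversion: a transform is probed by its
    integrals over segments, so that membership in the Hardy space becomes a family of vanishing
    pairings with transforms of indicators. Damping by [exp (- eps |xi|)], whose transform is the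
    Poisson kernel, supplies both the L2 bound and the inversion formula. That [|u|^2] has a
    projection at all rests on the boundedness of H1 functions. *)

Section ComplexNumbers.
Context {R : realType}.
Local Open Scope complex_scope.
Local Notation C := R[i].
Implicit Types (z w : C) (t : R).

(** The squared modulus is kept polynomial in the two coordinates, so that [ring] and the
    measurability of sums and products apply; [normc] hides a square root. *)
Definition nsq z : R := complex.Re z ^+ 2 + complex.Im z ^+ 2.

Lemma complexP z w :
  complex.Re z = complex.Re w -> complex.Im z = complex.Im w -> z = w.
Proof. by case: z w => [a b] [c d] /= -> ->. Qed.

Lemma cReD z w : complex.Re (z + w) = complex.Re z + complex.Re w.
Proof. by case: z w => [a b] [c d]. Qed.

Lemma cImD z w : complex.Im (z + w) = complex.Im z + complex.Im w.
Proof. by case: z w => [a b] [c d]. Qed.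

Lemma cReN z : complex.Re (- z) = - complex.Re z.
Proof. by case: z. Qed.

Lemma cImN z : complex.Im (- z) = - complex.Im z.
Proof. by case: z. Qed.

Lemma cReM z w : complex.Re (z * w) =
  complex.Re z * complex.Re w - complex.Im z * complex.Im w.
Proof. by case: z w => [a b] [c d]. Qed.

Lemma cImM z w : complex.Im (z * w) =
  complex.Re z * complex.Im w + complex.Im z * complex.Re w.
Proof. by case: z w => [a b] [c d]. Qed.

Lemma cReJ z : complex.Re z^* = complex.Re z.
Proof. by case: z. Qed.

Lemma cImJ z : complex.Im z^* = - complex.Im z.
Proof. by case: z. Qed.

Definition ReImE := (cReD, cImD, cReN, cImN, cReM, cImM, cReJ, cImJ).

Lemma normc_sqr z : normc z ^+ 2 = nsq z.
Proof. by case: z => a b; rewrite /= sqr_sqrtr// addr_ge0 ?sqr_ge0. Qed.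

Lemma normc_ge0 z : 0 <= normc z.
Proof. by case: z => a b; rewrite sqrtr_ge0. Qed.

Lemma normc_nsq z : normc z = Num.sqrt (nsq z).
Proof. by case: z. Qed.

Lemma nsq_ge0 z : 0 <= nsq z.
Proof. by rewrite addr_ge0 ?sqr_ge0. Qed.

Lemma nsq_eq0 z : nsq z = 0 -> z = 0.
Proof. by rewrite -normc_sqr => /eqP; rewrite sqrf_eq0 => /eqP/eq0_normc. Qed.

Lemma nsq0 : nsq 0 = 0.
Proof. by rewrite /nsq /= expr0n /= addr0. Qed.

Lemma nsqM z w : nsq (z * w) = nsq z * nsq w.
Proof. by rewrite -!normc_sqr normcM exprMn. Qed.

Lemma nsqJ z : nsq z^* = nsq z.
Proof. by rewrite /nsq !ReImE sqrrN. Qed.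

Lemma nsqN z : nsq (- z) = nsq z.
Proof. by rewrite /nsq !ReImE !sqrrN. Qed.

Lemma nsqD z w : nsq (z + w) <= 2 * nsq z + 2 * nsq w.
Proof.
rewrite /nsq !ReImE -subr_ge0.
have -> : 2 * (complex.Re z ^+ 2 + complex.Im z ^+ 2) +
    2 * (complex.Re w ^+ 2 + complex.Im w ^+ 2) -
    ((complex.Re z + complex.Re w) ^+ 2 + (complex.Im z + complex.Im w) ^+ 2) =
  (complex.Re z - complex.Re w) ^+ 2 + (complex.Im z - complex.Im w) ^+ 2 by ring.
by rewrite addr_ge0 ?sqr_ge0.
Qed.

Lemma cconjM z w : (z * w)^* = z^* * w^*.
Proof. by apply: complexP; rewrite !ReImE; ring. Qed.

Lemma cconj_real t : (t%:C)^* = t%:C.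
Proof. by apply: complexP; rewrite /= ?oppr0. Qed.

Lemma mulccJ z : z * z^* = (nsq z)%:C.
Proof. by apply: complexP; rewrite !ReImE /nsq /=; ring. Qed.

Lemma Re_le_normc z : `|complex.Re z| <= normc z.
Proof.
by case: z => a b /=; rewrite -sqrtr_sqr ler_wsqrtr// lerDl sqr_ge0.
Qed.

Lemma Im_le_normc z : `|complex.Im z| <= normc z.
Proof.
by case: z => a b /=; rewrite -sqrtr_sqr ler_wsqrtr// lerDr sqr_ge0.
Qed.

Lemma normc_leD z : normc z <= `|complex.Re z| + `|complex.Im z|.
Proof.
rewrite normc_nsq -[leRHS]ger0_norm ?addr_ge0// -sqrtr_sqr ler_wsqrtr//.
rewrite sqrrD !real_normK ?num_real// /nsq lerD2r lerDl.
by rewrite mulrn_wge0// mulr_ge0.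
Qed.

Lemma normc_real t : normc t%:C = `|t|.
Proof. by rewrite /= expr0n /= addr0 sqrtr_sqr. Qed.

Lemma normc_conj z : normc z^* = normc z.
Proof. by rewrite !normc_nsq nsqJ. Qed.

Lemma normc_expi t : normc (expi t) = 1.
Proof. by rewrite normc_nsq /nsq /= cos2Dsin2 sqrtr1. Qed.

Lemma nsq_expi t : nsq (expi t) = 1.
Proof. by rewrite -normc_sqr normc_expi expr1n. Qed.

Lemma expiD (s t : R) : expi (s + t) = expi s * expi t.
Proof. by apply: complexP; rewrite !ReImE /= ?cosD ?sinD; ring. Qed.

Lemma expiJ t : (expi t)^* = expi (- t).
Proof. by apply: complexP; rewrite /= ?cosN ?sinN. Qed.

(** Young's inequality, from the square of [normc z - normc w / t]. The weight [t] lets one factor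
    be counted heavily and the other lightly, which does the work of Cauchy-Schwarz in limits. *)
Lemma normc_mul_le z w t : 0 < t ->
  normc (z * w) <= 2^-1 * (t * nsq z + t^-1 * nsq w).
Proof.
move=> t0; rewrite normcM -!normc_sqr.
set a := normc z; set b := normc w.
rewrite -subr_ge0.
have -> : 2^-1 * (t * a ^+ 2 + t^-1 * b ^+ 2) - a * b =
  2^-1 * t * (a - b / t) ^+ 2.
  by field; rewrite gt_eqF.
by rewrite mulr_ge0 ?sqr_ge0// mulr_ge0// ltW.
Qed.

End ComplexNumbers.

(** * Measurability of complex-valued functions *)

Section ComplexMeasurable.
Context d (T : measurableType d) (R : realType).
Local Open Scope complex_scope.
Implicit Types f g : T -> R[i].

Definition cmeasurable f := measurable_fun setT (fun x => complex.Re (f x)) /\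
  measurable_fun setT (fun x => complex.Im (f x)).

Lemma cmeasurableD f g : cmeasurable f -> cmeasurable g ->
  cmeasurable (fun x => f x + g x).
Proof.
move=> [f1 f2] [g1 g2]; split.
  by under eq_fun do rewrite ReImE; exact: measurable_funD.
by under eq_fun do rewrite ReImE; exact: measurable_funD.
Qed.

Lemma cmeasurableN f : cmeasurable f -> cmeasurable (fun x => - f x).
Proof.
move=> [f1 f2]; split.
  by under eq_fun do rewrite ReImE; exact: measurableT_comp.
by under eq_fun do rewrite ReImE; exact: measurableT_comp.
Qed.

Lemma cmeasurableB f g : cmeasurable f -> cmeasurable g ->
  cmeasurable (fun x => f x - g x).
Proof. by move=> mf mg; apply: cmeasurableD => //; exact: cmeasurableN. Qed.

Lemma cmeasurableM f g : cmeasurable f -> cmeasurable g ->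
  cmeasurable (fun x => f x * g x).
Proof.
move=> [f1 f2] [g1 g2]; split.
  by under eq_fun do rewrite ReImE; apply: measurable_funB; exact: measurable_funM.
by under eq_fun do rewrite ReImE; apply: measurable_funD; exact: measurable_funM.
Qed.

Lemma cmeasurableJ f : cmeasurable f -> cmeasurable (fun x => (f x)^*).
Proof.
move=> [f1 f2]; split.
  by under eq_fun do rewrite ReImE.
by under eq_fun do rewrite ReImE; exact: measurableT_comp.
Qed.

Lemma cmeasurable_cst (c : R[i]) : cmeasurable (fun=> c).
Proof. by split; exact: measurable_cst. Qed.

Lemma cmeasurable_real (g : T -> R) : measurable_fun setT g ->
  cmeasurable (fun x => (g x)%:C).
Proof. by move=> mg; split => //=; exact: measurable_cst. Qed.

Lemma cmeasurable_expi (g : T -> R) : measurable_fun setT g ->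
  cmeasurable (fun x => expi (g x)).
Proof.
move=> mg; split => /=.
- apply: measurableT_comp => //.
  by apply: continuous_measurable_fun => x; exact: continuous_cos.
- apply: measurableT_comp => //.
  by apply: continuous_measurable_fun => x; exact: continuous_sin.
Qed.

Lemma measurable_nsq f : cmeasurable f -> measurable_fun setT (fun x => nsq (f x)).
Proof.
by move=> [f1 f2]; apply: measurable_funD; apply: measurable_funX.
Qed.

Lemma measurable_normc f :
  cmeasurable f -> measurable_fun setT (fun x => normc (f x)).
Proof.
move=> mf; under eq_fun do rewrite normc_nsq.
apply: measurableT_comp; last exact: measurable_nsq.
by apply: continuous_measurable_fun => x; exact: sqrt_continuous.
Qed.

End ComplexMeasurable.

Lemma cmeasurable_comp d d' (T : measurableType d) (S : measurableType d')
    (R : realType) (f : S -> R[i]) (phi : T -> S) :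
  measurable_fun setT phi -> cmeasurable f -> cmeasurable (fun x => f (phi x)).
Proof.
move=> mp [f1 f2]; split.
- exact: measurableT_comp f1 mp.
- exact: measurableT_comp f2 mp.
Qed.

(** * Almost-everywhere statements for Lebesgue measure *)

Section AlmostEverywhere.
Context {R : realType}.
Local Notation mu := (@lebesgue_measure R).
Implicit Types P Q S : R -> Prop.

Let ae_filter := @ae_filter_ringOfSetsType _ _ _ mu.

Lemma ae_imply P Q : (forall x, P x -> Q x) ->
  {ae mu, forall x, P x} -> {ae mu, forall x, Q x}.
Proof. by move=> h; apply: (@filterS _ _ ae_filter). Qed.

Lemma ae_imply2 P Q S : (forall x, P x -> Q x -> S x) ->
  {ae mu, forall x, P x} -> {ae mu, forall x, Q x} -> {ae mu, forall x, S x}.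
Proof. by move=> h; apply: (@filterS2 _ _ ae_filter). Qed.

Lemma ae_all P : (forall x, P x) -> {ae mu, forall x, P x}.
Proof. by move=> h; exact: (@filterE _ _ ae_filter). Qed.

(** Otherwise the exceptional null set would contain [[0, 1]], which has measure 1. *)
Lemma ae_exists P : {ae mu, forall x, P x} -> exists x, P x.
Proof.
move=> aeP; apply: contrapT => nP.
have : {ae mu, forall x : R, False}.
  by apply: ae_imply aeP => x Px; apply: nP; exists x.
case=> A [mA A0 /(_ _)AT].
have : (mu `[0%R, 1%R]%classic <= mu A)%E.
  by apply: le_measure; rewrite ?inE//=; move=> x _; exact: AT.
by rewrite A0 lebesgue_measure_itv/= lte_fin ltr01 sube0 lee_fin ler10.
Qed.

End AlmostEverywhere.

(** * Integration of complex-valued functions *)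

Section ComplexIntegral.
Context {R : realType}.
Local Open Scope complex_scope.
Local Notation C := R[i].
Local Notation mu := (@lebesgue_measure R).
Implicit Types (f g h : R -> C) (c z : C).

Definition cintegrable f :=
  mu.-integrable setT (EFin \o (fun x => complex.Re (f x))) /\
  mu.-integrable setT (EFin \o (fun x => complex.Im (f x))).

Lemma cintegrable_measurable f : cintegrable f -> cmeasurable f.
Proof.
by move=> [/measurable_int/measurable_EFinP f1 /measurable_int/measurable_EFinP].
Qed.

Lemma le_cintegrable f (g : R -> R) : cmeasurable f ->
  mu.-integrable setT (EFin \o g) -> (forall x, normc (f x) <= g x) ->
  cintegrable f.
Proof.
move=> [f1 f2] ig fg; split; apply: le_integrable ig => //;
    try exact/measurable_EFinP; move=> x _ /=; rewrite lee_fin.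
- exact: (le_trans (Re_le_normc _) (le_trans (fg x) (ler_norm _))).
- exact: (le_trans (Im_le_normc _) (le_trans (fg x) (ler_norm _))).
Qed.

Lemma integrable_normc f : cintegrable f ->
  mu.-integrable setT (EFin \o (fun x => normc (f x))).
Proof.
move=> If; have mf := cintegrable_measurable If; case: If => f1 f2.
have : mu.-integrable setT (EFin \o (fun x => `|complex.Re (f x)|) \+
    (EFin \o (fun x => `|complex.Im (f x)|))).
  by apply: integrableD => //; exact: integrable_norm.
apply: le_integrable => //; first exact/measurable_EFinP/measurable_normc.
move=> x _ /=; rewrite lee_fin ger0_norm ?normc_ge0//.
by apply: (le_trans (normc_leD _)); exact: ler_norm.
Qed.

Lemma cintegrableP f : cmeasurable f -> cintegrable f <->
  (\int[mu]_x (normc (f x))%:E < +oo)%E.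
Proof.
move=> mf; split.
  move/integrable_normc/integrableP => [_]; apply: le_lt_trans.
  by apply: ge0_le_integral => //;
    rewrite ?lee_fin ?normc_ge0//; try exact/measurable_EFinP/measurable_normc;
    [by move=> x _; rewrite lee_fin normc_ge0|
     apply/measurable_EFinP/measurableT_comp => //; exact: measurable_normc|
     move=> x _ /=; rewrite lee_fin; exact: ler_norm].
move=> h; apply: (@le_cintegrable _ (fun x => normc (f x))) => //.
apply/integrableP; split; first exact/measurable_EFinP/measurable_normc.
by under eq_integral do rewrite /= ger0_norm ?normc_ge0//.
Qed.

Lemma cintegrableD f g : cintegrable f -> cintegrable g ->
  cintegrable (fun x => f x + g x).
Proof.
move=> [f1 f2] [g1 g2]; split.
- have := integrableD measurableT f1 g1; apply: eq_integrable => // x _ /=.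
  by rewrite cReD EFinD.
- have := integrableD measurableT f2 g2; apply: eq_integrable => // x _ /=.
  by rewrite cImD EFinD.
Qed.

Lemma cintegrableN f : cintegrable f -> cintegrable (fun x => - f x).
Proof.
move=> [f1 f2]; split.
- have := integrableN f1; apply: eq_integrable => // x _ /=; by rewrite cReN.
- have := integrableN f2; apply: eq_integrable => // x _ /=; by rewrite cImN.
Qed.

Lemma cintegrableB f g : cintegrable f -> cintegrable g ->
  cintegrable (fun x => f x - g x).
Proof. by move=> If Ig; apply: cintegrableD => //; exact: cintegrableN. Qed.

Lemma cintegrableM f g (M : R) : cintegrable f -> cmeasurable g ->
  (forall x, normc (g x) <= M) -> cintegrable (fun x => g x * f x).
Proof.
move=> If mg gM; have mf := cintegrable_measurable If.
apply: (@le_cintegrable _ (fun x => M * normc (f x))).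
- exact: cmeasurableM.
- have := integrableZl measurableT M (integrable_normc If).
  by apply: eq_integrable => // x _.
- by move=> x; rewrite normcM ler_wpM2r// normc_ge0.
Qed.

Lemma cintegrableZ f c : cintegrable f -> cintegrable (fun x => c * f x).
Proof.
by move=> If; apply: (@cintegrableM f (cst c) (normc c)).
Qed.

Lemma cintegrableJ f : cintegrable f -> cintegrable (fun x => (f x)^*).
Proof.
move=> If; apply: (@le_cintegrable _ (fun x => normc (f x))).
- exact/cmeasurableJ/cintegrable_measurable.
- exact: integrable_normc.
- by move=> x; rewrite normc_conj.
Qed.

Definition cint f : C := integralC setT f.

Lemma eq_cint f g : f =1 g -> cint f = cint g.
Proof. by move=> fg; rewrite (_ : f = g)//; exact/funext. Qed.

Lemma Re_cint f : complex.Re (cint f) = \int[mu]_x complex.Re (f x).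
Proof. by []. Qed.

Lemma Im_cint f : complex.Im (cint f) = \int[mu]_x complex.Im (f x).
Proof. by []. Qed.

Lemma cint0 : cint (fun=> 0) = 0.
Proof.
by apply: complexP => /=; rewrite /Rintegral integral0.
Qed.

Lemma cintD f g : cintegrable f -> cintegrable g ->
  cint (fun x => f x + g x) = cint f + cint g.
Proof.
move=> [f1 f2] [g1 g2]; apply: complexP; rewrite ReImE !(Re_cint, Im_cint).
- by under [LHS]eq_Rintegral do rewrite cReD; rewrite RintegralD.
- by under [LHS]eq_Rintegral do rewrite cImD; rewrite RintegralD.
Qed.

Lemma cintZ f c : cintegrable f -> cint (fun x => c * f x) = c * cint f.
Proof.
move=> [f1 f2].
have Z (k : R) (h : R -> R) : mu.-integrable setT (EFin \o h) ->
    mu.-integrable setT (EFin \o (fun x => k * h x)).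
  by move=> ih; have := integrableZl measurableT k ih; apply: eq_integrable.
apply: complexP; rewrite ReImE !(Re_cint, Im_cint).
- under [LHS]eq_Rintegral do rewrite cReM.
  by rewrite RintegralB// ?RintegralZl//; exact: Z.
- under [LHS]eq_Rintegral do rewrite cImM.
  by rewrite RintegralD// ?RintegralZl//; exact: Z.
Qed.

Lemma cintN f : cintegrable f -> cint (fun x => - f x) = - cint f.
Proof.
by move=> If; under eq_cint do rewrite -mulN1r; rewrite cintZ// mulN1r.
Qed.

Lemma cintB f g : cintegrable f -> cintegrable g ->
  cint (fun x => f x - g x) = cint f - cint g.
Proof. by move=> If Ig; rewrite cintD ?cintN//; exact: cintegrableN. Qed.

Lemma cintJ f : cintegrable f -> cint (fun x => (f x)^*) = (cint f)^*.
Proof.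
move=> [f1 f2]; apply: complexP; rewrite ReImE !(Re_cint, Im_cint).
- by under [LHS]eq_Rintegral do rewrite cReJ.
- under [LHS]eq_Rintegral do rewrite cImJ -mulN1r.
  by rewrite RintegralZl// mulN1r.
Qed.

Lemma cint_real (h : R -> R) : cint (fun x => (h x)%:C) = (\int[mu]_x h x)%:C.
Proof. by apply: complexP => //=; rewrite /Rintegral integral0. Qed.

Lemma le_Re_cint f : cintegrable f ->
  `|complex.Re (cint f)| <= \int[mu]_x normc (f x).
Proof.
move=> If; have [f1 _] := If; rewrite Re_cint.
apply: (le_trans (le_normr_Rintegral _ _)) => //.
apply: le_Rintegral => //; [exact: integrable_norm|exact: integrable_normc|].
by move=> x _; exact: Re_le_normc.
Qed.

Lemma le_Im_cint f : cintegrable f ->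
  `|complex.Im (cint f)| <= \int[mu]_x normc (f x).
Proof.
move=> If; have [_ f2] := If; rewrite Im_cint.
apply: (le_trans (le_normr_Rintegral _ _)) => //.
apply: le_Rintegral => //; [exact: integrable_norm|exact: integrable_normc|].
by move=> x _; exact: Im_le_normc.
Qed.

(** The factor 2 comes from bounding the real and the imaginary part separately. It is what turns
    the [2 * pi] of Plancherel into the [4 * pi] of [n2_ft_le]. *)
Lemma normc_cint_le f : cintegrable f ->
  normc (cint f) <= 2 * \int[mu]_x normc (f x).
Proof.
move=> If; apply: (le_trans (normc_leD _)).
by rewrite mulr_natl mulr2n lerD ?le_Re_cint ?le_Im_cint.
Qed.

Lemma ae_eq_cint f g : cmeasurable f -> cmeasurable g ->
  {ae mu, forall x, f x = g x} -> cint f = cint g.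
Proof.
move=> [f1 f2] [g1 g2] fg; apply: complexP; rewrite ?Re_cint ?Im_cint;
    congr fine; apply: ae_eq_integral => //; try exact/measurable_EFinP;
    by apply: (ae_imply _ fg) => x -> .
Qed.

Lemma ae_cintegrable f g : cmeasurable g -> {ae mu, forall x, f x = g x} ->
  cintegrable f -> cintegrable g.
Proof.
move=> mg fg If; have mf := cintegrable_measurable If.
apply/cintegrableP => //; move/(cintegrableP mf): If; congr (_ < _)%E.
apply: ae_eq_integral => //; try exact/measurable_EFinP/measurable_normc.
by apply: (ae_imply _ fg) => x -> .
Qed.

(** Two real limits instead of one complex limit: uniqueness, products and dominated convergence are
    then imported from the real line. *)
Definition ccvg (u : nat -> C) z :=
  complex.Re (u n) @[n --> \oo] --> complex.Re z /\
  complex.Im (u n) @[n --> \oo] --> complex.Im z.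

Lemma ccvg_unique (u : nat -> C) z c : ccvg u z -> ccvg u c -> z = c.
Proof.
move=> [u1 u2] [v1 v2]; apply: complexP.
- by apply: (cvg_unique _ u1 v1); exact: Rhausdorff.
- by apply: (cvg_unique _ u2 v2); exact: Rhausdorff.
Qed.

Lemma ccvg_cst z : ccvg (fun=> z) z.
Proof. by split; exact: cvg_cst. Qed.

Lemma ccvgM (u v : nat -> C) z c : ccvg u z -> ccvg v c ->
  ccvg (fun n => u n * v n) (z * c).
Proof.
move=> [u1 u2] [v1 v2]; split; rewrite ReImE; under eq_fun do rewrite ReImE.
- by apply: cvgB; apply: cvgM.
- by apply: cvgD; apply: cvgM.
Qed.

Lemma cint_dominated (f_ : nat -> R -> C) f (g : R -> R) :
  (forall n, cmeasurable (f_ n)) -> cmeasurable f ->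
  (forall x, ccvg (f_ ^~ x) (f x)) ->
  mu.-integrable setT (EFin \o g) -> (forall n x, normc (f_ n x) <= g x) ->
  ccvg (fun n => cint (f_ n)) (cint f).
Proof.
move=> mf_ mf f_f ig fg.
have H (a_ : nat -> R -> R) (a : R -> R) : (forall n, measurable_fun setT (a_ n)) ->
    measurable_fun setT a -> (forall x, a_ n x @[n --> \oo] --> a x) ->
    (forall n x, `|a_ n x| <= g x) ->
    (\int[mu]_x a_ n x) @[n --> \oo] --> \int[mu]_x a x.
  move=> ma_ ma aa ag.
  have mEa_ n : measurable_fun setT (EFin \o a_ n) by exact/measurable_EFinP.
  have mEa : measurable_fun setT (EFin \o a) by exact/measurable_EFinP.
  have aeaa : {ae mu, forall x, setT x -> (EFin \o a_ n) x @[n --> \oo] --> (EFin \o a) x}.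
    by apply: ae_all => x _; apply/cvg_EFin; [exact: nearW|exact: aa].
  have aeag : {ae mu, forall x n, setT x -> (`|(EFin \o a_ n) x| <= (EFin \o g) x)%E}.
    by apply: ae_all => x n _ /=; rewrite lee_fin.
  have [ia _ h] := @dominated_convergence _ (measurableTypeR R) R mu setT
    measurableT (fun n => EFin \o a_ n) (EFin \o a) (EFin \o g) mEa_ mEa aeaa ig aeag.
  rewrite /Rintegral; apply: fine_cvg.
  by rewrite fineK//; exact: integrable_fin_num.
split.
- apply: H => [n||x|n x].
  + by have [] := mf_ n.
  + by have [] := mf.
  + by have [] := f_f x.
  + exact: le_trans (Re_le_normc _) (fg n x).
- apply: H => [n||x|n x].
  + by have [] := mf_ n.
  + by have [] := mf.
  + by have [] := f_f x.
  + exact: le_trans (Im_le_normc _) (fg n x).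
Qed.

End ComplexIntegral.

(** * Tonelli and Fubini for iterated integrals on the line *)

Section Fubini.
Context {R : realType}.
Local Notation mu := (@lebesgue_measure R).
Local Notation T := (measurableTypeR R).

Lemma integral_tonelli (F : T * T -> R) : measurable_fun setT F ->
  (forall z, 0 <= F z) ->
  (\int[mu]_x \int[mu]_y (F (x, y))%:E = \int[mu]_y \int[mu]_x (F (x, y))%:E)%E.
Proof.
move=> mF F0; apply: (@fubini_tonelli _ _ T T R mu mu (fun z => (F z)%:E)) => //.
exact/measurable_EFinP.
Qed.

Let fubini1 (F : T * T -> R) : measurable_fun setT F ->
  (\int[mu]_x \int[mu]_y `|F (x, y)|%:E < +oo)%E ->
  (forall x, mu.-integrable setT (EFin \o (fun y => F (x, y)))) ->
  mu.-integrable setT (EFin \o (fun x => \int[mu]_y F (x, y))).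
Proof.
move=> mF Foo Fx.
have iF : (mu \x mu)%E.-integrable setT (EFin \o F).
  by apply/(@integrable12ltyP _ _ T T R mu mu) => //; exact/measurable_EFinP.
apply: eq_integrable (integrable_fubini_F iF) => // x _ /=.
by rewrite fineK//; apply: integrable_fin_num => //; exact: Fx.
Qed.

(** Since [fine] sends an infinite value to 0, real inner integrals are faithful only where the
    section is integrable; asking this of every section lets extended integrals be replaced by real
    ones pointwise. *)
Lemma Rintegral_fubini (F : T * T -> R) : measurable_fun setT F ->
  (\int[mu]_x \int[mu]_y `|F (x, y)|%:E < +oo)%E ->
  (forall x, mu.-integrable setT (EFin \o (fun y => F (x, y)))) ->
  (forall y, mu.-integrable setT (EFin \o (fun x => F (x, y)))) ->
  [/\ mu.-integrable setT (EFin \o (fun x => \int[mu]_y F (x, y))),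
      mu.-integrable setT (EFin \o (fun y => \int[mu]_x F (x, y))) &
      \int[mu]_x \int[mu]_y F (x, y) = \int[mu]_y \int[mu]_x F (x, y)].
Proof.
move=> mF Foo Fx Fy; split; first exact: fubini1.
- apply: (@fubini1 (fun z => F (z.2, z.1))) => //.
    apply: (measurableT_comp mF).
    by apply/measurable_fun_pairP; split;
      [exact: measurable_snd|exact: measurable_fst].
  by rewrite -(@integral_tonelli (fun z => `|F z|))//; exact: measurableT_comp.
- have iF : (mu \x mu)%E.-integrable setT (EFin \o F).
    by apply/(@integrable12ltyP _ _ T T R mu mu) => //; exact/measurable_EFinP.
  have E1 x : (\int[mu]_y F (x, y))%:E = (\int[mu]_y (F (x, y))%:E)%E.
    by rewrite fineK//; apply: integrable_fin_num => //; exact: Fx.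
  have E2 y : (\int[mu]_x F (x, y))%:E = (\int[mu]_x (F (x, y))%:E)%E.
    by rewrite fineK//; apply: integrable_fin_num => //; exact: Fy.
  congr fine; under eq_integral do rewrite E1.
  under [RHS]eq_integral do rewrite E2.
  exact: (Fubini iF).
Qed.

Lemma cint_fubini (F : T * T -> R[i]) : cmeasurable F ->
  (\int[mu]_x \int[mu]_y (normc (F (x, y)))%:E < +oo)%E ->
  (forall x, cintegrable (fun y => F (x, y))) ->
  (forall y, cintegrable (fun x => F (x, y))) ->
  [/\ cintegrable (fun x => cint (fun y => F (x, y))),
      cintegrable (fun y => cint (fun x => F (x, y))) &
      cint (fun x => cint (fun y => F (x, y))) =
      cint (fun y => cint (fun x => F (x, y)))].
Proof.
move=> mF Foo Fx Fy; have [m1 m2] := mF.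
have mN : measurable_fun setT (fun z => (normc (F z))%:E).
  exact/measurable_EFinP/measurable_normc.
have H (G : T * T -> R) : measurable_fun setT G ->
    (forall z, `|G z| <= normc (F z)) ->
    (\int[mu]_x \int[mu]_y `|G (x, y)|%:E < +oo)%E.
  move=> mG GF; apply: le_lt_trans Foo.
  have mG' : measurable_fun setT (fun z => (`|G z|)%:E).
    by apply/measurable_EFinP; exact: measurableT_comp.
  apply: ge0_le_integral => //.
  - by move=> x _; apply: integral_ge0 => y _; rewrite lee_fin.
  - exact: (measurable_fun_fubini_tonelli_F (fun z => (`|G z|)%:E)).
  - apply: (measurable_fun_fubini_tonelli_F (fun z => (normc (F z))%:E)) => //.
    by move=> z; rewrite lee_fin normc_ge0.
  - move=> x _; apply: ge0_le_integral => //.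
    + exact: measurableT_comp mG' (measurable_pair1 _).
    + exact: measurableT_comp mN (measurable_pair1 _).
    + by move=> y _; rewrite lee_fin.
have h1 := H _ m1 (fun z => Re_le_normc (F z)).
have h2 := H _ m2 (fun z => Im_le_normc (F z)).
have [a1 a2 a3] := Rintegral_fubini m1 h1 (fun x => (Fx x).1) (fun y => (Fy y).1).
have [b1 b2 b3] := Rintegral_fubini m2 h2 (fun x => (Fx x).2) (fun y => (Fy y).2).
split; [by split|by split|apply: complexP; rewrite !(Re_cint, Im_cint)].
- exact: a3.
- exact: b3.
Qed.

End Fubini.

(** * Invariance of integrals under translation and reflection *)

Section MeasurePreserving.
Context {R : realType}.
Local Notation mu := (@lebesgue_measure R).
Local Notation T := (measurableTypeR R).

Definition lebesgue_preserving (phi : R -> R) := measurable_fun setT phi /\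
  forall A : set R, measurable A -> mu (phi @^-1` A) = mu A.

(** The image measure agrees with Lebesgue measure on the intervals []a, b]], and these determine
    it. *)
Lemma shift_preserving (h : R) : lebesgue_preserving (fun x => x + h).
Proof.
have mphi : measurable_fun setT (fun x : T => (x + h : T)).
  by apply: measurable_funD => //; exact: measurable_id.
split=> // A mA.
pose nu := pushforward mu (fun x : T => (x + h : T)).
apply/esym; apply: (lebesgue_measure_unique (mu := nu)) => //= _ [[a b]] _ <-.
rewrite /nu /pushforward.
have -> : (fun x : T => x + h) @^-1` `]a, b] = `](a - h), (b - h)]%classic.
  by apply/seteqP; split => x /=; rewrite !in_itv/= ltrBlDr lerBrDr.
rewrite /= !lebesgue_measure_itv/= !lte_fin ltrD2r.
by case: ifPn => // _; rewrite -!EFinB; congr EFin; lra.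
Qed.

Lemma opp_preserving : lebesgue_preserving (-%R).
Proof. by split=> // A mA; exact: lebesgue_measureN. Qed.

Variable phi : R -> R.
Hypothesis pphi : lebesgue_preserving phi.

Lemma preserving_measurable (f : R -> R) :
  measurable_fun setT f -> measurable_fun setT (fun x => f (phi x)).
Proof. by move=> mf; apply: measurableT_comp mf _; case: pphi. Qed.

Lemma preserving_cmeasurable (f : R -> R[i]) :
  cmeasurable f -> cmeasurable (fun x => f (phi x)).
Proof. by apply: cmeasurable_comp; case: pphi. Qed.

Lemma ge0_integral_preserving (f : R -> \bar R) : measurable_fun setT f ->
  (forall x, 0 <= f x)%E -> (\int[mu]_x f (phi x) = \int[mu]_x f x)%E.
Proof.
move=> mf f0; case: pphi => mphi h.
transitivity (\int[pushforward mu (phi : T -> T)]_x f x)%E.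
  rewrite (@ge0_integral_pushforward _ _ T T R phi mphi mu setT f)//.
by apply: eq_measure_integral => A mA _; exact: h.
Qed.

Lemma integrable_preserving (f : R -> R) : mu.-integrable setT (EFin \o f) ->
  mu.-integrable setT (EFin \o (fun x => f (phi x))).
Proof.
move=> /integrableP[/measurable_EFinP mf foo].
apply/integrableP; split; first by apply/measurable_EFinP; exact: preserving_measurable.
rewrite (@ge0_integral_preserving (fun x => `|(f x)%:E|)%E)//.
by apply: measurableT_comp => //; exact/measurable_EFinP.
Qed.

Lemma Rintegral_preserving (f : R -> R) : mu.-integrable setT (EFin \o f) ->
  \int[mu]_x f (phi x) = \int[mu]_x f x.
Proof.
move=> If; have Ifp := integrable_preserving If; case: pphi => mphi h.
congr fine; transitivity (\int[pushforward mu (phi : T -> T)]_x (f x)%:E)%E.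
  rewrite (@integral_pushforward _ _ T T R phi mphi mu setT (EFin \o f))//.
  exact: measurable_int If.
by apply: eq_measure_integral => A mA _; exact: h.
Qed.

Lemma cintegrable_preserving (f : R -> R[i]) :
  cintegrable f -> cintegrable (fun x => f (phi x)).
Proof.
move=> [f1 f2]; split.
- exact: (integrable_preserving f1).
- exact: (integrable_preserving f2).
Qed.

Lemma cint_preserving (f : R -> R[i]) :
  cintegrable f -> cint (fun x => f (phi x)) = cint f.
Proof.
move=> [f1 f2]; apply: complexP.
- exact: (Rintegral_preserving f1).
- exact: (Rintegral_preserving f2).
Qed.

Lemma ae_preserving (P : R -> Prop) :
  {ae mu, forall x, P x} -> {ae mu, forall x, P (phi x)}.
Proof.
case: pphi => mphi h [A [mA A0 PA]]; exists (phi @^-1` A); split.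
- by rewrite -[X in measurable X]setTI; exact: mphi.
- by rewrite h.
- by move=> x /= nP; exact: PA.
Qed.

End MeasurePreserving.

(** * Square-integrable functions, their pairings and their truncations *)

Section SquareIntegrable.
Context {R : realType}.
Local Open Scope complex_scope.
Local Notation C := R[i].
Local Notation mu := (@lebesgue_measure R).
Implicit Types (f g h : R -> C) (c z : C).

Lemma Lfun2P (k : R -> R) : k \in Lfun mu 2%:E <->
  measurable_fun setT k /\ mu.-integrable setT (EFin \o (fun x => k x ^+ 2)).
Proof.
split=> [kL|[mk ik]].
  split; last exact: Lfun2_integrable_sqr.
  by move: kL; rewrite inE => /andP[]; rewrite inE.
rewrite inE; apply/andP; split; rewrite inE//=.
rewrite /finite_norm unlock poweR_lty//.
move/integrableP: ik => [_]; apply: le_lt_trans.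
apply: ge0_le_integral => //.
- by move=> x _; exact: poweR_ge0.
- apply/measurable_EFinP; apply: (@measurableT_comp _ _ _ _ _ _ (@powR R ^~ 2)) => //.
  exact: measurableT_comp.
- by apply: measurableT_comp => //; apply/measurable_EFinP; exact: measurable_funX.
- by move=> x _ /=; rewrite lee_fin normrX powR_mulrn.
Qed.

Lemma L2P f : L2 f <->
  cmeasurable f /\ mu.-integrable setT (EFin \o (fun x => nsq (f x))).
Proof.
split.
  move=> [/Lfun2P[m1 i1] /Lfun2P[m2 i2]]; split=> //.
  by have := integrableD measurableT i1 i2; apply: eq_integrable.
move=> [mf If]; have [m1 m2] := mf.
split; apply/Lfun2P; split=> //; apply: le_integrable If => //.
- by apply/measurable_EFinP; exact: measurable_funX.
- move=> x _; rewrite /= lee_fin !ger0_norm ?sqr_ge0 ?nsq_ge0//.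
  by rewrite /nsq lerDl sqr_ge0.
- by apply/measurable_EFinP; exact: measurable_funX.
- move=> x _; rewrite /= lee_fin !ger0_norm ?sqr_ge0 ?nsq_ge0//.
  by rewrite /nsq lerDr sqr_ge0.
Qed.

Lemma L2_measurable f : L2 f -> cmeasurable f.
Proof. by case/L2P. Qed.

Lemma L2_integrable f : L2 f -> mu.-integrable setT (EFin \o (fun x => nsq (f x))).
Proof. by case/L2P. Qed.

Lemma le_L2 f (k : R -> R) : cmeasurable f ->
  mu.-integrable setT (EFin \o k) -> (forall x, nsq (f x) <= k x) -> L2 f.
Proof.
move=> mf ik fk; apply/L2P; split=> //; apply: le_integrable ik => //.
  exact/measurable_EFinP/measurable_nsq.
move=> x _; rewrite /= lee_fin ger0_norm ?nsq_ge0//.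
exact: le_trans (fk x) (ler_norm _).
Qed.

Lemma integrableZ_EFin (k : R -> R) (r : R) : mu.-integrable setT (EFin \o k) ->
  mu.-integrable setT (EFin \o (fun x => r * k x)).
Proof. by move=> ik; have := integrableZl measurableT r ik; apply: eq_integrable. Qed.

Lemma integrableD_EFin (k l : R -> R) : mu.-integrable setT (EFin \o k) ->
  mu.-integrable setT (EFin \o l) ->
  mu.-integrable setT (EFin \o (fun x => k x + l x)).
Proof. by move=> ik il; have := integrableD measurableT ik il; apply: eq_integrable. Qed.

Lemma L2D f g : L2 f -> L2 g -> L2 (fun x => f x + g x).
Proof.
move=> /L2P[mf If] /L2P[mg Ig].
apply: (@le_L2 _ (fun x => 2 * nsq (f x) + 2 * nsq (g x))).
- exact: cmeasurableD.
- by apply: integrableD_EFin; exact: integrableZ_EFin.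
- by move=> x; exact: nsqD.
Qed.

Lemma L2M f g (M : R) : L2 f -> cmeasurable g -> (forall x, nsq (g x) <= M) ->
  L2 (fun x => g x * f x).
Proof.
move=> /L2P[mf If] mg gM; apply: (@le_L2 _ (fun x => M * nsq (f x))).
- exact: cmeasurableM.
- exact: integrableZ_EFin.
- by move=> x; rewrite nsqM ler_wpM2r// nsq_ge0.
Qed.

Lemma L2Z f c : L2 f -> L2 (fun x => c * f x).
Proof.
by move=> Lf; apply: (@L2M f (cst c) (nsq c)) => //; exact: cmeasurable_cst.
Qed.

Lemma L2N f : L2 f -> L2 (fun x => - f x).
Proof. by move=> /(L2Z (-1)); under eq_fun do rewrite mulN1r. Qed.

Lemma L2B f g : L2 f -> L2 g -> L2 (fun x => f x - g x).
Proof. by move=> Lf Lg; apply: L2D => //; exact: L2N. Qed.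

Lemma L2J f : L2 f -> L2 (fun x => (f x)^*).
Proof.
move=> /L2P[mf If]; apply: (le_L2 _ If); first exact: cmeasurableJ.
by move=> x; rewrite nsqJ.
Qed.

Lemma L20 : L2 (fun=> 0 : C).
Proof.
apply: (@le_L2 _ (cst 0)); first exact: cmeasurable_cst.
  exact: integrable0.
by move=> x; rewrite nsq0.
Qed.

Lemma ae_L2 f g : cmeasurable g -> {ae mu, forall x, f x = g x} -> L2 f -> L2 g.
Proof.
move=> mg fg /L2P[mf If]; apply/L2P; split=> //.
have mnf := measurable_nsq mf; have mng := measurable_nsq mg.
apply/integrableP; split; first exact/measurable_EFinP.
move/integrableP : If => [_]; congr (_ < _)%E.
apply: ae_eq_integral => //.
- by apply: measurableT_comp => //; exact/measurable_EFinP.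
- by apply: measurableT_comp => //; exact/measurable_EFinP.
- by apply: (ae_imply _ fg) => x /= ->.
Qed.

Lemma L2_preserving f (phi : R -> R) :
  lebesgue_preserving phi -> L2 f -> L2 (fun x => f (phi x)).
Proof.
move=> pphi /L2P[mf If]; apply/L2P; split; first exact: preserving_cmeasurable.
exact: (integrable_preserving pphi If).
Qed.

Lemma L2_cintegrableM f g : L2 f -> L2 g -> cintegrable (fun x => f x * g x).
Proof.
move=> /L2P[mf If] /L2P[mg Ig].
apply: (@le_cintegrable _ _ (fun x => 2^-1 * (nsq (f x) + nsq (g x)))).
- exact: cmeasurableM.
- by apply: integrableZ_EFin; exact: integrableD_EFin.
- by move=> x; apply: le_trans (normc_mul_le _ _ ltr01) _; rewrite invr1 !mul1r.
Qed.

Lemma bounded_L2 f (M : R) : cintegrable f -> (forall x, normc (f x) <= M) -> L2 f.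
Proof.
move=> If fM; apply: (@le_L2 _ (fun x => M * normc (f x))).
- exact: cintegrable_measurable.
- exact/integrableZ_EFin/integrable_normc.
- by move=> x; rewrite -normc_sqr expr2 ler_wpM2r// normc_ge0.
Qed.

Definition n2 f : R := \int[mu]_x nsq (f x).

Lemma n2_ge0 f : 0 <= n2 f.
Proof. by apply: Rintegral_ge0 => x _; exact: nsq_ge0. Qed.

Lemma eq_n2 f g : f =1 g -> n2 f = n2 g.
Proof. by move=> fg; rewrite (_ : f = g)//; exact/funext. Qed.

Lemma L2norm_sqrE f : L2norm_sqr f = (\int[mu]_x (nsq (f x))%:E)%E.
Proof. by apply: eq_integral => x _; rewrite normc_sqr. Qed.

Lemma L2norm_sqr_n2 f : L2 f -> L2norm_sqr f = (n2 f)%:E.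
Proof.
move=> /L2P[_ If]; rewrite L2norm_sqrE /n2 fineK//.
exact: integrable_fin_num.
Qed.

Lemma L2norm_sqr_eq0 f : cmeasurable f -> L2norm_sqr f = 0%E ->
  {ae mu, forall x, f x = 0}.
Proof.
move=> mf; rewrite L2norm_sqrE => f0.
have : (\int[mu]_x `|(nsq (f x))%:E| = 0)%E.
  by rewrite -[RHS]f0; apply: eq_integral => x _; rewrite /= ger0_norm ?nsq_ge0.
move/ae_eq_integral_abs => /(_ measurableT) h.
apply: (ae_imply _ (h _)) => [x /(_ Logic.I)[]/nsq_eq0//|].
exact/measurable_EFinP/measurable_nsq.
Qed.

Lemma n2_eq0 f : L2 f -> n2 f = 0 -> {ae mu, forall x, f x = 0}.
Proof.
move=> Lf f0; apply: L2norm_sqr_eq0; first exact: L2_measurable.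
by rewrite L2norm_sqr_n2// f0.
Qed.

Lemma ae_n2 f g : cmeasurable f -> cmeasurable g ->
  {ae mu, forall x, f x = g x} -> n2 f = n2 g.
Proof.
move=> mf mg fg; congr fine; apply: ae_eq_integral => //.
- exact/measurable_EFinP/measurable_nsq.
- exact/measurable_EFinP/measurable_nsq.
- by apply: (ae_imply _ fg) => x /= ->.
Qed.

Lemma cint_mulJ f : cint (fun x => f x * (f x)^*) = (n2 f)%:C.
Proof. by under eq_cint do rewrite mulccJ; rewrite cint_real. Qed.

(** Continuity of the pairing in one L2 argument. It is the device by which identities proved for
    truncations pass to all of L2. *)
Lemma L2_cint_cvg (f_ : nat -> R -> C) f g : (forall n, L2 (f_ n)) -> L2 f ->
  L2 g -> n2 (fun x => f_ n x - f x) @[n --> \oo] --> 0 ->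
  ccvg (fun n => cint (fun x => f_ n x * g x)) (cint (fun x => f x * g x)).
Proof.
move=> Lf_ Lf Lg h.
suff H : (\int[mu]_x normc ((f_ n x - f x) * g x)) @[n --> \oo] --> 0.
  have E n : cint (fun x => f_ n x * g x) - cint (fun x => f x * g x) =
      cint (fun x => (f_ n x - f x) * g x).
    rewrite -cintB; [|exact: L2_cintegrableM..].
    by apply: eq_cint => x; rewrite mulrBl.
  have I n : cintegrable (fun x => (f_ n x - f x) * g x).
    by apply: L2_cintegrableM => //; exact: L2B.
  split; apply/cvgrPdist_lt => e e0;
    have /cvgrPdist_lt/(_ _ e0) := H; apply: filterS => n; rewrite sub0r normrN;
    apply: le_lt_trans; rewrite distrC; rewrite -?cReN -?cReD -?cImN -?cImD E;
    apply: le_trans (ler_norm _).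
  - exact: le_Re_cint.
  - exact: le_Im_cint.
apply/cvgrPdist_lt => e e0.
(* With this weight the term in [g] is at most [e], and the term in the difference falls below [e]
   for large [n]; Young's factor [2^-1] then leaves less than [e]. The [+ 1] keeps [t] positive when
   [g] vanishes. *)
pose t := (n2 g + 1) / e.
have t0 : 0 < t by rewrite divr_gt0// ltr_wpDl ?n2_ge0.
have et : 0 < e / t by rewrite divr_gt0.
have /cvgrPdist_lt/(_ _ et) := h; apply: filterS => n.
rewrite !sub0r !normrN => hn.
have Ln := L2B (Lf_ n) Lf.
rewrite ger0_norm; last by apply: Rintegral_ge0 => x _; exact: normc_ge0.
apply: (@le_lt_trans _ _ (2^-1 * (t * n2 (fun x => f_ n x - f x) + t^-1 * n2 g))).
  have In := L2_integrable Ln; have Ig := L2_integrable Lg.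
  have -> : 2^-1 * (t * n2 (fun x => f_ n x - f x) + t^-1 * n2 g) =
      \int[mu]_x (2^-1 * (t * nsq (f_ n x - f x) + t^-1 * nsq (g x))).
    rewrite RintegralZl//; last by apply: integrableD_EFin; exact: integrableZ_EFin.
    rewrite RintegralD//; try exact: integrableZ_EFin.
    by rewrite !RintegralZl.
  apply: le_Rintegral => //.
  - exact/integrable_normc/L2_cintegrableM.
  - by apply: integrableZ_EFin; apply: integrableD_EFin; exact: integrableZ_EFin.
  - by move=> x _; exact: normc_mul_le.
have h1 : t * n2 (fun x => f_ n x - f x) < e.
  by rewrite mulrC -ltr_pdivlMr//; apply: le_lt_trans hn; exact: ler_norm.
have h2 : t^-1 * n2 g <= e.
  rewrite /t invf_div mulrAC ler_pdivrMr ?ltr_wpDl ?n2_ge0//.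
  by rewrite ler_wpM2l ?lerDl// ltW.
lra.
Qed.

Definition cindic (A : set R) : R -> C := fun x => (\1_A x)%:C.

Lemma cmeasurable_cindic (A : set R) : measurable A -> cmeasurable (cindic A).
Proof. by move=> mA; apply: cmeasurable_real; exact: measurable_indic. Qed.

Lemma nsq_real (r : R) : nsq r%:C = r ^+ 2.
Proof. by rewrite /nsq /= expr0n addr0. Qed.

Lemma nsq_cindic (A : set R) x : nsq (cindic A x) = \1_A x.
Proof. by rewrite nsq_real indicE; case: (x \in A); rewrite ?expr1n ?expr0n. Qed.

Lemma normc_cindic (A : set R) x : normc (cindic A x) = \1_A x.
Proof. by rewrite normc_real indicE ger0_norm. Qed.

Lemma indic_le1 (A : set R) (x : R) : \1_A x <= 1 :> R.
Proof. by rewrite indicE; case: (x \in A). Qed.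

Lemma L2_cindicM (A : set R) f : measurable A -> L2 f -> L2 (fun x => cindic A x * f x).
Proof.
move=> mA Lf; apply: (L2M Lf (cmeasurable_cindic mA)) => x.
by rewrite nsq_cindic; exact: indic_le1.
Qed.

Lemma cintegrable_cindicM (A : set R) f : measurable A -> cintegrable f ->
  cintegrable (fun x => cindic A x * f x).
Proof.
move=> mA If; apply: (cintegrableM If (cmeasurable_cindic mA)) => x.
by rewrite normc_cindic; exact: indic_le1.
Qed.

Lemma integrable_indic_segment (a b : R) :
  mu.-integrable setT (EFin \o (\1_`[a, b] : R -> R)).
Proof. exact: integrable_indic_itv. Qed.

Lemma L2_cindic_segment (a b : R) : L2 (cindic `[a, b]).
Proof.
apply: (le_L2 _ (integrable_indic_segment a b)).
  exact: cmeasurable_cindic.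
by move=> x; rewrite nsq_cindic.
Qed.

Lemma cintegrable_cindic_segment (a b : R) : cintegrable (cindic `[a, b]).
Proof.
apply: (le_cintegrable _ (integrable_indic_segment a b)).
  exact: cmeasurable_cindic.
by move=> x; rewrite normc_cindic.
Qed.

Lemma L2_cintegrable_segment f (a b : R) : L2 f ->
  cintegrable (fun x => cindic `[a, b] x * f x).
Proof. by move=> Lf; apply: L2_cintegrableM => //; exact: L2_cindic_segment. Qed.

Lemma integralC_cindic (A : set R) f : integralC A f = cint (fun x => cindic A x * f x).
Proof.
apply: complexP; rewrite /= Rintegral_mkcond; apply: eq_Rintegral => x _;
  rewrite patchE !ReImE /= indicE; case: (x \in A);
  by rewrite ?mul1r !mul0r ?subr0 ?addr0.
Qed.

Definition trunc f (n : nat) : R -> C := fun x => cindic `[- n%:R, n%:R] x * f x.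

Lemma trunc_L2 f n : L2 f -> L2 (trunc f n).
Proof. by move=> Lf; exact: L2_cindicM. Qed.

Lemma trunc_cintegrable f n : L2 f -> cintegrable (trunc f n).
Proof. by move=> Lf; exact: L2_cintegrable_segment. Qed.

Lemma indic_segment_cvg (x : R) : (\1_`[- n%:R, n%:R] x : R) @[n --> \oo] --> (1 : R).
Proof.
apply: cvg_near_cst; near=> n.
rewrite indicE mem_set//= in_itv/= -ler_norml.
near: n; exact: nbhs_infty_ger.
Unshelve. all: by end_near. Qed.

Lemma trunc_n2_cvg f : L2 f -> n2 (fun x => trunc f n x - f x) @[n --> \oo] --> 0.
Proof.
move=> Lf; have If := L2_integrable Lf.
have E n x : nsq (trunc f n x - f x) = (\1_`[- n%:R, n%:R] x - 1) ^+ 2 * nsq (f x).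
  rewrite /trunc -[X in _ - X]mul1r -mulrBl nsqM; congr (_ * _).
  by rewrite /nsq /= subr0 expr0n addr0.
have [H _] : ccvg (fun n => cint (fun x => (nsq (trunc f n x - f x))%:C)) (cint (fun=> 0)).
  apply: (@cint_dominated _ _ _ (fun x => nsq (f x))) => //.
  - move=> n; apply: cmeasurable_real; apply: measurable_nsq.
    by apply: L2_measurable; apply: L2B => //; exact: trunc_L2.
  - move=> x; split=> /=; last exact: cvg_cst.
    under eq_fun do rewrite E expr2.
    have h : (\1_`[- n%:R, n%:R] x - 1 : R) @[n --> \oo] --> (1 - 1 : R).
      by apply: cvgB; [exact: indic_segment_cvg|exact: cvg_cst].
    have : ((\1_`[- n%:R, n%:R] x - 1) * (\1_`[- n%:R, n%:R] x - 1) * nsq (f x))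
        @[n --> \oo] --> (1 - 1) * (1 - 1) * nsq (f x).
      by apply: cvgM; [exact: cvgM|exact: cvg_cst].
    by rewrite subrr !mul0r.
  - move=> n x; rewrite normc_real ger0_norm ?nsq_ge0// E ler_piMl ?nsq_ge0//.
    rewrite indicE.
    by case: (_ \in _); rewrite ?subrr ?expr0n// sub0r sqrrN expr1n.
by move: H; rewrite cint0.
Qed.

End SquareIntegrable.

(** Fatou's lemma as a device for upper bounds: a bound common to all [k] survives a pointwise limit
    whose integrability is not yet known. *)
Lemma fatou_le {R : realType} (F : nat -> R -> R) (f : R -> R) (c : \bar R) :
  (forall k, measurable_fun setT (F k)) -> (forall k x, 0 <= F k x) ->
  (forall x, F k x @[k --> \oo] --> f x) ->
  (forall k, (\int[lebesgue_measure]_x (F k x)%:E <= c)%E) ->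
  (\int[lebesgue_measure]_x (f x)%:E <= c)%E.
Proof.
move=> mF F0 Ff Fc.
pose G k x := (F k x)%:E.
have mG k : measurable_fun setT (G k) by exact/measurable_EFinP.
have G0 k x : setT x -> (0 <= G k x)%E by move=> _; rewrite lee_fin.
have := @fatou _ (measurableTypeR R) R lebesgue_measure setT measurableT G mG G0.
rewrite (_ : (\int[lebesgue_measure]_x limn_einf (G ^~ x) =
    \int[lebesgue_measure]_x (f x)%:E)%E); last first.
  apply: eq_integral => x _.
  have c1 : (G ^~ x) @ \oo --> (f x)%:E by apply: cvg_EFin; [exact: nearW|exact: Ff].
  by rewrite is_cvg_limn_einfE; [exact: cvg_lim|apply/cvg_ex; eexists; exact: c1].
move=> /le_trans; apply.
rewrite limn_einf_lim; apply: lime_le; first exact: is_cvg_einfs.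
apply: nearW => k; apply: le_trans (Fc k).
by apply: ereal_inf_lbound; exists k => /=.
Qed.

(** * Completeness of real L2 *)

Section RieszFischer.
Context {R : realType}.
Local Notation mu := (@lebesgue_measure R).
Local Notation T := (measurableTypeR R).
Variables (g_ : nat -> R -> R) (a : nat -> R).
Hypothesis mg_ : forall n, measurable_fun setT (g_ n).
Hypothesis a_cvg : a n @[n --> \oo] --> 0.
Hypothesis g_a : forall n m, (n <= m)%N ->
  (\int[mu]_x ((g_ m x - g_ n x) ^+ 2)%:E <= (a n)%:E)%E.

(** The later series carries the weight [2 ^ k], so this rate leaves a term at most
    [1 / 2 ^ (k + 1)], which is summable. *)
Let fast_subsequence : exists sigma : nat -> nat,
  [/\ forall k, (k <= sigma k)%N, forall k, (sigma k <= sigma k.+1)%N &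
      forall k, a (sigma k) <= (2 ^ k * 2 ^ k.+1)%:R^-1].
Proof.
have /choice[N HN] : forall k, exists N, forall n, (N <= n)%N ->
    a n <= (2 ^ k * 2 ^ k.+1)%:R^-1.
  move=> k.
  have e0 : 0 < (2 ^ k * 2 ^ k.+1)%:R^-1 :> R.
    by rewrite invr_gt0 ltr0n muln_gt0 !expn_gt0.
  have /cvgrPdist_lt/(_ _ e0)[N _ HN] := a_cvg.
  exists N => n Nn; have := HN n Nn; rewrite /= sub0r normrN => h.
  exact: le_trans (ler_norm _) (ltW h).
(* Adding up the [(N j).+1] makes the index nondecreasing, at least [k] and at least [N k] by one
   formula. *)
exists (fun k => \sum_(j < k.+1) (N j).+1)%N; split.
- elim=> [//|k ih]; rewrite big_ord_recr/=.
  by rewrite -[X in (X <= _)%N]addn1 leq_add.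
- by move=> k; rewrite [leqRHS]big_ord_recr/= leq_addr.
- move=> k; apply: HN; rewrite big_ord_recr/= addnS.
  by apply: leqW; exact: leq_addl.
Qed.

(* A fast subsequence satisfies [\sum_k 2^k * |g_(k+1) - g_k|^2 < oo] almost
   everywhere, and [|d| <= 2^-k + 2^k * d^2] makes it converge there. *)
Lemma riesz_fischer : exists2 g : R -> R, measurable_fun setT g &
  forall n, (\int[mu]_x ((g x - g_ n x) ^+ 2)%:E <= (a n)%:E)%E.
Proof.
have [sigma [sigma_ge sigma_mono a_sigma]] := fast_subsequence.
pose d k x := g_ (sigma k.+1) x - g_ (sigma k) x.
pose s k x := (2 ^+ k * d k x ^+ 2)%:E.
have md k : measurable_fun setT (d k) by exact: measurable_funB.
have ms k : measurable_fun setT (s k).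
  apply/measurable_EFinP; apply: measurable_funM => //.
  by apply: measurable_funX; exact: measurable_funB.
have s0 k x : (0 <= s k x)%E by rewrite /s lee_fin; apply: mulr_ge0; [exact: exprn_ge0|exact: sqr_ge0].
pose S x := (\sum_(k <oo) s k x)%E.
have mS : measurable_fun setT S.
  by apply: (@ge0_emeasurable_sum _ T R setT s xpredT) => *; [exact: s0|exact: ms].
have S0 x : (0 <= S x)%E by exact: nneseries_ge0.
have intS : (\int[mu]_x S x < +oo)%E.
  rewrite (@integral_nneseries _ T R mu setT)//.
  apply: (@le_lt_trans _ _ (\sum_(k <oo) (1 / (2 ^ (k + 1))%:R)%:E)%E).
    apply: lee_nneseries => [k _ _|k _].
      by apply: integral_ge0 => x _.
    rewrite (_ : (\int[mu]_x s k x = (2 ^+ k)%:E * \int[mu]_x ((d k x) ^+ 2)%:E)%E); last first.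
      under eq_integral do rewrite /s EFinM.
      rewrite (@ge0_integralZl_EFin _ T)//.
      - by move=> x _; rewrite lee_fin sqr_ge0.
      - by apply/measurable_EFinP; exact: measurable_funX (md k).
    apply: (@le_trans _ _ ((2 ^+ k)%:E * (a (sigma k))%:E)%E).
      by apply: lee_wpmul2l; [rewrite lee_fin exprn_ge0|exact: g_a].
    rewrite -EFinM lee_fin mul1r.
    apply: le_trans (ler_wpM2l _ (a_sigma k)) _; first exact: exprn_ge0.
    rewrite natrM invfM mulrA natrX divff ?mul1r ?addn1//.
  rewrite (cvg_lim _ (@cvg_geometric_eseries_half R 1 0))//.
  exact: ltry.
pose E := [set x | (S x < +oo)%E].
have mE : measurable E.
  by rewrite /E -[X in measurable X]setTI; exact: emeasurable_fun_infty_o.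
have aeE : {ae mu, forall x, E x}.
  have iS : mu.-integrable setT S.
    apply/integrableP; split => //.
    by under eq_integral do rewrite gee0_abs//.
  have := @integrable_ae _ T R mu setT measurableT S iS.
  by apply: ae_imply => x /(_ Logic.I); rewrite /E/= ltey_eq => ->.
have cvgE x : E x -> cvgn (fun k => g_ (sigma k) x).
  move=> Ex.
  have Sfin : S x \is a fin_num by rewrite ge0_fin_numE.
  have cd : cvgn (series (fun k => d k x)).
    apply: normed_cvg; apply: nondecreasing_is_cvgn.
      by apply: nondecreasing_series => k _ _; exact: normr_ge0.
    exists (2 + fine (S x)) => _ [n _ <-].
    apply: (@le_trans _ _ (\sum_(0 <= k < n) (2^-1 ^+ k + 2 ^+ k * d k x ^+ 2))).
      apply: ler_sum => k _ /=.
      set t := 2^-1 ^+ k.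
      have t0 : 0 < t by rewrite exprn_gt0.
      have -> : 2 ^+ k = t^-1 :> R by rewrite /t -exprVn invrK.
      rewrite -(real_normK (num_real (d k x))); set r := `|_|.
      have r0 : 0 <= r by exact: normr_ge0.
      rewrite -(ler_pM2l t0) mulrDr mulrA divff ?gt_eqF// mul1r.
      have := sqr_ge0 (t - r); have := mulr_ge0 (ltW t0) r0.
      rewrite !expr2; nra.
    rewrite big_split/= lerD//.
      have -> : \sum_(0 <= k < n) 2^-1 ^+ k = series (geometric 1 (2^-1 : R)) n.
        by rewrite seriesEnat; apply: eq_bigr => k _; rewrite /= mul1r.
      rewrite geometric_seriesE; last by rewrite lt_eqF// invf_lt1// ltr1n.
      rewrite ler_pdivrMr; last by rewrite subr_gt0 invf_lt1// ltr1n.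
      have : 0 <= (2^-1 : R) ^+ n by rewrite exprn_ge0.
      lra.
    rewrite -lee_fin fineK// -sumEFin.
    exact: (@nneseries_lim_ge R (s ^~ x) xpredT 0%N n (fun k _ _ => s0 k x)).
  have E2 : (fun k => g_ (sigma k) x) =
      (fun k => g_ (sigma 0%N) x + series (fun k => d k x) k).
    apply/funext => k; rewrite seriesEnat/= telescope_sumr//.
    by rewrite addrC subrK.
  rewrite E2; apply: is_cvgD => //; exact: is_cvg_cst.
(* Cutting off outside [E] makes the sequence converge at every point, so that the limit is
   measurable as it stands. *)
pose h k x := \1_E x * g_ (sigma k) x.
pose g x := limn (fun k => h k x).
have h_cvg x : h k x @[k --> \oo] --> g x.
  rewrite /g /h indicE; case: (boolP (x \in E)) => [|_].
    rewrite inE => Ex; under eq_fun do rewrite mul1r; exact: cvgE.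
  by under eq_fun do rewrite mul0r; exact: is_cvg_cst.
have mh k : measurable_fun setT (h k).
  by apply: measurable_funM => //; exact: measurable_indic.
have mg : measurable_fun setT g.
  by apply: (measurable_fun_cvg (h := h)) => // x _.
exists g => // n.
have mB m : measurable_fun setT (fun x => ((g_ m x - g_ n x) ^+ 2)%:E).
  apply/measurable_EFinP; apply: measurable_funX; exact: measurable_funB.
(* The shift by [n] guarantees [n <= sigma (k + n)], hence [g_a] bounds every term of the
   sequence. *)
apply: (@fatou_le _ (fun k x => (h (k + n)%N x - g_ n x) ^+ 2)) => //.
- by move=> k; apply: measurable_funX; exact: measurable_funB.
- by move=> k x; exact: sqr_ge0.
- move=> x.
  have c1 : h (k + n)%N x - g_ n x @[k --> \oo] --> g x - g_ n x.
    apply: cvgB; last exact: cvg_cst.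
    by rewrite (cvg_shiftn n (fun k => h k x)).
  exact: (cvgM c1 c1).
move=> k.
have mhB : measurable_fun setT (fun x => ((h (k + n)%N x - g_ n x) ^+ 2)%:E).
  by apply/measurable_EFinP; apply: measurable_funX; exact: measurable_funB.
have kn : (n <= sigma (k + n))%N by apply: leq_trans (sigma_ge _); exact: leq_addl.
apply: le_trans (g_a kn); rewrite le_eqVlt; apply/orP; left; apply/eqP.
apply: ae_eq_integral => //; first exact: mB.
by apply: (ae_imply _ aeE) => x Ex _; rewrite /h indicE mem_set// mul1r.
Qed.

End RieszFischer.

(** * The Fourier transform *)

Section Calculus.
Context {R : realType}.
Local Notation mu := (@lebesgue_measure R).
Implicit Types f F : R -> R.

Lemma is_derive_continuous F f : (forall x : R, is_derive x (1 : R) F (f x)) ->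
  continuous F.
Proof.
move=> dF x; apply: differentiable_continuous; apply/derivable1_diffP.
by have [] := dF x.
Qed.

Lemma Rintegral_FTC F f (a b : R) : a <= b ->
  (forall x : R, is_derive x (1 : R) F (f x)) -> continuous f ->
  \int[mu]_(x in `[a, b]) f x = F b - F a.
Proof.
rewrite le_eqVlt => /predU1P[<- _ _|ab dF cf].
  by rewrite set_itv1 Rintegral_set1 subrr.
have cF := is_derive_continuous dF.
rewrite /Rintegral (@continuous_FTC2 _ f F)//.
- exact: continuous_subspaceT.
- split.
  + by move=> x _; have [] := dF x.
  + by apply: cvg_at_right_filter; exact: cF.
  + by apply: cvg_at_left_filter; exact: cF.
- by move=> x _; rewrite derive1E; exact: derive_val.
Qed.

Lemma integrable_continuous_segment f (a b : R) : continuous f ->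
  mu.-integrable `[a, b] (EFin \o f).
Proof.
move=> cf; apply: continuous_compact_integrable; first exact: segment_compact.
exact: continuous_subspaceT.
Qed.

End Calculus.

(** * Transforms of one-sided and two-sided exponentials *)

Section Exponential.
Context {R : realType}.
Local Open Scope complex_scope.
Local Notation C := R[i].
Local Notation mu := (@lebesgue_measure R).
Variable eps : R.
Hypothesis eps0 : 0 < eps.

Definition halfexp (x : R) : R := \1_`[0, +oo[ x * expR (- (eps * x)).

Lemma continuous_expRZ : continuous (fun x => expR (- (eps * x))).
Proof.
move=> x; apply: (@continuous_comp _ _ _ (fun x => - (eps * x)) expR).
  by apply: cvgN; apply: cvgM; [exact: cvg_cst|exact: cvg_id].
exact: continuous_expR.
Qed.

Lemma integrable_halfexp : mu.-integrable setT (EFin \o halfexp).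
Proof.
have := integrableZ_EFin eps^-1 (integrable_exponential_pdf eps0).
apply: eq_integrable => // x _; rewrite /= /halfexp /exponential_pdf patchE indicE.
case: (x \in _); last by rewrite mulr0 mul0r.
by rewrite mulrA mulVf ?gt_eqF// mulNr.
Qed.

Lemma halfexp_ge0 x : 0 <= halfexp x.
Proof. by rewrite /halfexp mulr_ge0// expR_ge0. Qed.

Lemma cvg_expRn : expR (- (eps * n%:R)) @[n --> \oo] --> (0 : R).
Proof.
under eq_fun do rewrite -mulNr expRM_natr.
by apply: cvg_expr; rewrite ger0_norm ?expR_ge0// expR_lt1 oppr_lt0.
Qed.

Lemma nsq_eps_neq0 x : eps ^+ 2 + x ^+ 2 != 0.
Proof. by rewrite gt_eqF// ltr_wpDr ?sqr_ge0// exprn_gt0. Qed.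

(** This is [1 / (eps + i x)] in Cartesian form. *)
Definition halfexp_ft (x : R) : C :=
  (eps / (eps ^+ 2 + x ^+ 2)) +i* (- x / (eps ^+ 2 + x ^+ 2)).

(** With [Gs], the real and imaginary parts of [- exp (- (eps + i x) xi) / (eps + i x)], a primitive
    of the integrand on the half-line. *)
Let Gc x (xi : R) := expR (- (eps * xi)) *
  (x * sin (x * xi) - eps * cos (x * xi)) / (eps ^+ 2 + x ^+ 2).

Let Gs x (xi : R) := expR (- (eps * xi)) *
  (eps * sin (x * xi) + x * cos (x * xi)) / (eps ^+ 2 + x ^+ 2).

Let dGc x (xi : R) : is_derive xi (1 : R) (Gc x) (expR (- (eps * xi)) * cos (x * xi)).
Proof.
rewrite /Gc; apply: is_derive_eq.
rewrite /GRing.scale/= !(mulr0, mul0r, addr0, add0r, mulr1).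
have := nsq_eps_neq0 x => h; field.
exact: h.
Qed.

Let dGs x (xi : R) : is_derive xi (1 : R) (Gs x) (- (expR (- (eps * xi)) * sin (x * xi))).
Proof.
rewrite /Gs; apply: is_derive_eq.
rewrite /GRing.scale/= !(mulr0, mul0r, addr0, add0r, mulr1).
have := nsq_eps_neq0 x => h; field.
exact: h.
Qed.

Lemma cvg_bounded_expRn (k : R -> R) (M : R) : (forall x, `|k x| <= M) ->
  expR (- (eps * n%:R)) * k n%:R @[n --> \oo] --> (0 : R).
Proof.
move=> kM; apply/norm_cvg0P.
apply: (@squeeze_cvgr _ _ _ _ (cst 0) (fun n => expR (- (eps * n%:R)) * M)).
- apply: nearW => n; rewrite normr_ge0/= normrM ger0_norm ?expR_ge0//.
  by rewrite ler_wpM2l// expR_ge0.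
- exact: cvg_cst.
- by rewrite -(mul0r M); apply: cvgM; [exact: cvg_expRn|exact: cvg_cst].
Qed.

(** The integrals over [[0, n]] have two limits to compare: the half-line integral, by dominated
    convergence, and minus the primitive at 0, because the primitive decays at infinity. *)
Lemma cint_halfexp x :
  cint (fun xi => expi (- (xi * x)) * (halfexp xi)%:C) = halfexp_ft x.
Proof.
pose f_ n xi : C := expi (- (xi * x)) * (\1_`[0, n%:R] xi * expR (- (eps * xi)))%:C.
have mexp : measurable_fun setT (fun xi : R => expR (- (eps * xi))).
  by apply: continuous_measurable_fun; exact: continuous_expRZ.
have mchr : cmeasurable (fun xi : R => expi (- (xi * x)) : C).
  apply: cmeasurable_expi; apply: measurableT_comp => //.
  by apply: measurable_funM.
have cvg1 : ccvg (fun n => cint (f_ n))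
    (cint (fun xi => expi (- (xi * x)) * (halfexp xi)%:C)).
  apply: (@cint_dominated _ _ _ halfexp) => //.
  - move=> n; apply: cmeasurableM => //; apply: cmeasurable_real.
    by apply: measurable_funM => //; exact: measurable_indic.
  - apply: cmeasurableM => //; apply: cmeasurable_real.
    by apply: measurable_funM => //; exact: measurable_indic.
  - move=> xi; rewrite /f_ /halfexp.
    have : (\1_`[0, n%:R] xi : R) @[n --> \oo] --> (\1_`[0, +oo[ xi : R).
      apply: cvg_near_cst; near=> n.
      rewrite !indicE; congr (nat_of_bool _)%:R; apply/idP/idP; rewrite !inE/= !in_itv/= andbT.
        by move/andP => [].
      by move=> ->; near: n; exact: nbhs_infty_ger.
    move=> c1; apply: ccvgM; first exact: ccvg_cst.
    by split=> /=; [apply: cvgM => //; exact: cvg_cst|exact: cvg_cst].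
  - exact: integrable_halfexp.
  - move=> n xi; rewrite normcM normc_expi mul1r normc_real normrM.
    rewrite !ger0_norm ?expR_ge0// ler_wpM2r ?expR_ge0//.
    rewrite !indicE ler_nat; apply: (@leq_trans (xi \in `[0, +oo[)%classic) => //.
    case: (boolP (xi \in `[0, n%:R]%classic)) => // /set_mem/=.
    by rewrite in_itv/= => /andP[h _]; rewrite mem_set//= in_itv/= h.
apply: (ccvg_unique cvg1).
have E (g : R -> R) (n : nat) : \int[mu]_x (\1_`[0, n%:R] x * g x) =
    \int[mu]_(x in `[0%R, n%:R]) g x.
  rewrite [RHS]Rintegral_mkcond; apply: eq_Rintegral => y _.
  by rewrite patchE indicE; case: (_ \in _); rewrite ?mul1r ?mul0r.
have kb (k l : R) y : `|(k * sin (x * y) + l * cos (x * y)) / (eps ^+ 2 + x ^+ 2)| <=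
    (`|k| + `|l|) / `|eps ^+ 2 + x ^+ 2|.
  rewrite normrM normfV ler_wpM2r// ?invr_ge0//.
  apply: (le_trans (ler_normD _ _)); rewrite !normrM lerD// ler_piMr//.
    by rewrite ler_norml sin_geN1 sin_le1.
  by rewrite ler_norml cos_geN1 cos_le1.
split.
- have -> : complex.Re (halfexp_ft x) = 0 - Gc x 0.
    rewrite /Gc /= !mulr0 oppr0 expR0 sin0 cos0.
    by field; exact: nsq_eps_neq0.
  have -> : (fun n => complex.Re (cint (f_ n))) = (fun n => Gc x n%:R - Gc x 0).
    apply/funext => n; rewrite Re_cint.
    rewrite -(@Rintegral_FTC _ _ _ 0 n%:R _ (dGc x))//; last first.
      move=> y; apply: cvgM; first exact: continuous_expRZ.
      apply: (@continuous_comp _ _ _ (fun y => x * y) cos); last exact: continuous_cos.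
      by apply: cvgM; [exact: cvg_cst|exact: cvg_id].
    rewrite -E; apply: eq_Rintegral => y _.
    by rewrite /f_ cReM /= cosN mulr0 subr0 (mulrC y x); ring.
  apply: cvgB; last exact: cvg_cst.
  under eq_fun do rewrite /Gc -mulrA.
  apply: (@cvg_bounded_expRn
    (fun y => (x * sin (x * y) - eps * cos (x * y)) / (eps ^+ 2 + x ^+ 2))) => y.
  by rewrite -mulNr; exact: kb.
- have -> : complex.Im (halfexp_ft x) = 0 - Gs x 0.
    rewrite /Gs /= !mulr0 oppr0 expR0 sin0 cos0.
    by field; exact: nsq_eps_neq0.
  have -> : (fun n => complex.Im (cint (f_ n))) = (fun n => Gs x n%:R - Gs x 0).
    apply/funext => n; rewrite Im_cint.
    rewrite -(@Rintegral_FTC _ _ _ 0 n%:R _ (dGs x))//; last first.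
      move=> y; apply: cvgN; apply: cvgM; first exact: continuous_expRZ.
      apply: (@continuous_comp _ _ _ (fun y => x * y) sin); last exact: continuous_sin.
      by apply: cvgM; [exact: cvg_cst|exact: cvg_id].
    rewrite -E; apply: eq_Rintegral => y _.
    by rewrite /f_ cImM /= sinN mulr0 add0r (mulrC y x); ring.
  apply: cvgB; last exact: cvg_cst.
  under eq_fun do rewrite /Gs -mulrA.
  exact: (cvg_bounded_expRn (k := fun y => (eps * sin (x * y) + x * cos (x * y)) / (eps ^+ 2 + x ^+ 2)) (kb _ _)).
Unshelve. all: by end_near. Qed.

Definition absexp (x : R) : R := expR (- (eps * `|x|)).

Lemma absexp_gt0 x : 0 < absexp x.
Proof. exact: expR_gt0. Qed.

Lemma absexp_le1 x : absexp x <= 1.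
Proof. by rewrite expR_le1 oppr_le0 mulr_ge0// ltW. Qed.

Lemma measurable_absexp : measurable_fun setT absexp.
Proof.
apply: measurableT_comp => //; apply: measurableT_comp => //.
by apply: measurable_funM => //; exact: measurableT_comp.
Qed.

(** At 0 both one-sided exponentials equal 1, so the sum would count that point twice. *)
Lemma absexp_halfexp (x : R) : x != 0 -> absexp x = halfexp x + halfexp (- x).
Proof.
have ind (y : R) : (\1_`[0%R, +oo[ y : R) = (0 <= y)%R%:R.
  by rewrite indicE; congr (nat_of_bool _)%:R; apply/idP/idP; rewrite inE/= in_itv/= andbT.
rewrite neq_lt /absexp /halfexp !ind oppr_ge0 => /orP[x0|x0].
- by rewrite ltr0_norm// (ltW x0) leNgt x0 mul0r add0r mul1r.
- by rewrite gtr0_norm// (ltW x0) leNgt x0 mul0r addr0 mul1r.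
Qed.

Lemma ae_absexp : {ae mu, forall x, (absexp x)%:C = (halfexp x)%:C + (halfexp (- x))%:C}.
Proof.
exists [set 0]; split => //; first exact: lebesgue_measure_set1.
move=> x /= h; apply: contrapT => /eqP x0; apply: h.
by rewrite absexp_halfexp// rmorphD.
Qed.

Lemma cintegrable_halfexp : cintegrable (fun x => (halfexp x)%:C).
Proof.
apply: (le_cintegrable _ integrable_halfexp).
  apply: cmeasurable_real.
  by have /measurable_int/measurable_EFinP := integrable_halfexp.
by move=> x; rewrite normc_real ger0_norm// halfexp_ge0.
Qed.

Lemma cintegrable_halfexpN : cintegrable (fun x => (halfexp (- x))%:C).
Proof. exact: (cintegrable_preserving (@opp_preserving R) cintegrable_halfexp). Qed.

Lemma cintegrable_absexp : cintegrable (fun x => (absexp x)%:C).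
Proof.
apply: (@ae_cintegrable _ (fun x => (halfexp x)%:C + (halfexp (- x))%:C)).
- apply: cmeasurable_real; exact: measurable_absexp.
- by apply: (ae_imply _ ae_absexp).
- by apply: cintegrableD; [exact: cintegrable_halfexp|exact: cintegrable_halfexpN].
Qed.

(** [2 * pi] times the normalised Poisson kernel of the half-plane at height [eps]; it is the
    transform of [absexp]. *)
Definition poisson (t : R) : R := 2 * eps / (eps ^+ 2 + t ^+ 2).

(** Reflection exchanges the two halves and conjugates the transform, so the sum is twice the real
    part of [1 / (eps + i x)]. *)
Lemma cint_absexp x :
  cint (fun xi => expi (- (xi * x)) * (absexp xi)%:C) = (poisson x)%:C.
Proof.
have mchr y : cmeasurable (fun xi : R => expi (- (xi * y)) : C).
  apply: cmeasurable_expi; apply: measurableT_comp => //.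
  by apply: measurable_funM.
have I y (f : R -> C) : cintegrable f -> cintegrable (fun xi => expi (- (xi * y)) * f xi).
  by move=> If; apply: (cintegrableM (M := 1) If) => // z; rewrite normc_expi.
rewrite (@ae_eq_cint _ _ (fun xi => expi (- (xi * x)) * (halfexp xi)%:C +
   expi (- (xi * x)) * (halfexp (- xi))%:C)); last first.
- by apply: (ae_imply _ ae_absexp) => y ->; rewrite mulrDr.
- apply: cmeasurableD; apply: cintegrable_measurable; apply: I.
    exact: cintegrable_halfexp.
  exact: cintegrable_halfexpN.
- by apply: cmeasurableM => //; apply: cmeasurable_real; exact: measurable_absexp.
rewrite cintD; [|apply: I; exact: cintegrable_halfexp|apply: I; exact: cintegrable_halfexpN].
rewrite cint_halfexp.
have -> : cint (fun xi => expi (- (xi * x)) * (halfexp (- xi))%:C) = halfexp_ft (- x).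
  rewrite -cint_halfexp -(cint_preserving (@opp_preserving R)); last first.
    by apply: I; exact: cintegrable_halfexpN.
  by apply: eq_cint => y; rewrite opprK mulNr mulrN.
apply: complexP; rewrite /= /poisson sqrrN; field; exact: nsq_eps_neq0.
Qed.

End Exponential.

(** * Mass of the Poisson kernel *)

Section PoissonKernel.
Context {R : realType}.
Local Notation mu := (@lebesgue_measure R).
Variable eps : R.
Hypothesis eps0 : 0 < eps.

Lemma poisson_ge0 t : 0 <= poisson eps t.
Proof.
rewrite /poisson mulr_ge0//; first by rewrite mulr_ge0// ltW.
by rewrite invr_ge0 addr_ge0// sqr_ge0.
Qed.

Lemma poissonN t : poisson eps (- t) = poisson eps t.
Proof. by rewrite /poisson sqrrN. Qed.

Lemma is_derive_poisson (x : R) :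
  is_derive x (1 : R) (fun t => 2 * atan (t / eps)) (poisson eps x).
Proof.
apply: is_derive_eq.
rewrite /GRing.scale/= !(mulr0, mul0r, addr0, add0r, mulr1) /poisson.
field; rewrite nsq_eps_neq0//= gt_eqF//.
Qed.

Lemma continuous_poisson : continuous (poisson eps).
Proof.
move=> x; apply: cvgM; first exact: cvg_cst.
apply: cvgV; first exact: nsq_eps_neq0.
by apply: cvgD; [exact: cvg_cst|apply: cvgM; exact: cvg_id].
Qed.

Lemma measurable_poisson : measurable_fun setT (poisson eps).
Proof. by apply: continuous_measurable_fun; exact: continuous_poisson. Qed.

Lemma integral_segment_poisson (a b : R) : a <= b ->
  \int[mu]_(t in `[a, b]) poisson eps t = 2 * atan (b / eps) - 2 * atan (a / eps).
Proof.
move=> ab; apply: (@Rintegral_FTC _ (fun t => 2 * atan (t / eps))) => //.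
- exact: is_derive_poisson.
- exact: continuous_poisson.
Qed.

(** On each segment [[- k, k]] the integral is a difference of two values of [2 * atan], at most
    [2 * pi]; Fatou removes the cutoff. *)
Lemma integral_poisson : (\int[mu]_t (poisson eps t)%:E <= (2 * pi)%:E)%E.
Proof.
pose F (k : nat) t := \1_`[- k%:R, k%:R] t * poisson eps t.
apply: (@fatou_le _ F) => [k|k t|t|k].
- by apply: measurable_funM; [exact: measurable_indic|exact: measurable_poisson].
- by rewrite /F mulr_ge0// poisson_ge0.
- rewrite -[X in _ --> X]mul1r; apply: cvgM; last exact: cvg_cst.
  exact: indic_segment_cvg.
have iP : mu.-integrable `[- k%:R, k%:R] (EFin \o poisson eps).
  by apply: integrable_continuous_segment; exact: continuous_poisson.
have -> : (\int[mu]_t (F k t)%:E = (\int[mu]_(t in `[- k%:R, k%:R]) poisson eps t)%:E)%E.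
  rewrite fineK; last exact: integrable_fin_num.
  rewrite [RHS]integral_mkcond; apply: eq_integral => t _.
  by rewrite patchE /F indicE; case: (_ \in _); rewrite ?mul1r ?mul0r.
rewrite integral_segment_poisson; last by rewrite (@le_trans _ _ 0)// ?oppr_le0.
rewrite lee_fin; have := @atan_ltpi2 R (k%:R / eps).
have := @atan_gtNpi2 R (- k%:R / eps); lra.
Qed.

Lemma integrable_poisson : mu.-integrable setT (EFin \o poisson eps).
Proof.
apply/integrableP; split; first by apply/measurable_EFinP; exact: measurable_poisson.
under eq_integral do rewrite /= ger0_norm ?poisson_ge0//.
exact: le_lt_trans integral_poisson (ltry _).
Qed.

Lemma shift_integral_poisson x :
  (\int[mu]_y (poisson eps (y - x))%:E <= (2 * pi)%:E)%E.
Proof.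
rewrite (@ge0_integral_preserving _ _ (shift_preserving (- x)) (EFin \o poisson eps)).
- exact: integral_poisson.
- by apply/measurable_EFinP; exact: measurable_poisson.
- by move=> y; rewrite lee_fin poisson_ge0.
Qed.

End PoissonKernel.

(** * The Fourier transform of integrable functions and its L2 bound *)

Section FourierL1.
Context {R : realType}.
Local Open Scope complex_scope.
Local Notation C := R[i].
Local Notation mu := (@lebesgue_measure R).
Local Notation T := (measurableTypeR R).
Implicit Types (f g phi : R -> C) (x xi : R).

(** No normalising constant: the factor [2 * pi] appears in the inversion formulas. *)
Definition ft f : R -> C := fun xi => cint (fun x => expi (- (x * xi)) * f x).

Lemma cmeasurable_chr xi : cmeasurable (fun x : R => expi (- (x * xi)) : C).
Proof.
apply: cmeasurable_expi; apply: measurableT_comp => //.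
by apply: measurable_funM.
Qed.

Lemma cintegrable_chr f xi : cintegrable f ->
  cintegrable (fun x => expi (- (x * xi)) * f x).
Proof.
move=> If; apply: (cintegrableM (M := 1) If); first exact: cmeasurable_chr.
by move=> x; rewrite normc_expi.
Qed.

Lemma L2_chr f xi : L2 f -> L2 (fun x => expi (- (x * xi)) * f x).
Proof.
move=> Lf; apply: (L2M (M := 1) Lf); first exact: cmeasurable_chr.
by move=> x; rewrite nsq_expi.
Qed.

Lemma ft_le f xi : cintegrable f -> normc (ft f xi) <= 2 * \int[mu]_x normc (f x).
Proof.
move=> If; apply: le_trans (normc_cint_le (cintegrable_chr xi If)) _.
by under eq_Rintegral do rewrite normcM normc_expi mul1r.
Qed.

(** The kernel [expi (- (x * xi)) * f x * phi xi] has modulus [normc (f x) * normc (phi xi)], a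
    product of integrable functions, so Fubini applies in either order. The integrability half is
    kept because it also yields measurability of the transform. *)
Let ft_fubini f phi : cintegrable f -> cintegrable phi ->
  cintegrable (fun xi => ft f xi * phi xi) /\
  cint (fun xi => ft f xi * phi xi) = cint (fun x => f x * ft phi x).
Proof.
move=> If Iphi.
have mf := cintegrable_measurable If; have mphi := cintegrable_measurable Iphi.
pose F (z : T * T) : C := expi (- (z.1 * z.2)) * f z.1 * phi z.2.
have mF : cmeasurable F.
  apply: cmeasurableM; last exact: cmeasurable_comp measurable_snd mphi.
  apply: cmeasurableM; last exact: cmeasurable_comp measurable_fst mf.
  apply: cmeasurable_expi; apply: measurableT_comp => //.
  by apply: measurable_funM; [exact: measurable_fst|exact: measurable_snd].
have NF x xi : normc (F (x, xi)) = normc (f x) * normc (phi xi).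
  by rewrite /F !normcM normc_expi mul1r.
have Nf : mu.-integrable setT (EFin \o (fun x => normc (f x))) := integrable_normc If.
have Foo : (\int[mu]_x \int[mu]_xi (normc (F (x, xi)))%:E < +oo)%E.
  have E x : (\int[mu]_xi (normc (F (x, xi)))%:E =
      (normc (f x) * \int[mu]_xi normc (phi xi))%:E)%E.
    rewrite EFinM fineK; last first.
      apply: integrable_fin_num => //; exact: (integrable_normc Iphi).
    rewrite -ge0_integralZl_EFin//.
    - by apply: eq_integral => xi _; rewrite NF.
    - by move=> xi _; rewrite lee_fin normc_ge0.
    - by apply/measurable_EFinP; exact: measurable_normc.
    - exact: normc_ge0.
  under eq_integral do rewrite E.
  have : mu.-integrable setT (EFin \o (fun x => (\int[mu]_xi normc (phi xi)) * normc (f x))).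
    exact: integrableZ_EFin.
  move/integrable_lty => /(_ measurableT); congr (_ < _)%E.
  by apply: eq_integral => x _; rewrite /= mulrC.
have Fx x : cintegrable (fun xi => F (x, xi)).
  have := cintegrableZ (f x) (cintegrable_chr x Iphi); congr cintegrable.
  by apply/funext => xi; rewrite /F/= (mulrC x) mulrCA mulrA.
have Fy xi : cintegrable (fun x => F (x, xi)).
  have := cintegrableZ (phi xi) (cintegrable_chr xi If); congr cintegrable.
  by apply/funext => x; rewrite /F/= mulrC.
have [_ h1 h2] := cint_fubini mF Foo Fx Fy.
have E1 xi : cint (fun x => F (x, xi)) = ft f xi * phi xi.
  rewrite mulrC -cintZ; last exact: cintegrable_chr.
  by apply: eq_cint => x; rewrite /F/= mulrC.
have E2 x : cint (fun xi => F (x, xi)) = f x * ft phi x.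
  rewrite -cintZ; last exact: cintegrable_chr.
  by apply: eq_cint => xi; rewrite /F/= (mulrC x) mulrCA mulrA.
split; first by move: h1; congr cintegrable; apply/funext => xi; rewrite E1.
by under eq_cint do rewrite -E1; under [RHS]eq_cint do rewrite -E2.
Qed.

Lemma cint_ftM f phi : cintegrable f -> cintegrable phi ->
  cint (fun xi => ft f xi * phi xi) = cint (fun x => f x * ft phi x).
Proof. by move=> If Ip; have [] := ft_fubini If Ip. Qed.

(** Fubini makes the product of [ft f] with a positive integrable weight integrable, hence
    measurable; multiplying by the inverse weight recovers [ft f]. *)
Lemma cmeasurable_ft f : cintegrable f -> cmeasurable (ft f).
Proof.
move=> If; have [] := ft_fubini If (cintegrable_absexp (@ltr01 R)).
move=> /cintegrable_measurable h _.
have E xi : ft f xi = ft f xi * (absexp 1 xi)%:C * (expR `|xi|)%:C.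
  by rewrite -mulrA -rmorphM/= /absexp mul1r -expRD addNr expR0 mulr1.
rewrite (_ : ft f = fun xi => ft f xi * (absexp 1 xi)%:C * (expR `|xi|)%:C); last exact/funext.
apply: cmeasurableM => //; apply: cmeasurable_real.
by apply: measurableT_comp => //; exact: measurableT_comp.
Qed.

Lemma cintegrable_ftM f phi : cintegrable f -> cintegrable phi ->
  cintegrable (fun xi => ft f xi * phi xi).
Proof. by move=> If Ip; have [] := ft_fubini If Ip. Qed.

Lemma ftB f g xi : cintegrable f -> cintegrable g ->
  ft (fun x => f x - g x) xi = ft f xi - ft g xi.
Proof.
move=> If Ig; rewrite -cintB; [|exact: cintegrable_chr..].
by apply: eq_cint => x; rewrite mulrBr.
Qed.

Lemma ftJ f xi : cintegrable f -> ft (fun x => (f x)^*) xi = (ft f (- xi))^*.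
Proof.
move=> If; rewrite -cintJ; last exact: cintegrable_chr.
by apply: eq_cint => x; rewrite cconjM expiJ mulrN !opprK.
Qed.

Lemma ft_chr f x xi : ft (fun y => expi (- (y * x)) * f y) xi = ft f (xi + x).
Proof.
by apply: eq_cint => y; rewrite mulrA -expiD -opprD -mulrDr.
Qed.

Lemma ft_absexp eps x : 0 < eps -> ft (fun y => (absexp eps y)%:C) x = (poisson eps x)%:C.
Proof. by move=> eps0; exact: cint_absexp. Qed.

(** Conjugating [ft f] makes the forward transform act as an inverse one. The multiplication formula
    then moves the transform onto the modulated exponential, where it is a translated Poisson
    kernel. *)
Lemma ft_damped f eps x : 0 < eps -> cintegrable f ->
  ft (fun xi => (ft f xi)^* * (absexp eps xi)%:C) x =
  (cint (fun y => f y * (poisson eps (y - x))%:C))^*.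
Proof.
move=> eps0 If.
pose e xi : C := (absexp eps xi)%:C.
have Ie' : cintegrable (fun xi => expi (- (xi * - x)) * e xi).
  by apply: cintegrable_chr; exact: cintegrable_absexp.
have -> : ft (fun xi => (ft f xi)^* * e xi) x =
    (cint (fun xi => ft f xi * (expi (- (xi * - x)) * e xi)))^*.
  rewrite -cintJ; last exact: cintegrable_ftM.
  apply: eq_cint => xi; rewrite !cconjM expiJ mulrN !opprK cconj_real.
  by rewrite mulrCA.
congr (_^*); rewrite cint_ftM//; apply: eq_cint => y.
by rewrite ft_chr /e ft_absexp.
Qed.

(* Damping by [exp (- eps |xi|)] turns [\int |ft f|^2] into the quadratic form
   of [f] against the Poisson kernel, whose total mass is [2 pi]. *)
Let damped_plancherel f eps : 0 < eps -> cintegrable f -> L2 f ->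
  (\int[mu]_xi (nsq (ft f xi) * absexp eps xi)%:E <= (4 * pi * n2 f)%:E)%E.
Proof.
move=> eps0 If Lf.
have mf := cintegrable_measurable If.
pose e xi : C := (absexp eps xi)%:C.
have Ie : cintegrable e := cintegrable_absexp eps0.
have mft := cmeasurable_ft If.
have Ieft : cintegrable (fun xi => (ft f xi)^* * e xi).
  apply: (cintegrableM (M := 2 * \int[mu]_x normc (f x)) Ie); first exact: cmeasurableJ.
  by move=> xi; rewrite normc_conj; exact: ft_le.
pose P x y := poisson eps (y - x).
have P0 x y : 0 <= P x y by exact: poisson_ge0.
pose Q x := cint (fun y => f y * (P x y)%:C).
have mP x : measurable_fun setT (P x).
  apply: (preserving_measurable (shift_preserving (- x))); exact: measurable_poisson.
have ftE x : ft (fun xi => (ft f xi)^* * e xi) x = (Q x)^* by exact: ft_damped.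
have IQ x : cintegrable (fun y => f y * (P x y)%:C).
  rewrite (_ : (fun y => _) = fun y => (P x y)%:C * f y).
    2: by apply/funext => y; rewrite mulrC.
  apply: (@cintegrableM _ f (fun y => (P x y)%:C) (2 / eps) If).
    exact: cmeasurable_real.
  move=> y; rewrite normc_real ger0_norm// /P /poisson.
  rewrite ler_pdivrMr; last by rewrite ltr_wpDr ?sqr_ge0// exprn_gt0.
  rewrite mulrAC ler_pdivlMr// -mulrA ler_pM2l// -expr2 lerDl.
  exact: sqr_ge0.
have IfQ : cintegrable (fun x => f x * (Q x)^*).
  rewrite (_ : (fun x => _) = fun x => ft (fun xi => (ft f xi)^* * e xi) x * f x).
    2: by apply/funext => x; rewrite ftE mulrC.
  apply: (@cintegrableM _ f _ _ If (cmeasurable_ft Ieft)) => x; exact: ft_le.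
(* The multiplication formula, applied to [f] and the damped conjugate of [ft f], whose own
   transform is the conjugate of the Poisson integral [Q]. *)
have LHS : (\int[mu]_xi (nsq (ft f xi) * absexp eps xi)%:E =
    (complex.Re (cint (fun x => f x * (Q x)^*)))%:E)%E.
  have E xi : ft f xi * ((ft f xi)^* * e xi) = (nsq (ft f xi) * absexp eps xi)%:C.
    by rewrite mulrA mulccJ -rmorphM.
  have [I1 _] := cintegrable_ftM If Ieft.
  under [in RHS]eq_cint do rewrite -ftE.
  rewrite -cint_ftM// Re_cint fineK; last exact: integrable_fin_num.
  by apply: eq_integral => xi _; rewrite E.
have IN : mu.-integrable setT (EFin \o (fun x => normc (f x * (Q x)^*))).
  exact: integrable_normc.
rewrite LHS; apply: (@le_trans _ _ (\int[mu]_x (normc (f x * (Q x)^*))%:E)%E).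
  rewrite -[leRHS]fineK; last exact: (integrable_fin_num measurableT IN).
  rewrite lee_fin; apply: le_trans (ler_norm _) _; exact: le_Re_cint.
have mPz : measurable_fun setT (fun z : T * T => P z.1 z.2).
  apply: measurableT_comp; first exact: measurable_poisson.
  by apply: measurable_funB; [exact: measurable_snd|exact: measurable_fst].
have mnf := measurable_nsq mf.
have mA : measurable_fun setT (fun z : T * T => nsq (f z.1) * P z.1 z.2).
  by apply: measurable_funM => //; exact: measurableT_comp mnf measurable_fst.
have mB : measurable_fun setT (fun z : T * T => nsq (f z.2) * P z.1 z.2).
  by apply: measurable_funM => //; exact: measurableT_comp mnf measurable_snd.
have A0 x y : (0 <= (nsq (f x) * P x y)%:E)%E by rewrite lee_fin mulr_ge0// nsq_ge0.
have B0 x y : (0 <= (nsq (f y) * P x y)%:E)%E by rewrite lee_fin mulr_ge0// nsq_ge0.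
have mFA : measurable_fun setT (fun x => \int[mu]_y (nsq (f x) * P x y)%:E)%E.
  apply: (@measurable_fun_fubini_tonelli_F _ _ T T R mu
    (fun z => (nsq (f z.1) * P z.1 z.2)%:E)) => //; exact/measurable_EFinP.
have mFB : measurable_fun setT (fun x => \int[mu]_y (nsq (f y) * P x y)%:E)%E.
  apply: (@measurable_fun_fubini_tonelli_F _ _ T T R mu
    (fun z => (nsq (f z.2) * P z.1 z.2)%:E)) => //; exact/measurable_EFinP.
have mAx x : measurable_fun setT (fun y => (nsq (f x) * P x y)%:E).
  by apply/measurable_EFinP; apply: measurable_funM.
have mBx x : measurable_fun setT (fun y => (nsq (f y) * P x y)%:E).
  by apply/measurable_EFinP; apply: measurable_funM.
have pi2 : (0 <= 2 * pi :> R)%R by rewrite mulr_ge0// pi_ge0.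
have If2 := L2_integrable Lf.
have intf2 : (\int[mu]_x (nsq (f x))%:E = (n2 f)%:E)%E.
  by rewrite /n2 fineK//; apply: integrable_fin_num.
(* Each half of the symmetrised bound integrates the kernel in one variable, which costs at most
   [2 * pi], and [nsq f] in the other. *)
have half (K : R -> \bar R) : (forall x, K x <= (nsq (f x) * (2 * pi))%:E)%E ->
    measurable_fun setT K -> (forall x, 0 <= K x)%E ->
    (\int[mu]_x K x <= (2 * pi * n2 f)%:E)%E.
  move=> Kle mK K0.
  apply: (@le_trans _ _ (\int[mu]_x (2 * pi * nsq (f x))%:E)%E).
    apply: ge0_le_integral => //.
    - by apply/measurable_EFinP; apply: measurable_funM.
    - by move=> x _; rewrite mulrC; exact: Kle.
  under eq_integral do rewrite EFinM.
  rewrite ge0_integralZl_EFin//; last 2 first.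
  - by move=> x _; rewrite lee_fin nsq_ge0.
  - exact/measurable_EFinP.
  by rewrite intf2 EFinM.
have HA : (\int[mu]_x \int[mu]_y (nsq (f x) * P x y)%:E <= (2 * pi * n2 f)%:E)%E.
  apply: half.
  - move=> x; under eq_integral do rewrite EFinM.
    rewrite ge0_integralZl_EFin//; last 3 first.
    - by move=> y _; rewrite lee_fin.
    - apply/measurable_EFinP; exact: mP.
    - exact: nsq_ge0.
    by rewrite EFinM lee_wpmul2l ?lee_fin ?nsq_ge0//; exact: shift_integral_poisson.
  - exact: mFA.
  - by move=> x; apply: integral_ge0 => y _.
have HB : (\int[mu]_x \int[mu]_y (nsq (f y) * P x y)%:E <= (2 * pi * n2 f)%:E)%E.
  rewrite (@integral_tonelli _ (fun z => nsq (f z.2) * P z.1 z.2))//; last first.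
    by move=> z; rewrite mulr_ge0// nsq_ge0.
  apply: half.
  - move=> y /=; under eq_integral do rewrite EFinM.
    rewrite ge0_integralZl_EFin//; last 3 first.
    - by move=> x _; rewrite lee_fin.
    - apply/measurable_EFinP; under eq_fun do rewrite /P -opprB poissonN.
      apply: (preserving_measurable (shift_preserving (- y))); exact: measurable_poisson.
    - exact: nsq_ge0.
    rewrite EFinM lee_wpmul2l ?lee_fin ?nsq_ge0//.
    under eq_integral do rewrite /P -opprB poissonN.
    exact: shift_integral_poisson.
  - apply: (@measurable_fun_fubini_tonelli_G _ _ T T R mu
      (fun z => (nsq (f z.2) * P z.1 z.2)%:E)) => //; exact/measurable_EFinP.
  - by move=> x; apply: integral_ge0 => y _; exact: B0.
(* The factor 2 from [normc_cint_le] is absorbed by [2 |f x| |f y| <= |f x|^2 + |f y|^2], which also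
   splits the quadratic form into two symmetric halves. *)
apply: (@le_trans _ _ (\int[mu]_x (\int[mu]_y (nsq (f x) * P x y)%:E +
    \int[mu]_y (nsq (f y) * P x y)%:E))%E).
  apply: ge0_le_integral => //.
  - by move=> x _; rewrite lee_fin normc_ge0.
  - by have /measurable_int := IN.
  - by apply: emeasurable_funD; [exact: mFA|exact: mFB].
  move=> x _; rewrite -ge0_integralD//; [|exact: mAx|exact: mBx].
  rewrite normcM normc_conj.
  apply: (@le_trans _ _ (2 * normc (f x) * \int[mu]_y normc (f y * (P x y)%:C))%:E).
    rewrite lee_fin (mulrC 2) -mulrA ler_wpM2l ?normc_ge0//.
    exact: normc_cint_le.
  have INx := integrable_normc (IQ x).
  rewrite EFinM fineK; last exact: (integrable_fin_num measurableT INx).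
  rewrite -ge0_integralZl_EFin//; last 3 first.
  - by move=> y _; rewrite lee_fin normc_ge0.
  - by have /measurable_int := INx.
  - by rewrite mulr_ge0// normc_ge0.
  apply: ge0_le_integral => //.
  - by move=> y _; rewrite -EFinM lee_fin mulr_ge0 ?normc_ge0// mulr_ge0// normc_ge0.
  - by apply: emeasurable_funM => //; have /measurable_int := INx.
  - by apply: emeasurable_funD; [exact: mAx|exact: mBx].
  move=> y _; rewrite -EFinM -EFinD lee_fin normcM normc_real ger0_norm//.
  rewrite -mulrDl mulrA ler_wpM2r// -!normc_sqr.
  have := sqr_ge0 (normc (f x) - normc (f y)); rewrite sqrrB !mulr2n; nra.
rewrite (@ge0_integralD _ T R mu setT measurableT _ _ _ mFA _ mFB); last 2 first.
- by move=> x _; apply: integral_ge0 => y _; exact: A0.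
- by move=> x _; apply: integral_ge0 => y _; exact: B0.
apply: le_trans (leeD HA HB) _.
by rewrite -EFinD lee_fin; lra.
Qed.

Lemma cvg_absexp xi : absexp n.+1%:R^-1 xi @[n --> \oo] --> (1 : R).
Proof.
have h : - (n.+1%:R^-1 * `|xi|) @[n --> \oo] --> (0 : R).
  rewrite -oppr0; apply: cvgN; rewrite -(mul0r `|xi|).
  by apply: cvgM; [exact: cvg_harmonic|exact: cvg_cst].
by have := cvg_comp _ _ h (@continuous_expR R 0); rewrite expR0.
Qed.

(** The damped bound does not depend on [eps]; Fatou along [eps = 1 / (n + 1)] removes the damping
    while integrability of [nsq (ft f)] is still open. *)
Lemma integral_nsq_ft_le f : cintegrable f -> L2 f ->
  (\int[mu]_xi (nsq (ft f xi))%:E <= (4 * pi * n2 f)%:E)%E.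
Proof.
move=> If Lf.
apply: (@fatou_le _ (fun n xi => nsq (ft f xi) * absexp n.+1%:R^-1 xi)) => [n|n xi|xi|n].
- apply: measurable_funM; last exact: measurable_absexp.
  by apply: measurable_nsq; exact: cmeasurable_ft.
- by rewrite mulr_ge0 ?nsq_ge0// ltW// absexp_gt0.
- by rewrite -[X in _ --> X]mulr1; apply: cvgM; [exact: cvg_cst|exact: cvg_absexp].
- by apply: damped_plancherel.
Qed.

Lemma ft_L2 f : cintegrable f -> L2 f -> L2 (ft f).
Proof.
move=> If Lf; apply/L2P; split; first exact: cmeasurable_ft.
apply/integrableP; split.
  by apply/measurable_EFinP; apply: measurable_nsq; exact: cmeasurable_ft.
under eq_integral do rewrite /= ger0_norm ?nsq_ge0//.
exact: le_lt_trans (integral_nsq_ft_le If Lf) (ltry _).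
Qed.

Lemma n2_ft_le f : cintegrable f -> L2 f -> n2 (ft f) <= 4 * pi * n2 f.
Proof.
move=> If Lf; rewrite -lee_fin -L2norm_sqr_n2; last exact: ft_L2.
by rewrite L2norm_sqrE; exact: integral_nsq_ft_le.
Qed.

End FourierL1.

(** * Primitives, Lebesgue differentiation, and functions determined by segment integrals *)

Section LocallyIntegrable.
Context {R : realType}.
Local Notation mu := (@lebesgue_measure R).
Implicit Types (k l : R -> R) (a b x : R).

Definition loc_integrable k := forall a b, mu.-integrable `[a, b] (EFin \o k).

(** Oriented integral from 0: for each [x], one of the two segments is empty or a single point. *)
Definition prim k x : R :=
  \int[mu]_(t in `[0, x]) k t - \int[mu]_(t in `[x, 0]) k t.

Lemma loc_integrable_measurable k : loc_integrable k -> measurable_fun setT k.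
Proof.
move=> lk.
rewrite (_ : setT = \bigcup_n `[- n%:R, n%:R]%classic :> set R); last first.
  apply/esym; rewrite -subTset => x _ /=.
  have [n nx] : exists n, `|x| <= n%:R.
    by exists (Num.bound `|x|); apply/ltW; exact: archi_boundP.
  by exists n => //=; rewrite in_itv/= -ler_norml.
apply/measurable_fun_bigcup => // n.
by have /measurable_int/measurable_EFinP := lk (- n%:R) n%:R.
Qed.

Lemma Rintegral_segment_cat k a b c : a <= b -> b <= c -> loc_integrable k ->
  \int[mu]_(t in `[a, c]) k t =
  \int[mu]_(t in `[a, b]) k t + \int[mu]_(t in `[b, c]) k t.
Proof.
move=> ab bc lk.
rewrite -(@Rintegral_itv_obnd_cbnd _ b (BRight c)); last first.
  by apply: integrableS (lk b c) => //; apply: subset_itvr; rewrite bnd_simp.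
have := @Rintegral_itvB _ k (BLeft a) (BRight c) b (lk a c).
rewrite !bnd_simp => /(_ ab bc) <-; by rewrite addrC subrK.
Qed.

Lemma primB k a b : a <= b -> loc_integrable k ->
  prim k b - prim k a = \int[mu]_(t in `[a, b]) k t.
Proof.
move=> ab lk; rewrite /prim.
have i0 x y : y < x -> \int[mu]_(t in `[x, y]) k t = 0.
  by move=> yx; rewrite set_itv_ge ?Rintegral_set0// bnd_simp -ltNge.
have i1 x : \int[mu]_(t in `[x, x]) k t = 0 by rewrite set_itv1 Rintegral_set1.
have i x y : y <= x -> \int[mu]_(t in `[x, y]) k t = 0.
  by rewrite le_eqVlt => /predU1P[->|/i0].
have [a0|a0] := leP 0 a.
  rewrite (i b 0) ?(le_trans a0 ab)// (i a 0)// (@Rintegral_segment_cat k 0 a b)//; lra.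
have [b0|b0] := leP 0 b.
  rewrite (i b 0)// (i 0 a) ?(ltW a0)// (@Rintegral_segment_cat k a 0 b) ?(ltW a0)//; lra.
rewrite (i 0 b) ?(ltW b0)// (i 0 a) ?(ltW a0)// (@Rintegral_segment_cat k a b 0) ?(ltW b0)//; lra.
Qed.

Lemma prim0 k : prim k 0 = 0.
Proof. by rewrite /prim subrr. Qed.

Lemma loc_integrable_locally k : loc_integrable k -> locally_integrable setT k.
Proof.
move=> lk; split; [exact: loc_integrable_measurable|exact: openT|].
move=> K _ cK.
have [M [_ HM]] := compact_bounded cK.
have KM : K `<=` `[- (M + 1), M + 1].
  move=> x Kx; rewrite /= in_itv/= -ler_norml.
  by apply: (HM (M + 1)) => //; rewrite ltrDl.
have mK : measurable K by exact: compact_measurable.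
have /integrableP[_] : mu.-integrable K (EFin \o k).
  exact: (@integrableS _ (measurableTypeR R) R mu _ K _ (measurable_itv _) mK KM (lk _ _)).
by [].
Qed.

Lemma is_derive_prim k c x : loc_integrable k -> c < x ->
  derivable (fun y => \int[mu]_(t in `[c, y]) k t) x 1 /\
  derive1 (fun y => \int[mu]_(t in `[c, y]) k t) x = k x ->
  is_derive x (1 : R) (prim k) (k x).
Proof.
move=> lk cx; set F := fun _ => _ => -[dF F'].
have E : {near x, (fun y => F y + prim k c) =1 prim k}.
  near=> y; rewrite /F -(@primB k _ y)//; first by rewrite subrK.
  by apply/ltW; near: y; exact: lt_nbhsr.
apply: (near_eq_is_derive E).
have -> : k x = k x + 0 by rewrite addr0.
apply: is_deriveD.
by apply: DeriveDef => //; rewrite -derive1E.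
Unshelve. all: by end_near. Qed.

(** Lebesgue differentiation is applied from each left endpoint [- n]; these countably many
    exceptional sets together remain null, and every [x] lies to the right of some [- n]. *)
Lemma ae_derive_prim k : loc_integrable k ->
  {ae mu, forall x, is_derive x (1 : R) (prim k) (k x)}.
Proof.
move=> lk.
have H n : {ae mu, forall x, - n%:R < x -> is_derive x (1 : R) (prim k) (k x)}.
  have ik y : mu.-integrable [set` Interval (BLeft (- n%:R : R)) (BRight y)] (EFin \o k).
    exact: lk.
  have := FTC1 ik (loc_integrable_locally lk).
  apply: ae_imply => x h nx; apply: (is_derive_prim lk nx).
  by apply: h; exact: nx.
have : {ae mu, forall x : R, forall n, - n%:R < x -> is_derive x (1 : R) (prim k) (k x)}.
  exact: (@ae_foralln _ (measurableTypeR R)).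
apply: ae_imply => x /(_ (Num.bound `|x|)); apply.
rewrite ltrNl; apply: le_lt_trans (ler_norm _) _; rewrite normrN; exact: archi_boundP.
Qed.

Lemma continuous_derive_prim k x : loc_integrable k -> {for x, continuous k} ->
  is_derive x (1 : R) (prim k) (k x).
Proof.
move=> lk ck; apply: (@is_derive_prim _ (x - 1)) => //; first by rewrite ltrBlDr ltrDl.
apply: (@continuous_FTC1 _ k (BLeft (x - 1)) x (x + 1)) => //.
- by rewrite ltrDl.
- by change (x - 1 < x); rewrite ltrBlDr ltrDl.
Qed.

(** The primitive vanishes identically, and its derivative is [k] almost everywhere. *)
Lemma ae_eq0_segment k : loc_integrable k ->
  (forall a b, a <= b -> \int[mu]_(t in `[a, b]) k t = 0) -> {ae mu, forall x, k x = 0}.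
Proof.
move=> lk k0; apply: ae_imply (ae_derive_prim lk) => x dx.
have E : prim k = cst 0.
  apply/funext => y; rewrite /prim.
  have [y0|y0] := leP 0 y; first by rewrite (k0 0 y)// (_ : \int[mu]_(_ in _) _ = 0)
    ?subrr//; move: y0; rewrite le_eqVlt => /predU1P[<-|y0];
    [exact: k0|rewrite set_itv_ge ?Rintegral_set0// bnd_simp -ltNge].
  by rewrite (k0 y 0) ?ltW// set_itv_ge ?Rintegral_set0 ?subrr// bnd_simp -ltNge.
have := @derive_val _ _ _ _ _ _ _ dx.
by rewrite E derive_cst => <-.
Qed.

(* An additive function differentiable at one point is differentiable
   everywhere, with the same derivative. *)
Lemma ae_cst_translation k : loc_integrable k ->
  (forall h a b, a <= b ->
    \int[mu]_(t in `[a + h, b + h]) k t = \int[mu]_(t in `[a, b]) k t) ->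
  exists c, {ae mu, forall x, k x = c}.
Proof.
move=> lk kT; have aeD := ae_derive_prim lk.
have [x0 d0] := ae_exists aeD.
have P h x : prim k (x + h) = prim k x + prim k h.
  have [x_ge0|x_lt0] := leP 0 x.
  - have := kT h 0 x x_ge0; rewrite add0r.
    by rewrite -(@primB k h (x + h)) ?lerDr// -(@primB k 0 x)// prim0; lra.
  - have := kT h x 0 (ltW x_lt0); rewrite add0r.
    by rewrite -(@primB k (x + h) h) ?gerDr ?ltW// -(@primB k x 0) ?ltW// prim0; lra.
exists (k x0); apply: ae_imply aeD => x dx.
have d1 : is_derive x (1 : R) (prim k) (k x0).
  have -> : prim k = (fun y => prim k (y + (x0 - x)) + prim k (x - x0)).
    by apply/funext => y; rewrite -P; congr prim; ring.
  have -> : k x0 = k x0 + 0 by rewrite addr0.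
  apply: is_deriveD.
  have dz : is_derive x (1 : R) (fun y => y + (x0 - x)) (1 : R).
    by rewrite -[X in is_derive _ _ _ X]addr0; exact: is_deriveD.
  have d0' : is_derive (x + (x0 - x)) (1 : R) (prim k) (k x0) by rewrite addrC subrK.
  have := @is_derive1_comp _ (prim k) (fun y => y + (x0 - x)) x _ _ d0' dz.
  by rewrite mulr1.
by rewrite -(@derive_val _ _ _ _ _ _ _ dx) (@derive_val _ _ _ _ _ _ _ d1).
Qed.

End LocallyIntegrable.

(** * Segment integrals of complex-valued functions *)

Section ComplexLocallyIntegrable.
Context {R : realType}.
Local Open Scope complex_scope.
Local Notation C := R[i].
Local Notation mu := (@lebesgue_measure R).
Implicit Types (f g k : R -> C) (a b x xi : R).

Definition cloc_integrable k := forall a b,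
  cintegrable (fun x => cindic `[a, b] x * k x).

(** Written over the whole line with an indicator, so that a segment integral is a pairing to which
    Fubini and the multiplication formula apply. *)
Definition cseg a b k : C := cint (fun x => cindic `[a, b] x * k x).

Lemma Re_cindicM (A : set R) k :
  (fun x => complex.Re (cindic A x * k x)) = (fun x => complex.Re (k x)) \_ A.
Proof.
apply/funext => x; rewrite patchE cReM /= indicE.
by case: (x \in A); rewrite ?mul1r !mul0r ?subr0.
Qed.

Lemma Im_cindicM (A : set R) k :
  (fun x => complex.Im (cindic A x * k x)) = (fun x => complex.Im (k x)) \_ A.
Proof.
apply/funext => x; rewrite patchE cImM /= indicE.
by case: (x \in A); rewrite ?mul1r !mul0r ?addr0.
Qed.

Lemma Re_cseg a b k :
  complex.Re (cseg a b k) = \int[mu]_(x in `[a, b]) complex.Re (k x).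
Proof. by rewrite [RHS]Rintegral_mkcond -Re_cindicM. Qed.

Lemma Im_cseg a b k :
  complex.Im (cseg a b k) = \int[mu]_(x in `[a, b]) complex.Im (k x).
Proof. by rewrite [RHS]Rintegral_mkcond -Im_cindicM. Qed.

Lemma cloc_integrableP k : cloc_integrable k <->
  loc_integrable (fun x => complex.Re (k x)) /\
  loc_integrable (fun x => complex.Im (k x)).
Proof.
split=> [lk|[l1 l2] a b].
  split=> a b; have [i1 i2] := lk a b.
    by apply/integrable_mkcond => //; rewrite restrict_EFin -Re_cindicM.
  by apply/integrable_mkcond => //; rewrite restrict_EFin -Im_cindicM.
have mkc (u : R -> R) : mu.-integrable `[a, b] (EFin \o u) ->
    mu.-integrable setT (EFin \o (u \_ `[a, b])).
  rewrite -restrict_EFin => h.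
  exact: ((@integrable_mkcond _ (measurableTypeR R) R mu `[a, b]%classic (EFin \o u)
    (measurable_itv _)).1 h).
split; first by rewrite Re_cindicM; exact: mkc.
by rewrite Im_cindicM; exact: mkc.
Qed.

Lemma L2_cloc_integrable f : L2 f -> cloc_integrable f.
Proof. by move=> Lf a b; exact: L2_cintegrable_segment. Qed.

Lemma cintegrable_cloc_integrable f : cintegrable f -> cloc_integrable f.
Proof. by move=> If a b; exact: cintegrable_cindicM. Qed.

Lemma cloc_integrableB f g : cloc_integrable f -> cloc_integrable g ->
  cloc_integrable (fun x => f x - g x).
Proof.
move=> lf lg a b; have := cintegrableB (lf a b) (lg a b).
by congr cintegrable; apply/funext => x; rewrite mulrBr.
Qed.

Lemma csegB a b f g : cloc_integrable f -> cloc_integrable g ->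
  cseg a b (fun x => f x - g x) = cseg a b f - cseg a b g.
Proof.
move=> lf lg; rewrite -(cintB (lf a b) (lg a b)).
by apply: eq_cint => x; rewrite mulrBr.
Qed.

Lemma cloc_integrableZ f (c : C) : cloc_integrable f ->
  cloc_integrable (fun x => c * f x).
Proof.
move=> lf a b; have := cintegrableZ c (lf a b).
by congr cintegrable; apply/funext => x; rewrite mulrCA.
Qed.

Lemma csegZ a b f (c : C) : cloc_integrable f ->
  cseg a b (fun x => c * f x) = c * cseg a b f.
Proof.
move=> lf; rewrite -(cintZ c (lf a b)).
by apply: eq_cint => x; rewrite mulrCA.
Qed.

Lemma cloc_measurable f : cloc_integrable f -> cmeasurable f.
Proof.
by move=> /cloc_integrableP[l1 l2]; split; exact: loc_integrable_measurable.
Qed.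

Lemma ae_eq0_cseg k : cloc_integrable k ->
  (forall a b, a <= b -> cseg a b k = 0) -> {ae mu, forall x, k x = 0}.
Proof.
move=> /cloc_integrableP[l1 l2] k0.
apply: ae_imply2 (ae_eq0_segment l1 _) (ae_eq0_segment l2 _).
- by move=> x h1 h2; exact: complexP.
- by move=> a b ab; rewrite -Re_cseg k0.
- by move=> a b ab; rewrite -Im_cseg k0.
Qed.

Lemma ae_eq_cseg f g : cloc_integrable f -> cloc_integrable g ->
  (forall a b, a <= b -> cseg a b f = cseg a b g) -> {ae mu, forall x, f x = g x}.
Proof.
move=> lf lg fg.
have := @ae_eq0_cseg _ (cloc_integrableB lf lg).
move=> /(_ _)/ae_imply; apply; first by move=> x /eqP; rewrite subr_eq0 => /eqP.
by move=> a b ab; rewrite csegB// fg// subrr.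
Qed.

Lemma ae_cst_cseg k : cloc_integrable k ->
  (forall h a b, a <= b -> cseg (a + h) (b + h) k = cseg a b k) ->
  exists c, {ae mu, forall x, k x = c}.
Proof.
move=> /cloc_integrableP[l1 l2] kT.
have [|c1 h1] := ae_cst_translation l1.
  by move=> h a b ab; rewrite -!Re_cseg kT.
have [|c2 h2] := ae_cst_translation l2.
  by move=> h a b ab; rewrite -!Im_cseg kT.
exists (c1 +i* c2); apply: ae_imply2 h1 h2 => x e1 e2; exact: complexP.
Qed.

End ComplexLocallyIntegrable.

(** * The Fourier transform on L2 *)

Section FourierL2.
Context {R : realType}.
Local Open Scope complex_scope.
Local Notation C := R[i].
Local Notation mu := (@lebesgue_measure R).
Implicit Types (f g phi gam : R -> C) (a b x xi : R).

Lemma fourier_truncatedE f n xi : fourier_truncated f n xi = ft (trunc f n) xi.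
Proof.
by rewrite /fourier_truncated integralC_cindic; apply: eq_cint => x; rewrite mulrCA.
Qed.

Lemma ft_trunc_L2 f n : L2 f -> L2 (ft (trunc f n)).
Proof.
by move=> Lf; apply: ft_L2; [exact: trunc_cintegrable|exact: trunc_L2].
Qed.

Lemma is_fourierP f g : L2 f -> is_fourier f g <->
  L2 g /\ n2 (fun xi => ft (trunc f n) xi - g xi) @[n --> \oo] --> 0.
Proof.
move=> Lf.
have E n : L2 g -> L2norm_sqr (fun xi => fourier_truncated f n xi - g xi) =
    (n2 (fun xi => ft (trunc f n) xi - g xi))%:E.
  move=> Lg; rewrite -L2norm_sqr_n2; last by apply: L2B => //; exact: ft_trunc_L2.
  by congr L2norm_sqr; apply/funext => xi; rewrite fourier_truncatedE.
split=> -[Lg h]; split=> //.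
  have := h; under eq_fun do rewrite (E _ Lg).
  by move/fine_cvgP => [_].
under eq_fun do rewrite (E _ Lg).
by apply: cvg_EFin => //; exact: nearW.
Qed.

Lemma is_fourier_L2 f g : is_fourier f g -> L2 g.
Proof. by case. Qed.

(** The truncations tend to [f] in L2, and [n2_ft_le] carries this over to their transforms. *)
Lemma is_fourier_ft f : cintegrable f -> L2 f -> is_fourier f (ft f).
Proof.
move=> If Lf; apply/is_fourierP => //; split; first exact: ft_L2.
apply: (@squeeze_cvgr _ _ _ _ (cst 0) (fun n => 4 * pi * n2 (fun x => trunc f n x - f x))).
- apply: nearW => n; rewrite n2_ge0/=.
  have It := trunc_cintegrable n Lf; have Lt := trunc_L2 n Lf.
  rewrite (@eq_n2 _ _ (ft (fun x => trunc f n x - f x))); last first.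
    by move=> xi; rewrite ftB.
  by apply: n2_ft_le; [exact: cintegrableB|exact: L2B].
- exact: cvg_cst.
- rewrite -(mulr0 (4 * pi)); apply: cvgM; first exact: cvg_cst.
  exact: trunc_n2_cvg.
Qed.

(** The difference of the truncations is [f] restricted to [n < |x| <= m], part of the tail on the
    right. *)
Lemma n2_trunc_cauchy f n m : L2 f -> (n <= m)%N ->
  n2 (fun x => trunc f m x - trunc f n x) <= n2 (fun x => trunc f n x - f x).
Proof.
move=> Lf nm; apply: le_Rintegral => //.
- by apply: L2_integrable; apply: L2B; exact: trunc_L2.
- by apply: L2_integrable; apply: L2B => //; exact: trunc_L2.
move=> x _; rewrite /trunc.
rewrite -[X in _ <= nsq (_ - X)]mul1r -!mulrBl !nsqM ler_wpM2r ?nsq_ge0//.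
have sub : x \in `[- n%:R, n%:R]%classic -> x \in `[- m%:R, m%:R]%classic.
  rewrite !inE/= !in_itv/= -!ler_norml => h.
  by apply: (le_trans h); rewrite ler_nat.
rewrite /nsq /= !subr0 expr0n !addr0 !indicE.
case: (x \in `[- n%:R, n%:R]%classic) sub => [->//|_].
by case: (_ \in _); rewrite ?subr0 ?sub0r ?sqrrN ?expr1n ?expr0n ?subrr// ler01.
Qed.

(** [n2_ft_le] turns the Cauchy property of the truncations into one for their transforms.
    Completeness is used for the real and imaginary parts separately, hence the rate [2 * a n]. *)
Lemma fourier_exists f : L2 f -> exists g, is_fourier f g.
Proof.
move=> Lf.
pose a n := 4 * pi * n2 (fun x => trunc f n x - f x).
have a0 : a n @[n --> \oo] --> 0.
  rewrite -(mulr0 (4 * pi)); apply: cvgM; first exact: cvg_cst.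
  exact: trunc_n2_cvg.
have Lt n := ft_trunc_L2 n Lf.
have LB n m : L2 (fun xi => ft (trunc f m) xi - ft (trunc f n) xi) by exact: L2B.
have cauchy n m : (n <= m)%N ->
    (\int[mu]_xi (nsq (ft (trunc f m) xi - ft (trunc f n) xi))%:E <= (a n)%:E)%E.
  move=> nm; rewrite -L2norm_sqrE L2norm_sqr_n2// lee_fin.
  have I k : cintegrable (trunc f k) by exact: trunc_cintegrable.
  rewrite (@eq_n2 _ _ (ft (fun x => trunc f m x - trunc f n x))); last first.
    by move=> xi; rewrite ftB.
  apply: le_trans (n2_ft_le _ _) _.
  - exact: cintegrableB.
  - by apply: L2B; exact: trunc_L2.
  - by rewrite ler_wpM2l ?n2_trunc_cauchy// mulr_ge0// pi_ge0.
have part (p : C -> R) : (forall z w, p (z - w) = p z - p w) ->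
    (forall z, p z ^+ 2 <= nsq z) ->
    (forall n, measurable_fun setT (fun xi => p (ft (trunc f n) xi))) ->
    exists2 g : R -> R, measurable_fun setT g &
    forall n, (\int[mu]_xi ((g xi - p (ft (trunc f n) xi)) ^+ 2)%:E <= (a n)%:E)%E.
  move=> pB pn mp; apply: (@riesz_fischer _ (fun n xi => p (ft (trunc f n) xi)) a) => //.
  move=> n m nm; apply: le_trans (cauchy n m nm).
  have mB : measurable_fun setT
      (fun xi => ((p (ft (trunc f m) xi) - p (ft (trunc f n) xi)) ^+ 2)%:E).
    by apply/measurable_EFinP; apply: measurable_funX; exact: measurable_funB.
  apply: ge0_le_integral => //.
  - by move=> xi _; rewrite lee_fin sqr_ge0.
  - by apply/measurable_EFinP; apply: measurable_nsq; exact: L2_measurable.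
  - by move=> xi _; rewrite lee_fin -pB.
have [|||g1 mg1 h1] := part (@complex.Re R).
- by move=> z w; rewrite !ReImE.
- by move=> z; rewrite /nsq lerDl sqr_ge0.
- by move=> n; have [] := L2_measurable (Lt n).
have [|||g2 mg2 h2] := part (@complex.Im R).
- by move=> z w; rewrite !ReImE.
- by move=> z; rewrite /nsq lerDr sqr_ge0.
- by move=> n; have [] := L2_measurable (Lt n).
pose g xi := g1 xi +i* g2 xi.
have mg : cmeasurable g by [].
have bnd n : (\int[mu]_xi (nsq (ft (trunc f n) xi - g xi))%:E <= (2 * a n)%:E)%E.
  have mft := L2_measurable (Lt n).
  rewrite (_ : (\int[mu]_xi _ = \int[mu]_xi (
      ((g1 xi - complex.Re (ft (trunc f n) xi)) ^+ 2)%:E +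
      ((g2 xi - complex.Im (ft (trunc f n) xi)) ^+ 2)%:E))%E); last first.
    apply: eq_integral => xi _; rewrite -EFinD; congr EFin.
    by rewrite /nsq !ReImE /= -sqrrN opprB; congr (_ + _); rewrite -sqrrN opprB.
  case: mft => m1 m2.
  have mB (u v : R -> R) : measurable_fun setT u -> measurable_fun setT v ->
      measurable_fun setT (fun xi => ((u xi - v xi) ^+ 2)%:E).
    by move=> mu1 mv; apply/measurable_EFinP; apply: measurable_funX; exact: measurable_funB.
  rewrite ge0_integralD//; last 4 first.
  - by move=> xi _; rewrite lee_fin sqr_ge0.
  - exact: mB.
  - by move=> xi _; rewrite lee_fin sqr_ge0.
  - exact: mB.
  by rewrite mulr_natl mulr2n EFinD leeD.
have LBg n : L2 (fun xi => ft (trunc f n) xi - g xi).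
  apply/L2P; have m : cmeasurable (fun xi => ft (trunc f n) xi - g xi).
    by apply: cmeasurableB => //; exact: L2_measurable.
  split=> //; apply/integrableP; split.
    by apply/measurable_EFinP; exact: measurable_nsq.
  under eq_integral do rewrite /= ger0_norm ?nsq_ge0//.
  exact: le_lt_trans (bnd n) (ltry _).
have Lg : L2 g.
  have := L2B (Lt 0%N) (LBg 0%N); congr L2; apply/funext => xi.
  by rewrite opprB addrC subrK.
exists g; apply/is_fourierP => //; split => //.
apply: (@squeeze_cvgr _ _ _ _ (cst 0) (fun n => 2 * a n)).
- apply: nearW => n; rewrite n2_ge0/= -lee_fin -L2norm_sqr_n2// L2norm_sqrE.
  exact: bnd.
- exact: cvg_cst.
- by rewrite -(mulr0 2); apply: cvgM => //; exact: cvg_cst.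
Qed.

(** The formula holds for truncations, which are integrable. Two successive limits extend it, first
    in the truncation of [phi], then in that of [f]. *)
Lemma cint_fourierM f g phi gam : L2 f -> L2 phi -> is_fourier f g ->
  is_fourier phi gam ->
  cint (fun xi => g xi * phi xi) = cint (fun x => f x * gam x).
Proof.
move=> Lf Lp /(is_fourierP _ Lf)[Lg hg] /(is_fourierP _ Lp)[Lgam hgam].
have E n m : cint (fun xi => ft (trunc f n) xi * trunc phi m xi) =
    cint (fun x => trunc f n x * ft (trunc phi m) x).
  by rewrite cint_ftM//; exact: trunc_cintegrable.
have E2 n : cint (fun xi => ft (trunc f n) xi * phi xi) =
    cint (fun x => trunc f n x * gam x).
  have Ltf := trunc_L2 n Lf; have Lftf := ft_trunc_L2 n Lf.
  have c1 : ccvg (fun m => cint (fun xi => trunc phi m xi * ft (trunc f n) xi))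
      (cint (fun xi => phi xi * ft (trunc f n) xi)).
    by apply: L2_cint_cvg => //; [move=> m; exact: trunc_L2|exact: trunc_n2_cvg].
  have c2 : ccvg (fun m => cint (fun x => ft (trunc phi m) x * trunc f n x))
      (cint (fun x => gam x * trunc f n x)).
    by apply: L2_cint_cvg => // m; exact: ft_trunc_L2.
  have Em : (fun m => cint (fun xi => trunc phi m xi * ft (trunc f n) xi)) =
      (fun m => cint (fun x => ft (trunc phi m) x * trunc f n x)).
    apply/funext => m; under eq_cint do rewrite mulrC.
    by rewrite E; apply: eq_cint => x; rewrite mulrC.
  rewrite Em in c1; have := ccvg_unique c1 c2.
  under eq_cint do rewrite mulrC; move=> ->.
  by apply: eq_cint => x; rewrite mulrC.
have c1 : ccvg (fun n => cint (fun xi => ft (trunc f n) xi * phi xi))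
    (cint (fun xi => g xi * phi xi)).
  by apply: L2_cint_cvg => // n; exact: ft_trunc_L2.
have c2 : ccvg (fun n => cint (fun x => trunc f n x * gam x))
    (cint (fun x => f x * gam x)).
  by apply: L2_cint_cvg => //; [move=> n; exact: trunc_L2|exact: trunc_n2_cvg].
by rewrite (funext E2) in c1; exact: ccvg_unique c1 c2.
Qed.

End FourierL2.

(** * Fourier inversion tested on segments *)

Section FourierInversion.
Context {R : realType}.
Local Open Scope complex_scope.
Local Notation C := R[i].
Local Notation mu := (@lebesgue_measure R).
Implicit Types (f g phi gam : R -> C) (a b x xi : R).

(** As the height [1 / (n + 1)] tends to 0, the Poisson mass of a segment tends to a difference of
    such signs, that is to [2 * pi] inside and 0 outside. *)
Lemma cvg_atan_sg (c : R) : atan (c / n.+1%:R^-1) @[n --> \oo] --> pi / 2 * Num.sg c.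
Proof.
under eq_fun do rewrite invrK.
have pos (r : R) : 0 < r -> atan (r * n.+1%:R) @[n --> \oo] --> pi / 2.
  move=> r0; have h : r * n.+1%:R @[n --> \oo] --> +oo.
    apply/cvgryPge => A; near=> n.
    rewrite mulrC -ler_pdivrMr//; apply: (@le_trans _ _ n%:R); last by rewrite ler_nat.
    by near: n; exact: nbhs_infty_ger.
  exact: (cvg_comp _ _ h (@cvgy_atan R)).
have [c0|c0|->] := ltgtP c 0.
- rewrite ltr0_sg// mulrN1.
  have E n : atan (c * n.+1%:R) = - atan (- c * n.+1%:R) by rewrite mulNr atanN opprK.
  rewrite (funext E).
  by apply: cvgN; apply: pos; rewrite oppr_gt0.
- by rewrite gtr0_sg// mulr1; exact: pos.
- by under eq_fun do rewrite mul0r atan0; rewrite sgr0 mulr0; exact: cvg_cst.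
Unshelve. all: by end_near. Qed.

Lemma cint_segment_poisson eps a b x : 0 < eps -> a <= b ->
  cint (fun y => cindic `[a, b] y * (poisson eps (y - x))%:C) =
  (2 * atan ((b - x) / eps) - 2 * atan ((a - x) / eps))%:C.
Proof.
move=> eps0 ab.
have d (y : R) : is_derive y (1 : R) (fun t => 2 * atan ((t - x) / eps)) (poisson eps (y - x)).
  have dz : is_derive y (1 : R) (fun t => t - x) (1 : R).
    by rewrite -[X in is_derive _ _ _ X]addr0; exact: is_deriveD.
  have := @is_derive1_comp _ _ (fun t => t - x) y _ _ (is_derive_poisson eps0 (y - x)) dz.
  by rewrite mulr1.
have cp : continuous (fun y => poisson eps (y - x)).
  move=> y; apply: (@continuous_comp _ _ _ (fun y => y - x) (poisson eps)).
    by apply: cvgB; [exact: cvg_id|exact: cvg_cst].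
  exact: continuous_poisson.
apply: complexP.
  by rewrite Re_cseg /= (Rintegral_FTC ab d cp).
by rewrite Im_cseg /= /Rintegral integral0.
Qed.

(** Abel summation. With damping, the left side is [f] integrated against the Poisson mass of
    [[a, b]] seen from [x]. Both sides pass to the limit by dominated convergence: on the left
    because [ft f] and the transform of the indicator are in L2, on the right because that mass is
    at most [2 * pi]. *)
Lemma inversion_L1 f a b : cintegrable f -> L2 f -> a <= b ->
  cint (fun xi => ft f xi * (ft (cindic `[a, b]) xi)^*) = (2 * pi)%:C * cseg a b f.
Proof.
move=> If Lf ab.
pose e n xi : C := (absexp n.+1%:R^-1 xi)%:C.
have Iab := @cintegrable_cindic_segment R a b.
have Lab := @L2_cindic_segment R a b.
pose K := ft (cindic `[a, b]).
have mK : cmeasurable K := cmeasurable_ft Iab.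
have mf := cintegrable_measurable If.
pose A n x := 2 * atan ((b - x) / n.+1%:R^-1) - 2 * atan ((a - x) / n.+1%:R^-1).
(* The limit of [A n] is [2 * pi] times the indicator except at [a] and [b], where [Num.sg 0 = 0]
   enters; the final comparison discards these two points. *)
pose A' x := 2 * (pi / 2 * Num.sg (b - x)) - 2 * (pi / 2 * Num.sg (a - x)).
have n0 n : 0 < (n.+1%:R^-1 : R) by rewrite invr_gt0.
have Ke n : cintegrable (fun xi => (K xi)^* * e n xi).
  apply: (cintegrableM (M := 2 * \int[mu]_x normc (cindic `[a, b] x : C))
    (cintegrable_absexp (n0 n))); first exact: cmeasurableJ.
  by move=> xi; rewrite normc_conj; exact: ft_le.
have E n : cint (fun xi => ft f xi * ((K xi)^* * e n xi)) =
    cint (fun x => f x * (A n x)%:C).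
  rewrite cint_ftM//; apply: eq_cint => x.
  by rewrite ft_damped// cint_segment_poisson// cconj_real.
have LK : L2 (fun xi => (K xi)^*) by apply: L2J; exact: ft_L2.
have Lft : L2 (ft f) by exact: ft_L2.
have me n : cmeasurable (e n) by apply: cmeasurable_real; exact: measurable_absexp.
have c1 : ccvg (fun n => cint (fun xi => ft f xi * ((K xi)^* * e n xi)))
    (cint (fun xi => ft f xi * (K xi)^*)).
  apply: (@cint_dominated _ _ _ (fun xi => normc (ft f xi * (K xi)^*))).
  - move=> n; apply: cmeasurableM; first exact: L2_measurable.
    by apply: cmeasurableM => //; exact: cmeasurableJ.
  - by apply: cmeasurableM; exact: L2_measurable.
  - move=> xi; rewrite -[X in ccvg _ X]mulr1.
    under eq_fun do rewrite mulrA.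
    apply: ccvgM; first exact: ccvg_cst.
    by split=> /=; [exact: cvg_absexp|exact: cvg_cst].
  - by apply: integrable_normc; exact: L2_cintegrableM.
  - move=> n xi; rewrite mulrA normcM ler_piMr ?normc_ge0// normc_real.
    by rewrite ger0_norm ?absexp_le1// ltW// absexp_gt0.
have mA n : measurable_fun setT (A n).
  have mat c : measurable_fun setT (fun x : R => 2 * atan ((c - x) / n.+1%:R^-1)).
    apply: measurable_funM => //; apply: (@measurableT_comp _ _ _ _ _ _ (@atan R)).
      by apply: continuous_measurable_fun; exact: continuous_atan.
    by apply: measurable_funM => //; exact: measurable_funB.
  exact: measurable_funB.
have A_A' x : A n x @[n --> \oo] --> A' x.
  by apply: cvgB; apply: cvgM; [exact: cvg_cst|exact: cvg_atan_sg
    |exact: cvg_cst|exact: cvg_atan_sg].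
have mA' : measurable_fun setT A'.
  by apply: (measurable_fun_cvg (h := A)) => // x _.
have c2 : ccvg (fun n => cint (fun x => f x * (A n x)%:C))
    (cint (fun x => f x * (A' x)%:C)).
  apply: (@cint_dominated _ _ _ (fun x => 2 * pi * normc (f x))).
  - by move=> n; apply: cmeasurableM => //; exact: cmeasurable_real.
  - by apply: cmeasurableM => //; exact: cmeasurable_real.
  - move=> x; apply: ccvgM; first exact: ccvg_cst.
    by split=> /=; [exact: A_A'|exact: cvg_cst].
  - by apply: integrableZ_EFin; exact: integrable_normc.
  - move=> n x; rewrite normcM normc_real mulrC ler_wpM2r ?normc_ge0//.
    have := atan_ltpi2 ((b - x) / n.+1%:R^-1); have := atan_gtNpi2 ((b - x) / n.+1%:R^-1).
    have := atan_ltpi2 ((a - x) / n.+1%:R^-1); have := atan_gtNpi2 ((a - x) / n.+1%:R^-1).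
    by rewrite /A ler_norml => *; apply/andP; split; lra.
rewrite (funext E) in c1; rewrite (ccvg_unique c1 c2).
rewrite /cseg -cintZ; last exact: cintegrable_cindicM.
apply: ae_eq_cint.
- by apply: cmeasurableM => //; exact: cmeasurable_real.
- apply: cmeasurableM => //; apply: cmeasurableM => //; exact: cmeasurable_cindic.
have neq (c : R) : {ae mu, forall x : R, x != c}.
  exists [set c]; split => //; first exact: lebesgue_measure_set1.
  by move=> x /= /negP; rewrite negbK => /eqP.
apply: ae_imply2 (neq a) (neq b) => x xa xb.
rewrite mulrA mulrC; congr (_ * _); rewrite /cindic -rmorphM; congr (_%:C).
have E0 : \1_`[a, b] x = ((a <= x) && (x <= b))%R%:R :> R.
  by rewrite indicE; congr (nat_of_bool _)%:R; apply/idP/idP; rewrite inE/= in_itv/=.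
rewrite /A' E0.
move: xa xb; rewrite !neq_lt => /orP[xa|xa] /orP[xb|xb].
- rewrite [a <= x]leNgt xa !gtr0_sg ?subr_gt0//= mulr0; lra.
- by have := lt_trans xb (lt_le_trans xa ab); rewrite ltxx.
- rewrite (ltW xa) (ltW xb) gtr0_sg ?subr_gt0// ltr0_sg ?subr_lt0//= mulr1; lra.
- rewrite [x <= b]leNgt xb andbF !ltr0_sg ?subr_lt0//= mulr0; lra.
Qed.

Lemma cseg_trunc_cvg f a b : L2 f ->
  ccvg (fun n => cseg a b (trunc f n)) (cseg a b f).
Proof.
move=> Lf.
have : ccvg (fun n => cint (fun x => trunc f n x * cindic `[a, b] x))
    (cint (fun x => f x * cindic `[a, b] x)).
  apply: L2_cint_cvg => //; first by move=> n; exact: trunc_L2.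
  - exact: L2_cindic_segment.
  - exact: trunc_n2_cvg.
have E (k : R -> C) : cint (fun x => k x * cindic `[a, b] x) = cseg a b k.
  by apply: eq_cint => x; rewrite mulrC.
by rewrite E; under eq_fun do rewrite E.
Qed.

Lemma fourier_inversion f g a b : L2 f -> is_fourier f g -> a <= b ->
  cint (fun xi => g xi * (ft (cindic `[a, b]) xi)^*) = (2 * pi)%:C * cseg a b f.
Proof.
move=> Lf /(is_fourierP _ Lf)[Lg hg] ab.
have Iab := @cintegrable_cindic_segment R a b.
have Lab := @L2_cindic_segment R a b.
have c1 : ccvg (fun n => cint (fun xi => ft (trunc f n) xi * (ft (cindic `[a, b]) xi)^*))
    (cint (fun xi => g xi * (ft (cindic `[a, b]) xi)^*)).
  apply: L2_cint_cvg => //; first by move=> n; exact: ft_trunc_L2.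
  by apply: L2J; exact: ft_L2.
have c2 : ccvg (fun n => (2 * pi)%:C * cseg a b (trunc f n)) ((2 * pi)%:C * cseg a b f).
  by apply: ccvgM; [exact: ccvg_cst|exact: cseg_trunc_cvg].
apply: ccvg_unique c2; move: c1; congr ccvg; apply/funext => n.
by apply: inversion_L1 => //; [exact: trunc_cintegrable|exact: trunc_L2].
Qed.

Lemma cseg_fourier f g a b : L2 f -> is_fourier f g ->
  cseg a b g = cint (fun x => f x * ft (cindic `[a, b]) x).
Proof.
move=> Lf fg.
have Iab := @cintegrable_cindic_segment R a b.
have Lab := @L2_cindic_segment R a b.
rewrite -(cint_fourierM Lf Lab fg (is_fourier_ft Iab Lab)).
by apply: eq_cint => x; rewrite mulrC.
Qed.

(** The two sides have equal integrals over every segment: [cseg_fourier] evaluates the left one,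
    [fourier_inversion] the right one, and they match because the transform of a real indicator at
    [- xi] is the conjugate of its value at [xi]. *)
Lemma fourier_inverse f g gam : L2 f -> is_fourier f g ->
  is_fourier (fun xi => g (- xi)) gam -> {ae mu, forall x, gam x = (2 * pi)%:C * f x}.
Proof.
move=> Lf fg ggam; have Lg := is_fourier_L2 fg.
have Lg' : L2 (fun xi => g (- xi)) by exact: (L2_preserving (@opp_preserving R)).
have Lgam := is_fourier_L2 ggam.
apply: ae_eq_cseg.
- exact: L2_cloc_integrable.
- by apply: L2_cloc_integrable; exact: L2Z.
move=> a b ab; rewrite csegZ; last exact: L2_cloc_integrable.
rewrite -(fourier_inversion Lf fg ab) (cseg_fourier _ _ Lg' ggam).
have Iab := @cintegrable_cindic_segment R a b.
have Lab := @L2_cindic_segment R a b.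
rewrite -(cint_preserving (@opp_preserving R)); last first.
  by apply: L2_cintegrableM => //; apply: ft_L2.
apply: eq_cint => xi; rewrite opprK; congr (_ * _).
have := ftJ (- xi) Iab; rewrite opprK => <-.
by apply: eq_cint => x; rewrite cconj_real.
Qed.

End FourierInversion.

(** * The Hardy space *)

Section HardySpace.
Context {R : realType}.
Local Open Scope complex_scope.
Local Notation C := R[i].
Local Notation mu := (@lebesgue_measure R).
Implicit Types (f g h p q rho phi psi P : R -> C) (a b c d x xi : R).

(** Explicitly [(exp (- i a x) - exp (- i b x)) / (i x)] for nonzero [x]. Pairing with it, without
    conjugation, integrates the Fourier transform over [[a, b]]. *)
Definition segft a b : R -> C := ft (cindic `[a, b]).

Lemma segft_L2 a b : L2 (segft a b).
Proof.
by apply: ft_L2; [exact: cintegrable_cindic_segment|exact: L2_cindic_segment].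
Qed.

Lemma segft_J a b xi : (segft a b xi)^* = segft (- b) (- a) xi.
Proof.
rewrite /segft /ft -cintJ; last exact/cintegrable_chr/cintegrable_cindic_segment.
rewrite -(cint_preserving (@opp_preserving R)); last first.
  apply: cintegrableJ; exact/cintegrable_chr/cintegrable_cindic_segment.
apply: eq_cint => x; rewrite cconjM expiJ opprK mulNr cconj_real; congr (_ * _).
rewrite /cindic !indicE; congr (_%:C); congr (nat_of_bool _)%:R.
by apply/idP/idP; rewrite !inE/= !in_itv/= lerNl lerNr andbC.
Qed.

Lemma segft_chr a b (t : R) xi :
  expi (- (xi * t)) * segft a b xi = segft (a + t) (b + t) xi.
Proof.
rewrite /segft /ft -[RHS](cint_preserving (shift_preserving t)); last first.
  exact/cintegrable_chr/cintegrable_cindic_segment.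
rewrite -cintZ; last exact/cintegrable_chr/cintegrable_cindic_segment.
apply: eq_cint => x; rewrite mulrA -expiD -opprD mulrDl addrC (mulrC xi); congr (_ * _).
rewrite /cindic !indicE; congr (_%:C); congr (nat_of_bool _)%:R.
by apply/idP/idP; rewrite !inE/= !in_itv/= !lerD2r.
Qed.

Lemma ae_neq c : {ae mu, forall x : R, x != c}.
Proof.
exists [set c]; split => //; first exact: lebesgue_measure_set1.
by move=> x /= /negP; rewrite negbK => /eqP.
Qed.

Lemma cseg_ae0 a b g : cloc_integrable g ->
  {ae mu, forall x, a <= x <= b -> g x = 0} -> cseg a b g = 0.
Proof.
move=> lg g0; rewrite -[RHS](@cint0 R); apply: ae_eq_cint.
- exact: cintegrable_measurable (lg a b).
- exact: cmeasurable_cst.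
apply: ae_imply g0 => x gx; rewrite /cindic indicE.
case: (boolP (x \in _)) => [|_]; last by rewrite mul0r.
by rewrite inE/= in_itv/= => /gx ->; rewrite mulr0.
Qed.

(** Cutting [g] at 0 replaces each segment [[a, b]] by [[a, min b 0]], so the cut function has
    vanishing integral over all segments. *)
Lemma ae_neg_eq0 g : cloc_integrable g ->
  (forall a b, a <= b -> b <= 0 -> cseg a b g = 0) ->
  {ae mu, forall xi, xi < 0 -> g xi = 0}.
Proof.
move=> lg g0.
pose k xi := cindic `]-oo, 0] xi * g xi.
have ind0 a b xi : (cindic `[a, b] xi * k xi =
    cindic `[a, Order.min b 0] xi * g xi :> C).
  rewrite /k mulrA; congr (_ * _); rewrite /cindic -rmorphM/= !indicE -natrM mulnb.
  congr (_%:C); congr (nat_of_bool _)%:R.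
  apply/andP/idP => [[]|]; rewrite !inE/= !in_itv/= le_min.
    by move=> /andP[-> ->] ->.
  by move=> /and3P[-> -> ->].
have E a b : cseg a b k = cseg a (Order.min b 0) g by apply: eq_cint => xi.
have lk : cloc_integrable k.
  move=> a b; have := lg a (Order.min b 0); congr cintegrable.
  by apply/funext => xi; rewrite ind0.
have := @ae_eq0_cseg _ k lk.
move=> /(_ _)/ae_imply; apply.
  move=> xi; rewrite /k /cindic indicE => h xi0; move: h.
  by rewrite mem_set/= ?in_itv/= ?ltW// mul1r.
move=> a b ab; rewrite E.
have [am|ma] := leP a (Order.min b 0); first by apply: g0 => //; rewrite ge_min lexx orbT.
rewrite /cseg set_itv_ge; last by rewrite bnd_simp -ltNge.
by under eq_cint do rewrite /cindic indic0 mul0r; rewrite cint0.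
Qed.

Lemma cseg_opp a b g : cloc_integrable g ->
  cseg a b (fun x => g (- x)) = cseg (- b) (- a) g.
Proof.
move=> lg; rewrite /cseg -[RHS](cint_preserving (@opp_preserving R) (lg (- b) (- a))).
apply: eq_cint => x; congr (_ * _).
rewrite /cindic !indicE; congr (_%:C); congr (nat_of_bool _)%:R.
by apply/idP/idP; rewrite !inE/= !in_itv/= !lerN2 andbC.
Qed.

(* It suffices to test [f] against the transforms of the indicators of the
   segments of ]-oo, 0]. *)
Lemma HardyP f : Hardy f <-> L2 f /\
  forall a b, a <= b -> b <= 0 -> cint (fun x => f x * segft a b x) = 0.
Proof.
split=> [[Lf [g fg g0]]|[Lf f0]]; split=> //.
  move=> a b ab b0; rewrite -(cseg_fourier _ _ Lf fg).
  apply: cseg_ae0; first exact: L2_cloc_integrable (is_fourier_L2 fg).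
  apply: ae_imply2 g0 (ae_neq 0) => x gx x0 /andP[_ xb]; apply: gx.
  by rewrite lt_neqAle x0 (le_trans xb).
have [g fg] := fourier_exists Lf; exists g => //.
apply: ae_neg_eq0; first exact: L2_cloc_integrable (is_fourier_L2 fg).
by move=> a b ab b0; rewrite (cseg_fourier _ _ Lf fg); exact: f0.
Qed.

Lemma Hardy_L2 f : Hardy f -> L2 f.
Proof. by case. Qed.

Lemma HardyB f g : Hardy f -> Hardy g -> Hardy (fun x => f x - g x).
Proof.
move=> /HardyP[Lf f0] /HardyP[Lg g0]; apply/HardyP; split; first exact: L2B.
move=> a b ab b0; have LK := segft_L2 a b.
under eq_cint do rewrite mulrBl.
by rewrite cintB ?f0 ?g0 ?subrr//; exact: L2_cintegrableM.
Qed.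

Lemma HardyZ f (c : C) : Hardy f -> Hardy (fun x => c * f x).
Proof.
move=> /HardyP[Lf f0]; apply/HardyP; split; first exact: L2Z.
move=> a b ab b0; have LK := segft_L2 a b.
under eq_cint do rewrite -mulrA.
by rewrite cintZ ?f0 ?mulr0//; exact: L2_cintegrableM.
Qed.

(** This modulation translates the spectrum by [- xi], that is to the right. *)
Lemma Hardy_chr f xi : xi <= 0 -> Hardy f ->
  Hardy (fun x => expi (- (x * xi)) * f x).
Proof.
move=> xi0 /HardyP[Lf f0]; apply/HardyP; split; first exact: L2_chr.
move=> a b ab b0.
transitivity (cint (fun x => f x * segft (a + xi) (b + xi) x)).
  by apply: eq_cint => x; rewrite -segft_chr mulrCA mulrA.
by apply: f0; rewrite ?lerD2r//; lra.
Qed.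

(** By inversion the pairing of two such transforms is [2 * pi] times the length of [[a, b]] met
    with [[- d, - c]], and these lie on opposite sides of 0. *)
Lemma segft_Hardy a b : a <= b -> b <= 0 -> Hardy (segft a b).
Proof.
move=> ab b0; apply/HardyP; split; first exact: segft_L2.
move=> c d cd d0.
have -> : cint (fun x => segft a b x * segft c d x) =
    cint (fun x => ft (cindic `[a, b]) x * (ft (cindic `[- d, - c]) x)^*).
  by apply: eq_cint => x; rewrite -/(segft _ _) -/(segft _ _ _) segft_J !opprK.
rewrite inversion_L1 ?lerN2//; last exact: L2_cindic_segment.
  rewrite cseg_ae0 ?mulr0//; first exact/L2_cloc_integrable/L2_cindic_segment.
  apply: ae_imply (ae_neq 0) => x x0 /andP[dx _].
  rewrite /cindic indicE memNset//= in_itv/= => /andP[_ xb].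
  have : 0 <= x by apply: le_trans dx; rewrite oppr_ge0.
  rewrite le_eqVlt eq_sym (negbTE x0)/= => x_gt0.
  by have := lt_le_trans x_gt0 (le_trans xb b0); rewrite ltxx.
exact: cintegrable_cindic_segment.
Qed.

(* Parseval: the transform of [f] lives on [0, +oo[ and the reflected transform
   of [g] on ]-oo, 0]. *)
Lemma Hardy_cintM f g : Hardy f -> Hardy g -> cint (fun x => f x * g x) = 0.
Proof.
move=> [Lf [f' ff' f'0]] [Lg [g' gg' g'0]].
have Lg' := is_fourier_L2 gg'; have Lf' := is_fourier_L2 ff'.
have Lphi : L2 (fun xi => g' (- xi)) by exact: (L2_preserving (@opp_preserving R)).
have [gam hgam] := fourier_exists Lphi.
have Lgam := is_fourier_L2 hgam.
have gamE := fourier_inverse Lg gg' hgam.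
have := cint_fourierM Lf Lphi ff' hgam.
rewrite (@ae_eq_cint _ _ (fun=> 0)); last 3 first.
- by apply: cmeasurableM; exact: L2_measurable.
- exact: cmeasurable_cst.
- have h12 : {ae mu, forall x, (x < 0 -> f' x = 0) /\ (- x < 0 -> g' (- x) = 0)}.
    have h2 := ae_preserving (@opp_preserving R) g'0.
    by apply: ae_imply2 f'0 h2 => x.
  apply: ae_imply2 (ae_neq 0) h12 => x x0 [h1 h2].
  move: x0; rewrite neq_lt => /orP[/h1 ->|x0]; first by rewrite mul0r.
  by rewrite h2 ?mulr0// oppr_lt0.
rewrite cint0 (@ae_eq_cint _ _ (fun x => (2 * pi)%:C * (f x * g x))); last 3 first.
- by apply: cmeasurableM; exact: L2_measurable.
- apply: cmeasurableM; first exact: cmeasurable_cst.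
  by apply: cmeasurableM; exact: L2_measurable.
- by apply: ae_imply gamE => x ->; rewrite mulrCA.
rewrite cintZ; last exact: L2_cintegrableM.
move/esym/eqP; rewrite mulf_eq0 => /orP[|/eqP//].
by rewrite eq_complex/= mulf_eq0 (gt_eqF (pi_gt0 _)) pnatr_eq0.
Qed.

(** Extends the test of [HardyP] from indicators to general multipliers supported on []-oo, 0]],
    such as the modulated indicators that translation produces. *)
Lemma Hardy_cint_ft f psi : Hardy f -> cintegrable psi -> L2 psi ->
  (forall xi, 0 < xi -> psi xi = 0) -> cint (fun x => f x * ft psi x) = 0.
Proof.
move=> [Lf [g fg g0]] Ipsi Lpsi psi0; have Lg := is_fourier_L2 fg.
rewrite -(cint_fourierM Lf Lpsi fg (is_fourier_ft Ipsi Lpsi)).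
rewrite (@ae_eq_cint _ _ (fun=> 0)) ?cint0//.
- by apply: cmeasurableM; exact: L2_measurable.
apply: ae_imply2 g0 (ae_neq 0) => x gx; rewrite neq_lt => /orP[/gx ->|/psi0 ->].
  by rewrite mul0r.
by rewrite mulr0.
Qed.

(** A forward transform acts as an inverse one up to reflection, so left support in [phi] becomes
    right support in the spectrum of [P]. This is how Hardy functions are constructed here. *)
Lemma is_fourier_Hardy phi P : L2 phi -> is_fourier phi P ->
  (forall x, 0 < x -> phi x = 0) -> Hardy P.
Proof.
move=> Lphi hP phi0; have LP := is_fourier_L2 hP.
apply/HardyP; split=> // a b ab b0.
have -> : cint (fun x => P x * segft a b x) =
    cint (fun x => P x * (ft (cindic `[- b, - a]) x)^*).
  by apply: eq_cint => x; rewrite -/(segft _ _ _) segft_J !opprK.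
rewrite (fourier_inversion Lphi hP) ?lerN2// cseg_ae0 ?mulr0//.
  exact: L2_cloc_integrable.
apply: ae_imply (ae_neq 0) => x x0 /andP[bx _]; apply: phi0.
by rewrite lt_neqAle eq_sym x0 (le_trans _ bx)// oppr_ge0.
Qed.

(** For imaginary values [q^2 = - |q|^2], and [q^2] has integral 0. This rigidity is the uniqueness
    principle behind the real decomposition, the translation identity and the projection of the
    soliton. *)
Lemma Hardy_imaginary q : Hardy q -> {ae mu, forall x, q x + (q x)^* = 0} ->
  {ae mu, forall x, q x = 0}.
Proof.
move=> Hq qJ; have Lq := Hardy_L2 Hq.
apply: n2_eq0 => //.
have := Hardy_cintM Hq Hq.
rewrite (@ae_eq_cint _ _ (fun x => - (q x * (q x)^*))); last 3 first.
- by apply: cmeasurableM; exact: L2_measurable.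
- by apply: cmeasurableN; apply: cmeasurableM; [|apply: cmeasurableJ]; exact: L2_measurable.
- by apply: ae_imply qJ => x /eqP; rewrite addr_eq0 => /eqP h; rewrite {2}h mulrN.
rewrite cintN; last by apply: L2_cintegrableM => //; exact: L2J.
by rewrite cint_mulJ => /eqP; rewrite oppr_eq0 eq_complex/= => /andP[/eqP].
Qed.

(** The character is absorbed into [f], which stays in the Hardy space; this reaches the product,
    which is only integrable. *)
Lemma Hardy_ftM f g xi : Hardy f -> Hardy g -> xi <= 0 ->
  ft (fun x => f x * g x) xi = 0.
Proof.
move=> Hf Hg xi0.
transitivity (cint (fun x => expi (- (x * xi)) * f x * g x)).
  by apply: eq_cint => x; rewrite mulrA.
exact: (Hardy_cintM (Hardy_chr xi0 Hf) Hg).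
Qed.

Lemma Hardy_orthoJ f p a b : a <= b -> b <= 0 -> L2 f -> L2 p ->
  (forall h, Hardy h -> L2dot (fun x => f x - p x) h = 0) ->
  cint (fun x => (f x - p x)^* * segft a b x) = 0.
Proof.
move=> ab b0 Lf Lp ortho; have Lfp := L2B Lf Lp.
have := ortho _ (segft_Hardy ab b0).
rewrite /L2dot -/(cint _) => h.
transitivity ((cint (fun x => (f x - p x) * (segft a b x)^*))^*); last by rewrite h conjc0.
rewrite -cintJ; last by apply: L2_cintegrableM => //; apply/L2J/segft_L2.
by apply: eq_cint => x; rewrite cconjM conjcK.
Qed.

(** Conjugated orthogonality is exactly the test of [HardyP], so the conjugate of [rho - p] is a
    Hardy function. Subtracting [p] gives [rho - p - conj p], which is real; multiplied by [i] it is
    imaginary and vanishes. *)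
Lemma real_projection rho p : L2 rho -> (forall x, (rho x)^* = rho x) -> Hardy p ->
  (forall h, Hardy h -> L2dot (fun x => rho x - p x) h = 0) ->
  {ae mu, forall x, rho x = p x + (p x)^*}.
Proof.
move=> Lr rJ Hp ortho; have Lp := Hardy_L2 Hp.
have H1 : Hardy (fun x => (rho x - p x)^*).
  apply/HardyP; split; first exact/L2J/L2B.
  by move=> a b ab b0; exact: Hardy_orthoJ.
have H2 := HardyZ 'i (HardyB H1 Hp).
have h := Hardy_imaginary H2.
apply: ae_imply (h _); last first.
  apply: ae_all => x.
  by apply: complexP; have := rJ x; case: (rho x) (p x) => [a b] [c d] [] /= e; lra.
move=> x /eqP; rewrite mulf_eq0 => /orP[|/eqP].
  by rewrite eq_complex/= oner_eq0 andbF.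
move=> e; apply: complexP; move: e (rJ x); case: (rho x) (p x) => [a b] [c d] [] /= e1 e2 [] e3; lra.
Qed.

(** The spectrum is cut at 0 and transformed back. The remainder [Q] is orthogonal to [h] by the
    multiplication formula: [psi] lives on positive frequencies, while the transform of the
    conjugate of [h] vanishes there. *)
Lemma projection_exists f : L2 f -> exists p, Hardy p /\
  forall h, Hardy h -> L2dot (fun x => f x - p x) h = 0.
Proof.
move=> Lf; have [g fg] := fourier_exists Lf; have Lg := is_fourier_L2 fg.
have Lg' : L2 (fun xi => g (- xi)) by exact: (L2_preserving (@opp_preserving R)).
(* After the reflection a forward transform inverts, up to [2 * pi]; the nonnegative frequencies of
   [f] now sit on []-oo, 0]]. *)
pose phi xi := cindic `]-oo, 0] xi * g (- xi).
pose psi xi := cindic `]0, +oo[ xi * g (- xi).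
have Lphi : L2 phi by exact: L2_cindicM.
have Lpsi : L2 psi by exact: L2_cindicM.
have [P hP] := fourier_exists Lphi; have [Q hQ] := fourier_exists Lpsi.
have LP := is_fourier_L2 hP; have LQ := is_fourier_L2 hQ.
have [gam hgam] := fourier_exists Lg'; have Lgam := is_fourier_L2 hgam.
have gamE := fourier_inverse Lf fg hgam.
have split_ind xi : phi xi + psi xi = g (- xi).
  rewrite /phi /psi -mulrDl /cindic -rmorphD/= -[RHS]mul1r; congr (_ * _).
  rewrite -[X in _ = X]/(1%:C); congr (_%:C).
  have -> : \1_`]-oo, 0] xi = (xi <= 0)%R%:R :> R.
    by rewrite indicE; congr (nat_of_bool _)%:R; apply/idP/idP; rewrite inE/= in_itv.
  have -> : \1_`]0, +oo[ xi = (0 < xi)%R%:R :> R.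
    by rewrite indicE; congr (nat_of_bool _)%:R; apply/idP/idP; rewrite inE/= in_itv/= andbT.
  by case: (leP xi 0); rewrite ?addr0 ?add0r.
have PQ : {ae mu, forall x, P x + Q x = gam x}.
  have LPQ := L2D LP LQ.
  apply: ae_eq_cseg => [||a b ab]; [exact: L2_cloc_integrable..|].
  rewrite (cseg_fourier _ _ Lg' hgam).
  transitivity (cseg a b P + cseg a b Q).
    rewrite -cintD; [|exact: L2_cintegrable_segment..].
    by apply: eq_cint => x; rewrite mulrDr.
  rewrite (cseg_fourier _ _ Lphi hP) (cseg_fourier _ _ Lpsi hQ).
  have LK := segft_L2 a b.
  rewrite -cintD; [|exact: L2_cintegrableM..].
  by apply: eq_cint => x; rewrite -mulrDl split_ind.
have pi0 : (2 * pi)%:C != 0 :> C.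
  by rewrite eq_complex/= mulf_eq0 (gt_eqF (pi_gt0 _)) pnatr_eq0.
pose p x := ((2 * pi)%:C)^-1 * P x.
have fp : {ae mu, forall x, f x - p x = ((2 * pi)%:C)^-1 * Q x}.
  apply: ae_imply2 PQ gamE => x e1 e2.
  apply: (mulfI pi0); rewrite mulrBr /p !mulrA divff// !mul1r -e2 -e1.
  by rewrite addrC addKr.
exists p; split.
  apply: HardyZ; apply: is_fourier_Hardy Lphi hP _ => x x0.
  by rewrite /phi /cindic indicE memNset/= ?mul0r// in_itv/=; apply/negP; rewrite -ltNge.
move=> h Hh; have Lh := Hardy_L2 Hh; have LhJ := L2J Lh.
have [eta heta] := fourier_exists LhJ; have Leta := is_fourier_L2 heta.
have eta0 : {ae mu, forall xi, xi < 0 -> eta (- xi) = 0}.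
  apply: (@ae_neg_eq0 (fun xi => eta (- xi))).
    by apply: L2_cloc_integrable; exact: (L2_preserving (@opp_preserving R)).
  move=> a b ab b0; rewrite cseg_opp; last exact: L2_cloc_integrable.
  rewrite (cseg_fourier _ _ LhJ heta).
  have /HardyP[_ h0] := Hh.
  transitivity ((cint (fun x => h x * segft a b x))^*); last by rewrite h0// conjc0.
  rewrite -cintJ; last by apply: L2_cintegrableM => //; exact: segft_L2.
  by apply: eq_cint => x; rewrite cconjM segft_J.
rewrite /L2dot -/(cint _).
rewrite (@ae_eq_cint _ _ (fun x => ((2 * pi)%:C)^-1 * (Q x * (h x)^*))); last 3 first.
- apply: cmeasurableM; last exact: L2_measurable.
  by apply: cmeasurableB; [exact: L2_measurable|apply: L2_measurable; exact: L2Z].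
- apply: cmeasurableM; first exact: cmeasurable_cst.
  by apply: cmeasurableM; exact: L2_measurable.
- by apply: ae_imply fp => x ->; rewrite mulrA.
rewrite cintZ; last exact: L2_cintegrableM.
rewrite (cint_fourierM Lpsi LhJ hQ heta).
rewrite (@ae_eq_cint _ _ (fun=> 0)) ?cint0 ?mulr0//.
- by apply: cmeasurableM; exact: L2_measurable.
- have := ae_preserving (@opp_preserving R) eta0.
  apply: ae_imply => x; rewrite opprK oppr_lt0 => hx.
  rewrite /psi /cindic indicE; case: (boolP (x \in _)) => [|_]; last by rewrite !mul0r.
  by rewrite inE/= in_itv/= andbT => /hx ->; rewrite mulr0.
Qed.

Lemma Pi_plusP f : L2 f -> Hardy (Pi_plus f) /\
  forall h, Hardy h -> L2dot (fun x => f x - Pi_plus f x) h = 0.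
Proof.
move=> Lf; exact: (@xgetPex _ (cst 0) [set p | Hardy p /\
  forall h, Hardy h -> L2dot (fun x => f x - p x) h = 0] (projection_exists Lf)).
Qed.

End HardySpace.

(** * Weak derivatives *)

Section Smooth.
Context {R : realType}.
Implicit Types (f g : R -> R) (x : R).

(** Derivatives are peeled off from the first one on, so that the product and chain rules go through
    by induction on [n]; [derive1n] adds them at the other end. *)
Fixpoint nderivable n f : Prop :=
  if n is m.+1 then (forall x, derivable f x 1) /\ nderivable m (derive1 f) else True.

Lemma nderivable_smooth f : (forall n, nderivable n f) ->
  forall n x, derivable (derive1n n f) x 1.
Proof.
move=> df n; elim: n f df => [|n ih] f df x; first by have [] := df 1%N.
rewrite derive1Sn; apply: ih => m.
by have [] := df m.+1.
Qed.

Lemma smooth_nderivable f : (forall n x, derivable (derive1n n f) x 1) ->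
  forall n, nderivable n f.
Proof.
move=> df n; elim: n f df => [//|n ih] f df /=; split; first exact: (df 0%N).
by apply: ih => m x; rewrite -derive1Sn.
Qed.

Lemma nderivableW n f : nderivable n.+1 f -> nderivable n f.
Proof. by elim: n f => [//|n ih] f [df dn]; split=> //; exact: ih. Qed.

Lemma nderivableS n f g : (forall x : R, is_derive x (1 : R) f (g x)) ->
  nderivable n g -> nderivable n.+1 f.
Proof.
move=> df dg; split; first by move=> x; have [] := df x.
rewrite (_ : derive1 f = g)//; apply/funext => x; rewrite derive1E.
exact: derive_val.
Qed.

Lemma nderivable_is_derive n f x : nderivable n.+1 f -> is_derive x (1 : R) f (derive1 f x).
Proof. by move=> [df _]; apply: DeriveDef; rewrite ?derive1E. Qed.

Lemma nderivableD n f g : nderivable n f -> nderivable n g ->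
  nderivable n (fun x => f x + g x).
Proof.
elim: n f g => [//|n ih] f g df dg.
apply: (@nderivableS _ _ (fun x => derive1 f x + derive1 g x)).
  move=> x; have h1 := nderivable_is_derive x df; have h2 := nderivable_is_derive x dg.
  exact: is_deriveD.
by apply: ih; [case: df|case: dg].
Qed.

Lemma nderivableZ n f (c : R) : nderivable n f -> nderivable n (fun x => c * f x).
Proof.
elim: n f => [//|n ih] f df.
apply: (@nderivableS _ _ (fun x => c * derive1 f x)).
  move=> x; have := nderivable_is_derive x df => h; exact: is_deriveZ.
by apply: ih; case: df.
Qed.

Lemma nderivableM n f g : nderivable n f -> nderivable n g ->
  nderivable n (fun x => f x * g x).
Proof.
elim: n f g => [//|n ih] f g df dg.
apply: (@nderivableS _ _ (fun x => f x * derive1 g x + g x * derive1 f x)).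
  move=> x; have h1 := nderivable_is_derive x df; have h2 := nderivable_is_derive x dg.
  exact: is_deriveM.
apply: nderivableD; apply: ih.
- exact: nderivableW.
- by case: dg.
- exact: nderivableW.
- by case: df.
Qed.

Lemma nderivable_affine n f (c d : R) : nderivable n f ->
  nderivable n (fun x => f (c * x + d)).
Proof.
elim: n f => [//|n ih] f df.
apply: (@nderivableS _ _ (fun x => c * derive1 f (c * x + d))).
  move=> x.
  have dz : is_derive x (1 : R) (fun t => c * t + d) c.
    by apply: is_derive_eq; rewrite /GRing.scale/= ?(mulr1, mulr0, addr0, add0r).
  have := @is_derive1_comp _ f (fun t => c * t + d) x _ _ (nderivable_is_derive (c * x + d) df) dz.
  by rewrite mulrC.
by apply: nderivableZ; apply: ih; case: df.
Qed.

(** The classical flat function is the case [k = 0]. The power is carried along because a derivative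
    is a combination of the members [k + 1] and [k + 2], which closes the induction for
    smoothness. *)
Definition flat_exp k x : R := if 0 < x then x^-1 ^+ k * expR (- x^-1) else 0.

Lemma flat_exp_ge0 k x : 0 <= flat_exp k x.
Proof.
rewrite /flat_exp; case: ifP => // x0.
by rewrite mulr_ge0 ?expR_ge0// exprn_ge0// invr_ge0 ltW.
Qed.

(** One term of the exponential series at [1 / x], of order [k + 2], is enough. The order is chosen
    to leave [x ^+ 2], which forces a zero derivative at 0. *)
Lemma flat_exp_le k x : flat_exp k x <= (k.+2)`!%:R * x ^+ 2.
Proof.
rewrite /flat_exp; case: ifP => x0; last by rewrite mulr_ge0 ?sqr_ge0.
have xV0 : 0 < x^-1 by rewrite invr_gt0.
have h : x^-1 ^+ k.+2 <= (k.+2)`!%:R * expR x^-1.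
  rewrite mulrC -ler_pdivrMr ?ltr0n ?fact_gt0//.
  apply: le_trans (expR_ge1Dxn k.+1 (ltW xV0)); lra.
rewrite expRN ler_pdivrMr ?expR_gt0//.
rewrite mulrAC -ler_pdivrMr ?exprn_gt0//; apply: le_trans h.
by rewrite -exprVn -exprD addn2.
Qed.

Lemma is_derive0_quadratic f (c : R) : (forall x, `|f x| <= c * x ^+ 2) ->
  is_derive (0 : R) (1 : R) f 0.
Proof.
move=> fc.
have f0 : f 0 = 0 by apply/normr0_eq0/le_anti; rewrite normr_ge0 andbT (le_trans (fc 0))// expr0n mulr0.
have H : h^-1 *: ((f \o shift 0) (h *: (1 : R)) - f 0) @[h --> (0 : R)^'] --> (0 : R).
  apply/cvgr0Pnorm_le => e e0; near=> h.
  have h0 : h != 0 by near: h; exact: nbhs_dnbhs_neq.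
  rewrite f0 subr0 /= addr0 /GRing.scale/= mulr1 normrM normfV mulrC.
  rewrite ler_pdivrMr ?normr_gt0//; apply: le_trans (fc h) _.
  rewrite -real_normK ?num_real// expr2 mulrA ler_wpM2r//.
  have hc : `|h| <= e / (`|c| + 1).
    near: h; apply: dnbhs0_le; rewrite divr_gt0// ltr_wpDl.
  apply: (@le_trans _ _ ((`|c| + 1) * `|h|)).
    by rewrite ler_wpM2r// (le_trans (ler_norm c))// lerDl.
  by rewrite mulrC -ler_pdivlMr// ltr_wpDl.
apply: DeriveDef; first by apply: cvgP; exact: H.
exact: cvg_lim H.
Unshelve. all: by end_near. Qed.

Lemma is_derive_exprn f (df : R) x n : is_derive x (1 : R) f df ->
  is_derive x (1 : R) (fun y => f y ^+ n.+1) (n.+1%:R * f x ^+ n * df).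
Proof.
move=> dfx; elim: n => [|n ih].
  by rewrite expr0 !mul1r; under eq_fun do rewrite expr1.
have -> : n.+2%:R * f x ^+ n.+1 * df =
    f x *: (n.+1%:R * f x ^+ n * df) + f x ^+ n.+1 *: df.
  by rewrite /GRing.scale/= exprS -[in LHS]addn1 natrD; ring.
by under eq_fun do rewrite exprS; exact: is_deriveM.
Qed.

Lemma is_derive_flat_exp k x :
  is_derive x (1 : R) (flat_exp k) (- k%:R * flat_exp k.+1 x + flat_exp k.+2 x).
Proof.
have [x0|x0|->] := ltgtP x 0.
- have E : {near x, cst 0 =1 flat_exp k}.
    by near=> y; rewrite /flat_exp ifF//; apply/negbTE; rewrite -leNgt ltW//;
      near: y; exact: lt_nbhsl.
  apply: (near_eq_is_derive E); rewrite /flat_exp ltNge (ltW x0)/= mulr0 addr0.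
  exact: is_derive_cst.
- have E : {near x, (fun y => y^-1 ^+ k * expR (- y^-1)) =1 flat_exp k}.
    by near=> y; rewrite /flat_exp ifT//; near: y; exact: lt_nbhsr.
  apply: (near_eq_is_derive E); rewrite /flat_exp x0.
  have xn0 : x != 0 by rewrite gt_eqF.
  have dV : is_derive x (1 : R) (fun y : R => y^-1) (- x^-1 ^+ 2).
    have := @is_deriveV _ id x 1 1 xn0 (is_derive_id _ _).
    by rewrite /GRing.scale/= mulr1 exprVn.
  have dN : is_derive x (1 : R) (fun y : R => - y^-1) (x^-1 ^+ 2).
    by have := is_deriveN dV; rewrite opprK.
  have dE : is_derive x (1 : R) (fun y : R => expR (- y^-1)) (expR (- x^-1) * x^-1 ^+ 2).
    exact: (@is_derive1_comp _ expR (fun y => - y^-1) x _ _ (is_derive_expR _) dN).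
  case: k {E} => [|k].
    under eq_fun do rewrite expr0 mul1r.
    by rewrite oppr0 mul0r add0r mulrC.
  have dX := is_derive_exprn k dV.
  have := is_deriveM dX dE.
  congr (is_derive _ _ _ _).
  rewrite /GRing.scale/= !exprS; ring.
have -> : - k%:R * flat_exp k.+1 0 + flat_exp k.+2 0 = 0.
  by rewrite /flat_exp ltxx mulr0 addr0.
apply: (@is_derive0_quadratic _ (k.+2)`!%:R) => y.
by rewrite ger0_norm ?flat_exp_ge0// flat_exp_le.
Unshelve. all: by end_near. Qed.

Lemma nderivable_flat_exp n k : nderivable n (flat_exp k).
Proof.
elim: n k => [//|n ih] k; apply: nderivableS; first exact: is_derive_flat_exp.
by apply: nderivableD => //; exact: nderivableZ.
Qed.

Lemma flat_exp_le1 x : flat_exp 0 x <= 1.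
Proof.
rewrite /flat_exp; case: ifP => // x0.
by rewrite expr0 mul1r expR_le1 oppr_le0 invr_ge0 ltW.
Qed.

Lemma flat_exp_eq0 k x : x <= 0 -> flat_exp k x = 0.
Proof. by rewrite /flat_exp leNgt => /negbTE ->. Qed.

Lemma flat_exp_cvg x : 0 < x -> flat_exp 0 (n.+1%:R * x) @[n --> \oo] --> (1 : R).
Proof.
move=> x0.
have E n : flat_exp 0 (n.+1%:R * x) = expR (- (n.+1%:R^-1 * x^-1)).
  by rewrite /flat_exp mulr_gt0// expr0 mul1r invfM.
rewrite (funext E).
have h : - (n.+1%:R^-1 * x^-1) @[n --> \oo] --> (0 : R).
  rewrite -oppr0; apply: cvgN; rewrite -(mul0r x^-1).
  by apply: cvgM; [exact: cvg_harmonic|exact: cvg_cst].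
by have := cvg_comp _ _ h (@continuous_expR R 0); rewrite expR0.
Qed.

(** The two edges steepen as [n] grows; the bumps stay below the indicator of [[a, b]] and tend to
    that of []a, b[], so identities on test functions pass to segments by dominated convergence. *)
Definition smooth_bump a b (n : nat) x :=
  flat_exp 0 (n.+1%:R * (x - a)) * flat_exp 0 (n.+1%:R * (b - x)).

Lemma test_function_support f (M : R) : (forall n, nderivable n f) ->
  (forall x, M < `|x| -> f x = 0) -> test_function f.
Proof.
move=> df f0; split; first exact: nderivable_smooth.
apply: (subclosed_compact _ (@segment_compact R (- M) M)).
  exact: closed_closure.
have cl : closed `[- M, M]%classic by exact: interval_closed.
rewrite ((closure_id _).1 cl); apply: closure_subset => x /= fx.
rewrite in_itv/= -ler_norml leNgt; apply/negP => /f0 e.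
by rewrite e eqxx in fx.
Qed.

Lemma test_bump a b n : test_function (smooth_bump a b n).
Proof.
apply: (@test_function_support _ (`|a| + `|b|)).
  move=> m; rewrite /smooth_bump.
  have E1 : (fun x => flat_exp 0 (n.+1%:R * (x - a))) =
      (fun x => flat_exp 0 (n.+1%:R * x + - (n.+1%:R * a))).
    by apply/funext => x; rewrite mulrBr.
  have E2 : (fun x => flat_exp 0 (n.+1%:R * (b - x))) =
      (fun x => flat_exp 0 (- n.+1%:R * x + n.+1%:R * b)).
    by apply/funext => x; rewrite mulrBr mulNr addrC.
  apply: nderivableM; rewrite ?E1 ?E2; apply: nderivable_affine;
    exact: nderivable_flat_exp.
move=> x xM; rewrite /smooth_bump.
have [xa|ax] := leP x a.
  by rewrite flat_exp_eq0 ?mul0r// mulr_ge0_le0// subr_le0.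
have [bx|xb] := leP b x.
  by rewrite [X in _ * X]flat_exp_eq0 ?mulr0// mulr_ge0_le0// subr_le0.
exfalso; move: xM; apply/negP; rewrite -leNgt ler_norml; apply/andP.
have := ler_norm b; have := ler_norm (- a); rewrite normrN.
by have := normr_ge0 a; have := normr_ge0 b; split; lra.
Qed.

Lemma bump_ge0 a b n x : 0 <= smooth_bump a b n x.
Proof. by rewrite mulr_ge0 ?flat_exp_ge0. Qed.

Lemma bump_le_indic a b n x : smooth_bump a b n x <= \1_`[a, b] x.
Proof.
rewrite indicE; case: (boolP (x \in _)) => [_|].
  by rewrite -[leRHS]mulr1 ler_pM ?flat_exp_ge0 ?flat_exp_le1.
rewrite notin_setE/= in_itv/= => /negP; rewrite negb_and -!ltNge /smooth_bump.
move=> /orP[xa|bx].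
  by rewrite flat_exp_eq0 ?mul0r// mulr_ge0_le0// subr_le0 ltW.
by rewrite [X in _ * X]flat_exp_eq0 ?mulr0// mulr_ge0_le0// subr_le0 ltW.
Qed.

Lemma bump_cvg a b x : smooth_bump a b n x @[n --> \oo] --> (\1_`]a, b[ x : R).
Proof.
rewrite indicE; case: (boolP (x \in _)) => [|].
  rewrite inE/= in_itv/= => /andP[ax bx].
  by rewrite -[X in _ --> X]mulr1; apply: cvgM; apply: flat_exp_cvg; rewrite subr_gt0.
rewrite notin_setE/= in_itv/= => /negP; rewrite negb_and -!leNgt => xab.
apply: cvg_near_cst; apply: nearW => n; rewrite /smooth_bump.
move: xab => /orP[xa|bx].
  by rewrite flat_exp_eq0 ?mul0r// mulr_ge0_le0// subr_le0.
by rewrite [X in _ * X]flat_exp_eq0 ?mulr0// mulr_ge0_le0// subr_le0.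
Qed.

Lemma test_function_bounded_support f : test_function f ->
  exists2 M : R, 0 < M & forall x, M < `|x| -> f x = 0.
Proof.
move=> [_ /compact_bounded[M [_ HM]]].
exists (`|M| + 1); first by rewrite ltr_wpDl.
move=> x xM; apply/eqP; apply: contraT => fx.
have : closure [set y | f y != 0] x by exact: subset_closure.
move/(HM (`|M| + 1)) => h.
have : `|x| <= `|M| + 1.
  by apply: h; rewrite (le_lt_trans (ler_norm M))// ltrDl.
by rewrite leNgt xM.
Qed.

Lemma test_function_is_derive f x : test_function f -> is_derive x (1 : R) f (derive1 f x).
Proof.
move=> [df _]; exact: (nderivable_is_derive x (smooth_nderivable df 1%N)).
Qed.

Lemma test_function_nderivable f n : test_function f -> nderivable n f.
Proof. by move=> [df _]; exact: smooth_nderivable. Qed.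

Lemma test_function_continuous f : test_function f -> continuous f.
Proof.
move=> tf; apply: (@is_derive_continuous _ _ (derive1 f)) => x.
exact: test_function_is_derive.
Qed.

Lemma test_function_continuous1 f : test_function f -> continuous (derive1 f).
Proof.
move=> tf; have [_ d2] := test_function_nderivable 2 tf.
apply: (@is_derive_continuous _ _ (derive1 (derive1 f))) => x.
exact: (@nderivable_is_derive 0 _ x d2).
Qed.

Lemma test_function_derive0 f (M : R) : (forall x, M < `|x| -> f x = 0) ->
  forall x, M < `|x| -> derive1 f x = 0.
Proof.
move=> f0 x xM; rewrite derive1E.
have E : {near x, f =1 cst 0}.
  near=> y; apply: f0; near: y.
  have c : (fun y : R => `|y|) y @[y --> x] --> `|x| by exact: norm_continuous.
  exact: (cvgr_gt _ c _ xM).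
by rewrite (near_eq_derive _ E) derive_cst.
Unshelve. all: by end_near. Qed.

End Smooth.

(** * Absolutely continuous functions and integration by parts *)

Section AbsolutelyContinuous.
Context {R : realType}.
Local Notation mu := (@lebesgue_measure R).
Local Notation T := (measurableTypeR R).
Implicit Types (f g F G phi : R -> R) (a b c x : R).

Lemma indicM_patch f (A : set R) : (fun x => \1_A x * f x) = f \_ A.
Proof.
apply/funext => x; rewrite patchE indicE.
by case: (x \in A); rewrite ?mul1r ?mul0r.
Qed.

Lemma integrable_segmentP f a b : mu.-integrable `[a, b] (EFin \o f) <->
  mu.-integrable setT (EFin \o (fun x => \1_`[a, b] x * f x)).
Proof.
rewrite indicM_patch -restrict_EFin.
exact: (@integrable_mkcond _ T R mu `[a, b]%classic (EFin \o f) (measurable_itv _)).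
Qed.

Lemma Rintegral_segment f a b :
  \int[mu]_(x in `[a, b]) f x = \int[mu]_x (\1_`[a, b] x * f x).
Proof. by rewrite Rintegral_mkcond -indicM_patch. Qed.

(** Absolute continuity as an integral formula: [F] is an actual function, whereas [f] matters only
    up to null sets. *)
Definition ac F f := loc_integrable f /\
  forall a b, a <= b -> F b - F a = \int[mu]_(x in `[a, b]) f x.

Lemma ac_prim f : loc_integrable f -> ac (prim f) f.
Proof. by move=> lf; split => // a b ab; exact: primB. Qed.

Lemma ac_C1 F f : (forall x : R, is_derive x (1 : R) F (f x)) -> continuous f -> ac F f.
Proof.
move=> dF cf; split => [a b|a b ab]; first exact: integrable_continuous_segment.
by rewrite (Rintegral_FTC ab dF cf).
Qed.

Lemma ac_addr F f c : ac F f -> ac (fun x => F x + c) f.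
Proof.
by move=> [lf Ff]; split => // a b ab; rewrite -(Ff a b ab); ring.
Qed.

Lemma loc_integrableD f g : loc_integrable f -> loc_integrable g ->
  loc_integrable (fun x => f x + g x).
Proof.
move=> lf lg a b; have := @integrableD _ T R mu `[a, b]%classic (measurable_itv _) _ _ (lf a b) (lg a b).
by apply: eq_integrable.
Qed.

Lemma loc_integrableZ f c : loc_integrable f -> loc_integrable (fun x => c * f x).
Proof.
move=> lf a b; have := @integrableZl _ T R mu `[a, b]%classic (measurable_itv _) c _ (lf a b).
by apply: eq_integrable.
Qed.

Lemma acD F G f g : ac F f -> ac G g -> ac (fun x => F x + G x) (fun x => f x + g x).
Proof.
move=> [lf Ff] [lg Gg]; split; first exact: loc_integrableD.
move=> a b ab; rewrite RintegralD//.
by rewrite -(Ff a b ab) -(Gg a b ab); ring.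
Qed.

Lemma acZ F f c : ac F f -> ac (fun x => c * F x) (fun x => c * f x).
Proof.
move=> [lf Ff]; split; first exact: loc_integrableZ.
move=> a b ab; rewrite RintegralZl//.
by rewrite -(Ff a b ab); ring.
Qed.

(* Fubini on the triangle [{(x, y) | a <= y <= x <= b}]. *)
Lemma ac_triangle F G f g a b : a <= b -> ac F f -> ac G g ->
  [/\ mu.-integrable `[a, b] (EFin \o (fun x => f x * (G x - G a))),
      mu.-integrable `[a, b] (EFin \o (fun x => g x * (F b - F x))) &
      \int[mu]_(x in `[a, b]) (f x * (G x - G a)) =
      \int[mu]_(y in `[a, b]) (g y * (F b - F y))].
Proof.
move=> ab [lf Ff] [lg Gg].
pose fa x := \1_`[a, b] x * f x; pose ga x := \1_`[a, b] x * g x.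
have ifa : mu.-integrable setT (EFin \o fa) by apply/integrable_segmentP; exact: lf.
have iga : mu.-integrable setT (EFin \o ga) by apply/integrable_segmentP; exact: lg.
have mfa : measurable_fun setT fa by have /measurable_int/measurable_EFinP := ifa.
have mga : measurable_fun setT ga by have /measurable_int/measurable_EFinP := iga.
pose tri (z : T * T) : R := if z.2 <= z.1 then 1 else 0.
have mtri : measurable_fun setT tri.
  apply: measurable_fun_ifT => //; apply: measurable_fun_ler.
    exact: measurable_snd.
  exact: measurable_fst.
have tri_le z : `|tri z| <= 1 by rewrite /tri; case: ifP; rewrite ?normr1 ?normr0.
pose H (z : T * T) := fa z.1 * (ga z.2 * tri z).
have mH : measurable_fun setT H.
  apply: measurable_funM; first exact: measurableT_comp mfa measurable_fst.
  apply: measurable_funM => //; exact: measurableT_comp mga measurable_snd.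
have mtx x : measurable_fun setT (fun y => tri (x, y)).
  exact: (measurableT_comp mtri (measurable_pair1 x)).
have mty y : measurable_fun setT (fun x => tri (x, y)).
  exact: (measurableT_comp mtri (measurable_pair2 y)).
have igx x : mu.-integrable setT (EFin \o (fun y => ga y * tri (x, y))).
  apply: le_integrable iga => //.
    by apply/measurable_EFinP; exact: measurable_funM.
  by move=> y _ /=; rewrite lee_fin normrM ler_piMr.
have ify y : mu.-integrable setT (EFin \o (fun x => fa x * tri (x, y))).
  apply: le_integrable ifa => //.
    by apply/measurable_EFinP; apply: measurable_funM; [exact: mfa|exact: mty].
  by move=> x _ /=; rewrite lee_fin normrM ler_piMr.
have Hx x : mu.-integrable setT (EFin \o (fun y => H (x, y))).
  exact: (integrableZ_EFin (fa x) (igx x)).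
have Hy y : mu.-integrable setT (EFin \o (fun x => H (x, y))).
  have := integrableZ_EFin (ga y) (ify y); apply: eq_integrable => // x _.
  by rewrite /H/= mulrCA.
have mnga : measurable_fun setT (fun y => (`|ga y|)%:E).
  by apply/measurable_EFinP; exact: measurableT_comp.
have mnfa : measurable_fun setT (fun y => (`|fa y|)%:E).
  by apply/measurable_EFinP; exact: measurableT_comp.
have mnH : measurable_fun setT (fun z => (`|H z|)%:E).
  by apply/measurable_EFinP; exact: measurableT_comp.
have mnHx x : measurable_fun setT (fun y => (`|H (x, y)|)%:E).
  exact: (measurableT_comp mnH (measurable_pair1 x)).
have Foo : (\int[mu]_x \int[mu]_y `|H (x, y)|%:E < +oo)%E.
  have /integrableP[_ foo] := ifa; have /integrableP[_ goo] := iga.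
  have gfin : (\int[mu]_y `|ga y|%:E)%E \is a fin_num.
    by rewrite ge0_fin_numE// integral_ge0.
  have B x : (\int[mu]_y `|H (x, y)|%:E <=
      (fine (\int[mu]_y `|ga y|%:E))%:E * `|fa x|%:E)%E.
    rewrite fineK// muleC -ge0_integralZl_EFin//.
    apply: ge0_le_integral => //.
    - by apply: emeasurable_funM => //; exact: mnga.
    - by move=> y _; rewrite -EFinM lee_fin /H/= !normrM ler_wpM2l// ler_piMr.
  apply: (@le_lt_trans _ _ (\int[mu]_x ((fine (\int[mu]_y `|ga y|%:E))%:E * `|fa x|%:E))%E).
    apply: ge0_le_integral => //.
    - by move=> x _; apply: integral_ge0.
    - exact: (@measurable_fun_fubini_tonelli_F _ _ T T R mu (fun z => `|H z|%:E)).
    - by apply: emeasurable_funM => //; exact: mnfa.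
  rewrite ge0_integralZl_EFin//.
  - by rewrite lte_mul_pinfty// lee_fin fine_ge0// integral_ge0.
  - by rewrite fine_ge0// integral_ge0.
have [I1 I2 E] := Rintegral_fubini mH Foo Hx Hy.
have E1 x : \int[mu]_y H (x, y) = \1_`[a, b] x * (f x * (G x - G a)).
  transitivity (fa x * \int[mu]_y (ga y * tri (x, y))).
    by rewrite -RintegralZl//; exact: igx.
  rewrite /fa -mulrA indicE; case: (boolP (x \in _)) => [|_]; last by rewrite !mul0r.
  rewrite inE/= in_itv/= => /andP[ax xb]; rewrite !mul1r; congr (_ * _).
  rewrite (Gg a x ax) Rintegral_segment; apply: eq_Rintegral => y _.
  rewrite /ga mulrAC; congr (_ * _); rewrite /tri/= !indicE.
  have -> : y \in `[a, b]%classic = (a <= y <= b) by apply/idP/idP; rewrite inE/= in_itv.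
  have -> : y \in `[a, x]%classic = (a <= y <= x) by apply/idP/idP; rewrite inE/= in_itv.
  case: (leP y x) => [yx|xy]; last by rewrite mulr0 andbF.
  by rewrite mulr1 (le_trans yx xb).
have E2 y : \int[mu]_x H (x, y) = \1_`[a, b] y * (g y * (F b - F y)).
  transitivity (ga y * \int[mu]_x (fa x * tri (x, y))).
    rewrite -RintegralZl//.
    by apply: eq_Rintegral => x _; rewrite /H/= mulrCA.
  rewrite /ga -mulrA indicE; case: (boolP (y \in _)) => [|_]; last by rewrite !mul0r.
  rewrite inE/= in_itv/= => /andP[ay yb]; rewrite !mul1r; congr (_ * _).
  rewrite (Ff y b yb) Rintegral_segment; apply: eq_Rintegral => x _.
  rewrite /fa mulrAC; congr (_ * _); rewrite /tri/= !indicE.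
  have -> : x \in `[a, b]%classic = (a <= x <= b) by apply/idP/idP; rewrite inE/= in_itv.
  have -> : x \in `[y, b]%classic = (y <= x <= b) by apply/idP/idP; rewrite inE/= in_itv.
  case: (leP y x) => [yx|xy]; last by rewrite mulr0.
  by rewrite mulr1 (le_trans ay yx).
split.
- by apply/integrable_segmentP; rewrite -(funext E1).
- by apply/integrable_segmentP; rewrite -(funext E2).
- rewrite !Rintegral_segment; under eq_Rintegral do rewrite -E1.
  by under [RHS]eq_Rintegral do rewrite -E2.
Qed.

Lemma acM_integrable F G f g a b : ac F f -> ac G g ->
  mu.-integrable `[a, b] (EFin \o (fun x => f x * G x)) /\
  mu.-integrable `[a, b] (EFin \o (fun x => F x * g x)).
Proof.
move=> aF aG; have [lf Ff] := aF; have [lg Gg] := aG.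
have [ab|ba] := leP a b; last first.
  by rewrite set_itv_ge ?bnd_simp -?ltNge//; split; exact: integrable_set0.
have [h1 h2 _] := ac_triangle ab aF aG; split.
  have := @integrableD _ T R mu `[a, b]%classic (measurable_itv _) _ _ h1 (loc_integrableZ (G a) lf a b).
  by apply: eq_integrable => // x _; rewrite /= -EFinD; congr EFin; ring.
have := @integrableB _ T R mu `[a, b]%classic (measurable_itv _) _ _ (loc_integrableZ (F b) lg a b) h2.
by apply: eq_integrable => // x _; rewrite /= -EFinB; congr EFin; ring.
Qed.

(** Expanding both sides of the triangle identity gives integration by parts, which is the integral
    formula for the product. *)
Lemma acM F G f g : ac F f -> ac G g ->
  ac (fun x => F x * G x) (fun x => f x * G x + F x * g x).
Proof.
move=> aF aG; have [lf Ff] := aF; have [lg Gg] := aG.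
have fG a b : mu.-integrable `[a, b] (EFin \o (fun x => f x * G x)).
  by have [] := acM_integrable a b aF aG.
have Fg a b : mu.-integrable `[a, b] (EFin \o (fun x => F x * g x)).
  by have [] := acM_integrable a b aF aG.
split=> [|a b ab]; first exact: loc_integrableD.
rewrite RintegralD//; do ?[exact: fG|exact: Fg].
have [h1 h2 E] := ac_triangle ab aF aG.
have e1 : \int[mu]_(x in `[a, b]) (f x * (G x - G a)) =
    \int[mu]_(x in `[a, b]) (f x * G x) - G a * (F b - F a).
  rewrite (Ff a b ab) -RintegralZl//.
  rewrite -RintegralB//; do ?[exact: fG|exact: (loc_integrableZ _ lf)].
  by apply: eq_Rintegral => x _; ring.
have e2 : \int[mu]_(x in `[a, b]) (g x * (F b - F x)) =
    F b * (G b - G a) - \int[mu]_(x in `[a, b]) (F x * g x).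
  rewrite (Gg a b ab) -RintegralZl//.
  rewrite -RintegralB//; do ?[exact: Fg|exact: (loc_integrableZ _ lg)].
  by apply: eq_Rintegral => x _; ring.
move: E; rewrite e1 e2; lra.
Qed.

(** Obtained from the product rule with the identity function, whose derivative 1 leaves [F]
    alone. *)
Lemma ac_loc_integrable F f : ac F f -> loc_integrable F.
Proof.
move=> aF a b.
have aid : ac id (cst 1).
  by apply: ac_C1 => x; exact: cvg_cst.
have [_] := acM_integrable a b aF aid.
by apply: eq_integrable => // x _; rewrite /= mulr1.
Qed.

Lemma ac_continuous F f : ac F f -> continuous F.
Proof.
move=> [lf Ff] x.
pose G y := parameterized_integral mu (x - 1) y f.
have cG : G y @[y --> x] --> G x.
  have ab : x - 1 < x + 1 by lra.
  have c := parameterized_integral_continuous (ltW ab) (lf (x - 1) (x + 1)).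
  have xx : x \in `]x - 1, x + 1[ by rewrite in_itv/=; apply/andP; split; lra.
  exact: (within_continuous_continuous ab c xx).
have E : {near x, (fun y => G y + F (x - 1)) =1 F}.
  near=> y; rewrite /G /parameterized_integral -Ff ?subrK//.
  by apply/ltW; near: y; apply: lt_nbhsr; lra.
have c : G y + F (x - 1) @[y --> x] --> F x.
  have -> : F x = G x + F (x - 1).
    by rewrite /G /parameterized_integral -Ff ?subrK//; lra.
  by apply: cvgD; [exact: cG|exact: cvg_cst].
by apply: cvg_trans c; apply: near_eq_cvg.
Unshelve. all: by end_near. Qed.

End AbsolutelyContinuous.

(** * Weak derivatives and absolutely continuous representatives *)

Section WeakDerivative.
Context {R : realType}.
Local Open Scope complex_scope.
Local Notation C := R[i].
Local Notation mu := (@lebesgue_measure R).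
Implicit Types (u v k U : R -> C) (f F phi psi : R -> R) (a b x M : R).

Lemma bounded_support f M : continuous f -> (forall x, M < `|x| -> f x = 0) ->
  exists B, forall x, `|f x| <= B.
Proof.
move=> cf f0.
have cK : compact (f @` `[- M, M]%classic).
  by apply: continuous_compact; [exact: continuous_subspaceT|exact: segment_compact].
have [B [_ HB]] := compact_bounded cK.
exists (`|B| + 1) => x.
have B1 : B < `|B| + 1 by rewrite (le_lt_trans (ler_norm B))// ltrDl.
have [xM|Mx] := leP `|x| M; last by rewrite f0// normr0 addr_ge0.
by apply: (HB _ B1); exists x => //=; rewrite in_itv/= -ler_norml.
Qed.

Lemma mul_support_indic f k M : (forall x, M < `|x| -> f x = 0) ->
  (fun x => k x * (f x)%:C) = (fun x => (f x)%:C * (cindic `[- M, M] x * k x)).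
Proof.
move=> f0; apply/funext => x; rewrite /cindic indicE.
have [xM|Mx] := leP `|x| M; last by rewrite f0// mulr0 mul0r.
by rewrite mem_set/= ?in_itv/= -?ler_norml// mul1r mulrC.
Qed.

Lemma cintegrable_support f k M : cloc_integrable k -> continuous f ->
  (forall x, M < `|x| -> f x = 0) -> cintegrable (fun x => k x * (f x)%:C).
Proof.
move=> lk cf f0; have [B fB] := bounded_support cf f0.
rewrite (mul_support_indic k f0); apply: (cintegrableM (M := B) (lk _ _)).
  by apply: cmeasurable_real; exact: continuous_measurable_fun.
by move=> x; rewrite normc_real.
Qed.

Lemma cintegrable_test phi k : cloc_integrable k -> test_function phi ->
  cintegrable (fun x => k x * (phi x)%:C).
Proof.
move=> lk tphi; have [M _ phi0] := test_function_bounded_support tphi.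
exact: (cintegrable_support lk (test_function_continuous tphi) phi0).
Qed.

Lemma cintegrable_test1 phi k : cloc_integrable k -> test_function phi ->
  cintegrable (fun x => k x * (derive1 phi x)%:C).
Proof.
move=> lk tphi; have [M _ phi0] := test_function_bounded_support tphi.
exact: (cintegrable_support lk (test_function_continuous1 tphi) (test_function_derive0 phi0)).
Qed.

Lemma bump_cint_cvg a b k : cloc_integrable k ->
  ccvg (fun n => cint (fun x => k x * (smooth_bump a b n x)%:C)) (cseg a b k).
Proof.
move=> lk; have mk := cloc_measurable lk.
have mb n : measurable_fun setT (smooth_bump a b n).
  by apply: continuous_measurable_fun; exact: test_function_continuous (test_bump a b n).
have -> : cseg a b k = cint (fun x => k x * (\1_(`]a, b[%classic) x)%:C).
  apply: ae_eq_cint.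
  - by apply: cmeasurableM => //; exact: cmeasurable_cindic.
  - by apply: cmeasurableM => //; exact: (cmeasurable_cindic (A := `]a, b[%classic)).
  apply: ae_imply2 (ae_neq a) (ae_neq b) => x xa xb.
  rewrite mulrC; congr (_ * _); rewrite /cindic !indicE; congr (_%:C); congr (nat_of_bool _)%:R.
  apply/idP/idP; rewrite !inE/= !in_itv/= => /andP[h1 h2].
    by rewrite !lt_neqAle h1 h2 eq_sym xa xb.
  by rewrite !ltW.
apply: (@cint_dominated _ _ _ (fun x => normc (cindic `[a, b] x * k x))).
- by move=> n; apply: cmeasurableM => //; exact: cmeasurable_real.
- by apply: cmeasurableM => //; exact: (cmeasurable_cindic (A := `]a, b[%classic)).
- move=> x; apply: ccvgM; first exact: ccvg_cst.
  by split=> /=; [exact: bump_cvg|exact: cvg_cst].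
- exact: integrable_normc (lk a b).
- move=> n x; rewrite !normcM mulrC ler_wpM2r ?normc_ge0// normc_cindic normc_real.
  by rewrite ger0_norm ?bump_ge0// bump_le_indic.
Qed.

Lemma test_ae_eq0 k : cloc_integrable k ->
  (forall psi, test_function psi -> cint (fun x => k x * (psi x)%:C) = 0) ->
  {ae mu, forall x, k x = 0}.
Proof.
move=> lk k0; apply: ae_eq0_cseg => // a b _.
have := bump_cint_cvg a b lk.
under eq_fun do rewrite (k0 _ (test_bump a b _)).
by move/ccvg_unique; apply; exact: ccvg_cst.
Qed.

Lemma weak_derivative_unique u v1 v2 : L2 v1 -> L2 v2 ->
  weak_derivative u v1 -> weak_derivative u v2 -> {ae mu, forall x, v1 x = v2 x}.
Proof.
move=> L1 L2 w1 w2.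
have l1 := L2_cloc_integrable L1; have l2 := L2_cloc_integrable L2.
have := test_ae_eq0 (cloc_integrableB l1 l2).
move=> /(_ _)/ae_imply; apply; first by move=> x /eqP; rewrite subr_eq0 => /eqP.
move=> psi tpsi; under eq_cint do rewrite mulrBl.
rewrite cintB; [|exact: cintegrable_test..].
apply/eqP; rewrite subr_eq0 -eqr_opp -[X in X == _](w1 _ tpsi).
by rewrite -[X in _ == X](w2 _ tpsi).
Qed.

Lemma ac_test F f phi : ac F f -> test_function phi ->
  \int[mu]_x (F x * derive1 phi x) = - \int[mu]_x (f x * phi x).
Proof.
move=> aF tphi; have [M M0 phi0] := test_function_bounded_support tphi.
have phi1 := test_function_derive0 phi0.
have aphi : ac phi (derive1 phi).
  by apply: ac_C1; [move=> x; exact: test_function_is_derive|exact: test_function_continuous1].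
(* The test function is known to vanish only where [M < |x|]; the margin of 1 puts the endpoints
   there and kills the boundary terms. *)
have M1 : - (M + 1) <= M + 1 by lra.
have seg (g h : R -> R) : (forall x, M < `|x| -> h x = 0) ->
    \int[mu]_x (g x * h x) = \int[mu]_(x in `[- (M + 1), M + 1]) (g x * h x).
  move=> h0; rewrite Rintegral_segment; apply: eq_Rintegral => x _.
  rewrite indicE; case: (boolP (x \in _)) => [_|]; first by rewrite mul1r.
  rewrite notin_setE/= in_itv/= -ler_norml => /negP; rewrite -ltNge => Mx.
  by rewrite h0 ?mulr0//; lra.
have [_ E] := acM aF aphi.
have [i1 i2] := acM_integrable (- (M + 1)) (M + 1) aF aphi.
have := E _ _ M1.
rewrite phi0; last by rewrite ger0_norm; lra.
rewrite (phi0 (- (M + 1))); last by rewrite normrN ger0_norm; lra.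
rewrite !mulr0 subrr (seg F _ phi1) (seg f _ phi0) RintegralD//.
by move/esym/eqP; rewrite addrC addr_eq0 => /eqP.
Qed.

Definition cac U v := ac (fun x => complex.Re (U x)) (fun x => complex.Re (v x)) /\
  ac (fun x => complex.Im (U x)) (fun x => complex.Im (v x)).

Lemma cac_weak_derivative U v : cac U v -> weak_derivative U v.
Proof.
move=> [a1 a2] phi tphi.
have EU : cint (fun x => U x * (derive1 phi x)%:C) =
    (\int[mu]_x (complex.Re (U x) * derive1 phi x)) +i*
    (\int[mu]_x (complex.Im (U x) * derive1 phi x)).
  by apply: complexP => /=; apply: eq_Rintegral => x _; rewrite !ReImE /=; ring.
have Ev : cint (fun x => v x * (phi x)%:C) =
    (\int[mu]_x (complex.Re (v x) * phi x)) +i*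
    (\int[mu]_x (complex.Im (v x) * phi x)).
  by apply: complexP => /=; apply: eq_Rintegral => x _; rewrite !ReImE /=; ring.
rewrite -/(cint _) -/(cint _) EU Ev.
by rewrite (ac_test a1 tphi) (ac_test a2 tphi); apply: complexP; rewrite ReImE.
Qed.

Definition cprim k x : C :=
  prim (fun t => complex.Re (k t)) x +i* prim (fun t => complex.Im (k t)) x.

Lemma cac_cprim k : cloc_integrable k -> cac (cprim k) k.
Proof. by move=> /cloc_integrableP[l1 l2]; split; exact: ac_prim. Qed.

Lemma cac_addr U v (c : C) : cac U v -> cac (fun x => U x + c) v.
Proof.
move=> [a1 a2]; split.
- by have := ac_addr (complex.Re c) a1; under eq_fun do rewrite -cReD.
- by have := ac_addr (complex.Im c) a2; under eq_fun do rewrite -cImD.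
Qed.

Lemma cac_cloc_integrable U v : cac U v -> cloc_integrable U.
Proof.
move=> [a1 a2]; apply/cloc_integrableP; split.
- exact: (ac_loc_integrable a1).
- exact: (ac_loc_integrable a2).
Qed.

Lemma cacB U v a b : cac U v -> a <= b -> U b - U a = cseg a b v.
Proof.
move=> [[_ a1] [_ a2]] ab.
by apply: complexP; rewrite !ReImE ?Re_cseg ?Im_cseg; [exact: a1|exact: a2].
Qed.

(** A primitive of [psi] need not have compact support, but its increment over a window of length
    [t] vanishes once the window leaves the support, that is for [|x| > M + t]. *)
Lemma test_prim_shift psi (t : R) : 0 <= t -> test_function psi ->
  test_function (fun x => prim psi x - prim psi (x - t)) /\
  forall x, derive1 (fun x => prim psi x - prim psi (x - t)) x = psi x - psi (x - t).
Proof.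
move=> t0 tpsi; have cpsi := test_function_continuous tpsi.
have [M M0 psi0] := test_function_bounded_support tpsi.
have lpsi : loc_integrable psi by move=> a b; exact: integrable_continuous_segment.
have d x : is_derive x (1 : R) (fun x => prim psi x - prim psi (x - t)) (psi x - psi (x - t)).
  have d1 y := continuous_derive_prim lpsi (cpsi y).
  have dz : is_derive x (1 : R) (fun y => y - t) (1 : R).
    by rewrite -[X in is_derive _ _ _ X]addr0; exact: is_deriveD.
  have d2 := @is_derive1_comp _ (prim psi) (fun y => y - t) x _ _ (d1 (x - t)) dz.
  rewrite mulr1 in d2; have := d1 x => d1x; exact: is_deriveB.
have dE : derive1 (fun x => prim psi x - prim psi (x - t)) = fun x => psi x - psi (x - t).
  by apply/funext => x; rewrite derive1E; exact: derive_val.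
split; last by move=> x; rewrite dE.
apply: (@test_function_support _ _ (M + t)).
  case=> [//|n]; apply: (nderivableS d).
  apply: nderivableD; first exact: test_function_nderivable.
  rewrite (_ : (fun x => _) = fun x => -1 * psi (1 * x + - t)).
    2: by apply/funext => x; rewrite mul1r mulN1r.
  apply: nderivableZ; apply: nderivable_affine; exact: test_function_nderivable.
move=> x xM; rewrite primB//; last by lra.
rewrite (_ : \int[mu]_(s in `[x - t, x]) psi s = \int[mu]_(s in `[x - t, x]) 0).
  by rewrite Rintegral_cst// mul0r.
apply: eq_Rintegral => s; rewrite inE/= in_itv/= => /andP[s1 s2]; apply: psi0.
have [x0|x0] := leP 0 x.
  rewrite ger0_norm// in xM; rewrite ger0_norm; lra.
rewrite ltr0_norm// in xM; rewrite ltr0_norm; lra.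
Qed.

Lemma cseg_shift k a b (t : R) : cloc_integrable k ->
  cseg (a + t) (b + t) k = cseg a b (fun x => k (x + t)).
Proof.
move=> lk; rewrite /cseg -[LHS](cint_preserving (shift_preserving t) (lk _ _)).
apply: eq_cint => x; congr (_ * _); rewrite /cindic !indicE; congr (_%:C).
by congr (nat_of_bool _)%:R; apply/idP/idP; rewrite !inE/= !in_itv/= !lerD2r.
Qed.

Lemma cloc_integrable_shift k (t : R) : cloc_integrable k ->
  cloc_integrable (fun x => k (x + t)).
Proof.
move=> lk a b; have := cintegrable_preserving (shift_preserving t) (lk (a + t) (b + t)).
congr cintegrable; apply/funext => x; congr (_ * _); rewrite /cindic !indicE; congr (_%:C).
by congr (nat_of_bool _)%:R; apply/idP/idP; rewrite !inE/= !in_itv/= !lerD2r.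
Qed.

Lemma ae_cst_shift k : cloc_integrable k ->
  (forall t a b, 0 <= t -> cseg (a + t) (b + t) k = cseg a b k) ->
  exists c, {ae mu, forall x, k x = c}.
Proof.
move=> lk kT; apply: ae_cst_cseg => // t a b _.
have [t0|t0] := leP 0 t; first exact: kT.
have := kT (- t) (a + t) (b + t); rewrite !addrK => -> //.
by rewrite oppr_ge0 ltW.
Qed.

(* du Bois-Reymond: [x |-> \int_(x - t)^x psi] is a test function whose
   derivative is [psi x - psi (x - t)]. *)
Lemma weak_derivative0 k : cloc_integrable k ->
  (forall phi, test_function phi -> cint (fun x => k x * (derive1 phi x)%:C) = 0) ->
  exists c, {ae mu, forall x, k x = c}.
Proof.
move=> lk k0; apply: ae_cst_shift => // t a b t0.
have lkt := cloc_integrable_shift t lk.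
rewrite cseg_shift//.
have c1 := bump_cint_cvg a b lkt; have c2 := bump_cint_cvg a b lk.
apply: ccvg_unique c1 _; move: c2; congr ccvg; apply/funext => n.
have tb := test_bump a b n.
have [tphi dphi] := test_prim_shift t0 tb.
have I1 := cintegrable_test lk tb.
have I2 : cintegrable (fun x => k x * (smooth_bump a b n (x - t))%:C).
  have := cintegrable_preserving (shift_preserving (- t)) (cintegrable_test lkt tb).
  by congr cintegrable; apply/funext => x; rewrite subrK.
have := k0 _ tphi; under eq_cint do rewrite dphi rmorphB/= mulrBr.
rewrite cintB// => /eqP; rewrite subr_eq0 => /eqP ->.
rewrite -(cint_preserving (shift_preserving t) I2).
by apply: eq_cint => x; rewrite addrK.
Qed.

(** [u] and a primitive of [v] have the same weak derivative, so they differ by a constant almost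
    everywhere; adding it to the primitive gives the representative. *)
Lemma weak_derivative_cac u v : cloc_integrable u -> cloc_integrable v ->
  weak_derivative u v -> exists2 U, cac U v & {ae mu, forall x, u x = U x}.
Proof.
move=> lu lv uv.
have aU := cac_cprim lv; have lU := cac_cloc_integrable aU.
have [|c kc] := weak_derivative0 (cloc_integrableB lu lU).
  move=> phi tphi; under eq_cint do rewrite mulrBl.
  rewrite cintB; [|exact: cintegrable_test1..].
  apply/eqP; rewrite subr_eq0; apply/eqP.
  by rewrite [LHS](uv _ tphi) [RHS](cac_weak_derivative aU tphi).
exists (fun x => cprim v x + c); first exact: cac_addr.
by apply: ae_imply kc => x <-; rewrite addrC subrK.
Qed.

End WeakDerivative.

(** * The equation *)

Section HardyTranslation.
Context {R : realType}.
Local Open Scope complex_scope.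
Local Notation C := R[i].
Local Notation mu := (@lebesgue_measure R).
Local Notation T := (measurableTypeR R).
Implicit Types (f g w s : R -> C) (a b t x y xi : R).

Lemma cindic_gt0 a b xi : b <= 0 -> 0 < xi -> cindic `[a, b] xi = 0 :> C.
Proof.
move=> b0 xi0; rewrite /cindic indicE memNset//= in_itv/= => /andP[_ xib].
by have := lt_le_trans xi0 (le_trans xib b0); rewrite ltxx.
Qed.

Lemma normc_cseg_le a b s : cintegrable s ->
  normc (cseg a b s) <= 2 * \int[mu]_x normc (s x).
Proof.
move=> Is; have Iab : cintegrable (fun x => cindic `[a, b] x * s x).
  exact: cintegrable_cindicM.
apply: le_trans (normc_cint_le Iab) _; rewrite ler_wpM2l//.
apply: le_Rintegral => //; [exact: integrable_normc..|].
by move=> y _; rewrite normcM normc_cindic ler_piMl ?normc_ge0.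
Qed.

(** Translating [f] translates the test function [segft a b] backwards, which modulates its
    indicator without moving the support. *)
Lemma Hardy_shift f t : Hardy f -> Hardy (fun x => f (x + t)).
Proof.
move=> Hf; have Lf := Hardy_L2 Hf.
apply/HardyP; split; first exact: (L2_preserving (shift_preserving t)).
move=> a b ab b0; have LK := segft_L2 a b.
have Iab := @cintegrable_cindic_segment R a b.
have Lab := @L2_cindic_segment R a b.
pose psi xi := expi (- (xi * - t)) * cindic `[a, b] xi : C.
have E x : f x * segft a b (x - t) = f x * ft psi x by rewrite ft_chr.
transitivity (cint (fun x => f x * segft a b (x - t))).
  rewrite -[RHS](cint_preserving (shift_preserving t)).
    by apply: eq_cint => x; rewrite addrK.
  rewrite (funext E); apply: L2_cintegrableM => //; apply: ft_L2.
    exact: cintegrable_chr.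
  exact: L2_chr.
rewrite (eq_cint E); apply: Hardy_cint_ft => //.
- exact: cintegrable_chr.
- exact: L2_chr.
- by move=> xi xi0; rewrite /psi cindic_gt0// mulr0.
Qed.

Lemma mem_window x y t : (y \in `[x, x + t]%classic) = (x \in `[y - t, y]%classic).
Proof.
by apply/idP/idP; rewrite !inE/= !in_itv/= => /andP[h1 h2]; apply/andP; split; lra.
Qed.

(** Fubini on the strip [x <= y <= x + t], read from [y] as [y - t <= x <= y]. The choice [beta = 1]
    gives integrability of the window integrals, and [beta = segft a b] tests them for the Hardy
    space. *)
Let window_fubini s (beta : R -> C) (B t : R) : 0 <= t -> cintegrable s ->
  cmeasurable beta -> (forall x, normc (beta x) <= B) ->
  cintegrable (fun x => cseg x (x + t) s * beta x) /\
  cint (fun x => cseg x (x + t) s * beta x) =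
  cint (fun y => s y * cseg (y - t) y beta).
Proof.
move=> t0 Is mbeta betaB; have ms := cintegrable_measurable Is.
have B0 : 0 <= B := le_trans (normc_ge0 _) (betaB 0).
pose ind (z : T * T) : R := if (z.1 <= z.2) && (z.2 <= z.1 + t) then 1 else 0.
have mind : measurable_fun setT ind.
  apply: measurable_fun_ifT => //; apply: measurable_and.
    by apply: measurable_fun_ler; [exact: measurable_fst|exact: measurable_snd].
  apply: measurable_fun_ler; first exact: measurable_snd.
  by apply: measurable_funD => //; exact: measurable_fst.
pose F (z : T * T) : C := (ind z)%:C * s z.2 * beta z.1.
have mF : cmeasurable F.
  apply: cmeasurableM; last exact: cmeasurable_comp measurable_fst mbeta.
  apply: cmeasurableM; last exact: cmeasurable_comp measurable_snd ms.
  exact: cmeasurable_real.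
have indE x y : (ind (x, y))%:C = cindic `[x, x + t] y :> C.
  rewrite /cindic /ind/= indicE; congr (_%:C).
  by case: (boolP (y \in _)) => [|]; rewrite ?notin_setE ?inE/= in_itv/=;
    [move=> ->|move=> /negP/negbTE ->].
have indE' x y : (ind (x, y))%:C = cindic `[y - t, y] x :> C.
  by rewrite indE /cindic !indicE mem_window.
have FxE x y : F (x, y) = beta x * (cindic `[x, x + t] y * s y).
  by rewrite /F/= indE mulrC.
have FyE x y : F (x, y) = s y * (cindic `[y - t, y] x * beta x).
  by rewrite /F/= indE' mulrAC mulrC mulrA.
have lbeta a b : cintegrable (fun x => cindic `[a, b] x * beta x).
  have := cintegrableM (@cintegrable_cindic_segment R a b) mbeta betaB.
  by congr cintegrable; apply/funext => x; rewrite mulrC.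
have Fx x : cintegrable (fun y => F (x, y)).
  have := cintegrableZ (beta x) (cintegrable_cindicM (measurable_itv `[x, x + t]) Is).
  by congr cintegrable; apply/funext => y; rewrite FxE.
have Fy y : cintegrable (fun x => F (x, y)).
  have := cintegrableZ (s y) (lbeta (y - t) y).
  by congr cintegrable; apply/funext => x; rewrite FyE.
have Foo : (\int[mu]_x \int[mu]_y (normc (F (x, y)))%:E < +oo)%E.
  have mN : measurable_fun setT (fun z => normc (F z)) by exact: measurable_normc.
  rewrite (@integral_tonelli _ (fun z => normc (F z)) mN (fun z => normc_ge0 _)).
  have Bnd y : (\int[mu]_x (normc (F (x, y)))%:E <= (B * t)%:E * (normc (s y))%:E)%E.
    apply: (@le_trans _ _ (\int[mu]_x ((B * normc (s y)) * \1_`[y - t, y] x)%:E)%E).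
      apply: ge0_le_integral => //.
      - by move=> x _; rewrite lee_fin normc_ge0.
      - have := measurableT_comp mN (measurable_pair2 y).
        by move=> h; apply/measurable_EFinP.
      - apply/measurable_EFinP; apply: measurable_funM => //; exact: measurable_indic.
      - move=> x _; rewrite lee_fin FyE !normcM normc_cindic.
        rewrite [leRHS](_ : _ = normc (s y) * (\1_`[y - t, y] x * B)); last by ring.
        by rewrite ler_wpM2l ?normc_ge0// ler_wpM2l.
    under eq_integral do rewrite EFinM.
    rewrite ge0_integralZl_EFin//; last 2 first.
    - exact/measurable_EFinP/measurable_indic.
    - by rewrite mulr_ge0 ?normc_ge0.
    rewrite integral_indic// setIT; have := @lebesgue_measure_itv R `[y - t, y].
    rewrite /= => ->; rewrite lte_fin; case: ifPn => _.
      rewrite -EFinD -!EFinM lee_fin (_ : y - (y - t) = t); last by ring.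
      by rewrite mulrAC.
    by rewrite mule0 -EFinM lee_fin !mulr_ge0// normc_ge0.
  apply: (@le_lt_trans _ _ (\int[mu]_y ((B * t)%:E * (normc (s y))%:E))%E).
    apply: ge0_le_integral => //.
    - by move=> y _; apply: integral_ge0 => x _; rewrite lee_fin normc_ge0.
    - have /measurable_EFinP mEN := mN.
      apply: (@measurable_fun_fubini_tonelli_G _ _ T T R mu _ mEN).
      by move=> z; rewrite lee_fin normc_ge0.
    - under eq_fun do rewrite -EFinM.
      apply/measurable_EFinP/measurable_funM; first exact: measurable_cst.
      exact: measurable_normc.
  rewrite ge0_integralZl_EFin ?mulr_ge0//; last 2 first.
  - by move=> y _; rewrite lee_fin normc_ge0.
  - exact/measurable_EFinP/measurable_normc.
  rewrite lte_mul_pinfty ?lee_fin ?mulr_ge0//.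
  exact/cintegrableP.
have [h1 _ h2] := cint_fubini mF Foo Fx Fy.
have E1 x : cint (fun y => F (x, y)) = cseg x (x + t) s * beta x.
  rewrite mulrC -cintZ; last exact: cintegrable_cindicM.
  by apply: eq_cint => y; rewrite FxE.
have E2 y : cint (fun x => F (x, y)) = s y * cseg (y - t) y beta.
  rewrite -cintZ; last exact: lbeta.
  by apply: eq_cint => x; rewrite FyE.
split; first by move: h1; rewrite (funext E1).
by rewrite -(eq_cint E1) h2; exact: eq_cint.
Qed.

(** Integrating over a sliding window is a convolution, so on the frequency side it multiplies by
    the transform of the window. *)
Let cseg_segft a b t y : 0 <= t ->
  cseg (y - t) y (segft a b) = ft (fun xi => cindic `[a, b] xi * segft (- t) 0 xi) y.
Proof.
move=> t0; have I1 := @cintegrable_cindic_segment R.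
transitivity (cint (fun xi => ft (cindic `[a, b]) xi * cindic `[y - t, y] xi)).
  by apply: eq_cint => xi; rewrite mulrC.
rewrite cint_ftM//; apply: eq_cint => xi.
rewrite -/(segft _ _ _) -[y in segft _ y]add0r [y - t]addrC -segft_chr; ring.
Qed.

(** [w * w] is only integrable; its window integrals are bounded as well, hence in L2. In the
    pairing with [segft a b], Fubini moves the window onto the test function, leaving the transform
    of [w * w] on [[a, b]], where it vanishes by [Hardy_ftM]. *)
Lemma Hardy_window w t : 0 <= t -> Hardy w ->
  Hardy (fun x => cseg x (x + t) (fun y => w y * w y)).
Proof.
move=> t0 Hw; have Lw := Hardy_L2 Hw.
have Is : cintegrable (fun y => w y * w y) by exact: L2_cintegrableM.
have I1 := @cintegrable_cindic_segment R; have L1 := @L2_cindic_segment R.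
have n1 (x : R) : normc (1 : C) <= 1 by rewrite (@normc_real R 1) normr1.
have m1 : cmeasurable (fun _ : T => 1 : C) by exact: cmeasurable_cst.
have [h1 _] := @window_fubini _ (fun=> 1) 1 t t0 Is m1 n1.
have IW : cintegrable (fun x => cseg x (x + t) (fun y => w y * w y)).
  by move: h1; congr cintegrable; apply/funext => x; rewrite mulr1.
apply/HardyP; split.
  by apply: (bounded_L2 IW) => x; exact: normc_cseg_le.
move=> a b ab b0.
have mS : cmeasurable (segft a b) by exact/L2_measurable/segft_L2.
have [_ ->] := @window_fubini _ _ _ t t0 Is mS (fun xi => ft_le xi (I1 a b)).
rewrite (eq_cint (fun y => congr1 _ (@cseg_segft a b t y t0))).
have Ipsi : cintegrable (fun xi => cindic `[a, b] xi * segft (- t) 0 xi).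
  by apply: L2_cintegrableM => //; exact: segft_L2.
rewrite -cint_ftM// -[RHS](@cint0 R); apply: eq_cint => xi.
have [xi0|xi0] := leP xi 0; first by rewrite Hardy_ftM// mul0r.
by rewrite cindic_gt0// mul0r mulr0.
Qed.

End HardyTranslation.

(** * The projection of the squared modulus and its differential equation *)

Section HardyEquation.
Context {R : realType}.
Local Open Scope complex_scope.
Local Notation C := R[i].
Local Notation mu := (@lebesgue_measure R).
Implicit Types (u v w U V W : R -> C) (a b t x y : R).

(* Naming the unit fixes the ring structure with respect to which its products
   are typed. *)
Definition ci : C := 'i%C.

Lemma ciJ : ci^* = - ci.
Proof. by apply: complexP; rewrite ReImE//= oppr0. Qed.

Lemma ciM : ci * ci = -1.
Proof. by apply: complexP => /=; ring. Qed.

Lemma ac_cst (k : R) : ac (fun=> k) (fun=> 0).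
Proof.
split=> [a b|a b _]; first exact: integrable0.
by rewrite subrr /Rintegral integral0.
Qed.

Lemma cacM U V v w : cac U v -> cac V w ->
  cac (fun x => U x * V x) (fun x => v x * V x + U x * w x).
Proof.
move=> [U1 U2] [V1 V2]; split.
- have := acD (acM U1 V1) (acZ (-1) (acM U2 V2)).
  by congr ac; apply/funext => x; rewrite !ReImE; ring.
- have := acD (acM U1 V2) (acM U2 V1).
  by congr ac; apply/funext => x; rewrite !ReImE; ring.
Qed.

Lemma cacZ U v (c : C) : cac U v -> cac (fun x => c * U x) (fun x => c * v x).
Proof.
move=> Uv; have cc : cac (fun=> c) (fun=> 0) by split; exact: ac_cst.
by have := cacM cc Uv; congr cac; apply/funext => x; rewrite mul0r add0r.
Qed.

Lemma cacJ U v : cac U v -> cac (fun x => (U x)^*) (fun x => (v x)^*).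
Proof.
move=> [U1 U2]; split.
- by move: U1; congr ac; apply/funext => x; rewrite cReJ.
- by have := acZ (-1) U2; congr ac; apply/funext => x; rewrite cImJ mulN1r.
Qed.

Lemma ae_eq_cseg_int a b v w : cmeasurable v -> cmeasurable w ->
  {ae mu, forall x, v x = w x} -> cseg a b v = cseg a b w.
Proof.
move=> mv mw vw; have mi := @cmeasurable_cindic R _ (measurable_itv `[a, b]).
apply: ae_eq_cint; [exact: cmeasurableM|exact: cmeasurableM|].
by apply: (ae_imply _ vw) => x ->.
Qed.

Lemma ae_cac U v w : cmeasurable w -> {ae mu, forall x, v x = w x} ->
  cac U v -> cac U w.
Proof.
move=> mw vw Uv; have [[l1 _] [l2 _]] := Uv.
have lv : cloc_integrable v by exact/cloc_integrableP.
have mv := cloc_measurable lv.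
have mi a b := @cmeasurable_cindic R _ (measurable_itv `[a, b]).
have lw : cloc_integrable w.
  move=> a b; apply: ae_cintegrable (lv a b); first exact: cmeasurableM.
  by apply: (ae_imply _ vw) => x ->.
have E a b : a <= b -> U b - U a = cseg a b w.
  by move=> ab; rewrite (cacB Uv ab); exact: ae_eq_cseg_int.
have /cloc_integrableP[lw1 lw2] := lw.
split; split=> // a b ab.
- by rewrite -Re_cseg -(E a b ab) !ReImE.
- by rewrite -Im_cseg -(E a b ab) !ReImE.
Qed.

Lemma cac_nsq U v : cac U v -> cac (fun x => (nsq (U x))%:C)
  (fun x => v x * (U x)^* + U x * (v x)^*).
Proof.
move=> Uv; have := cacM Uv (cacJ Uv).
by congr cac; apply/funext => x; rewrite mulccJ.
Qed.

Lemma sqr_modulusE u x : sqr_modulus u x = (nsq (u x))%:C.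
Proof. by rewrite /sqr_modulus /nsq add_Re2_Im2. Qed.

Lemma partialP u : H1 u -> L2 (partial u) /\ weak_derivative u (partial u).
Proof.
move=> [_ [v Lv uv]].
exact: (@xgetPex _ (cst 0) [set v | L2 v /\ weak_derivative u v] (ex_intro _ v (conj Lv uv))).
Qed.

Lemma H1_cac u : H1 u -> exists2 U, cac U (partial u) & {ae mu, forall x, u x = U x}.
Proof.
move=> Hu; have [Lp up] := partialP Hu.
by apply: weak_derivative_cac => //; apply: L2_cloc_integrable => //; exact: proj1 Hu.
Qed.

(** The Sobolev bound on the line: [|U|^2] has an integrable derivative, so it stays within [K] of
    its value at 0. Bounded and integrable, it is in L2, and its projection is meaningful. *)
Lemma sqr_modulus_L2 u : H1 u -> L2 (sqr_modulus u).
Proof.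
move=> Hu; have [Lp _] := partialP Hu; have [U Uv uU] := H1_cac Hu; set v := partial u in Lp Uv.
have mU := cloc_measurable (cac_cloc_integrable Uv).
have LU : L2 U by apply: ae_L2 uU (proj1 Hu).
have Iq : cintegrable (fun x => v x * (U x)^* + U x * (v x)^*).
  by apply: cintegrableD; apply: L2_cintegrableM => //; exact: L2J.
pose q x := v x * (U x)^* + U x * (v x)^*.
pose K := 2 * \int[mu]_x normc (q x).
have qK a b : normc (cseg a b q) <= K by exact: normc_cseg_le.
have bU x : nsq (U x) <= nsq (U 0) + K.
  have H a b : a <= b -> `|nsq (U b) - nsq (U a)| <= K.
    move=> ab; have e : (nsq (U b) - nsq (U a))%:C = cseg a b q.
      by rewrite rmorphB/=; exact: cacB (cac_nsq Uv) ab.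
    by rewrite -normc_real e; exact: qK.
  have [x0|/ltW x0] := leP 0 x.
    by have := H _ _ x0; rewrite ler_norml => /andP[_]; lra.
  by have := H _ _ x0; rewrite ler_norml => /andP[+ _]; lra.
have LS : L2 (fun x => (nsq (U x))%:C).
  apply: (@bounded_L2 _ _ (nsq (U 0) + K)).
    have := L2_cintegrableM LU (L2J LU).
    by congr cintegrable; apply/funext => x; rewrite mulccJ.
  by move=> x; rewrite normc_real ger0_norm ?nsq_ge0.
rewrite (funext (sqr_modulusE u)); apply: ae_L2 LS.
  exact/cmeasurable_real/measurable_nsq/L2_measurable/(proj1 Hu).
by apply: (ae_imply _ uU) => x ->.
Qed.

Lemma cseg_addJ a b v : cloc_integrable v ->
  cseg a b (fun x => v x + (v x)^*) = cseg a b v + (cseg a b v)^*.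
Proof.
move=> lv; have E x : (cindic `[a, b] x * v x)^* = cindic `[a, b] x * (v x)^*.
  by rewrite cconjM cconj_real.
rewrite /cseg -cintJ// -cintD//; last exact/cintegrableJ.
by apply: eq_cint => x; rewrite E mulrDr.
Qed.

Lemma Pi_plus_sqr_modulus u : H1 u ->
  Hardy (Pi_plus (sqr_modulus u)) /\
  {ae mu, forall x, sqr_modulus u x =
     Pi_plus (sqr_modulus u) x + (Pi_plus (sqr_modulus u) x)^*}.
Proof.
move=> Hu; have Ls := sqr_modulus_L2 Hu; have [HP oP] := Pi_plusP Ls.
split=> //; apply: real_projection => // x.
by rewrite sqr_modulusE cconj_real.
Qed.

Section Solution.
Variables u w : R -> C.
Hypotheses (Hu : H1 u) (Hw : Hardy w).
Hypothesis wJ : {ae mu, forall x, sqr_modulus u x = w x + (w x)^*}.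
Hypothesis u_eq : {ae mu, forall x, partial u x = ci * w x * u x}.

Let Lw := Hardy_L2 Hw.
Let lww : cloc_integrable (fun x => w x * w x).
Proof. exact/cintegrable_cloc_integrable/L2_cintegrableM. Qed.

Lemma projection_translation t : 0 <= t ->
  {ae mu, forall x, w (x + t) - w x = ci * cseg x (x + t) (fun y => w y * w y)}.
Proof.
move=> t0; have [Lp _] := partialP Hu; have [U Uv uU] := H1_cac Hu; set v := partial u in Lp Uv.
pose c x := cseg x (x + t) (fun y => w y * w y).
pose q x := w (x + t) - w x - ci * c x.
have Hq : Hardy q.
  apply: HardyB; last exact/HardyZ/Hardy_window.
  exact: (HardyB (Hardy_shift t Hw) Hw).
have mU := cloc_measurable (cac_cloc_integrable Uv).
have mv := L2_measurable Lp; have mw := L2_measurable Lw.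
pose z x := ci * (w x * w x).
have lz : cloc_integrable z by exact: cloc_integrableZ.
have mz := cloc_measurable lz.
(* With [rho = w + conj w], the derivative [i (w - conj w) rho] of [rho] factors as
   [i (w^2 - conj w^2)], which is [z + conj z]. *)
have vz : {ae mu, forall x, v x * (U x)^* + U x * (v x)^* = z x + (z x)^*}.
  have h : {ae mu, forall x, u x = U x /\ sqr_modulus u x = w x + (w x)^*}.
    exact: ae_imply2 uU wJ.
  apply: (ae_imply2 _ h u_eq) => x [e1 e2]; rewrite -/v => e3; move: e2.
  have e4 : (v x)^* = - ci * (w x)^* * (u x)^*.
    by rewrite e3; etransitivity; [exact: cconjM|rewrite cconjM ciJ].
  have e5 : (z x)^* = - ci * ((w x)^* * (w x)^*).
    by etransitivity; [exact: cconjM|rewrite cconjM ciJ].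
  rewrite sqr_modulusE -mulccJ -e1 e4 e3 e5 /z => e.
  transitivity (ci * w x * (u x * (u x)^*) - ci * (w x)^* * (u x * (u x)^*)); first by ring.
  by rewrite e; ring.
have cU x : (nsq (U (x + t)))%:C - (nsq (U x))%:C = ci * c x + (ci * c x)^*.
  have xt : x <= x + t by rewrite lerDl.
  rewrite (cacB (cac_nsq Uv) xt).
  rewrite (@ae_eq_cseg_int _ _ _ (fun x => z x + (z x)^*)) //; last 2 first.
  - by apply: cmeasurableD; apply: cmeasurableM => //; exact: cmeasurableJ.
  - by apply: cmeasurableD => //; exact: cmeasurableJ.
  by rewrite cseg_addJ// csegZ.
have Hx : {ae mu, forall x, (nsq (U x))%:C = w x + (w x)^*}.
  by apply: (ae_imply2 _ uU wJ) => x e; rewrite sqr_modulusE e.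
have Hxt := ae_preserving (shift_preserving t) Hx.
have := Hardy_imaginary Hq; move=> /(_ _)/ae_imply; apply.
  by move=> x /eqP; rewrite subr_eq0 => /eqP.
(* Twice the real part of [q] is the increment of [rho] over the window minus the integral of its
   derivative, hence 0. *)
apply: (ae_imply2 _ Hx Hxt) => x e1 e2; have := cU x.
rewrite e1 e2 /q => e; apply: complexP; move: e; rewrite /conjc.
- by case: (w x) (w (x + t)) (ci * c x) => [? ?] [? ?] [? ?] [] /= *; lra.
- by case: (w x) (w (x + t)) (ci * c x) => [? ?] [? ?] [? ?] [] /= *; lra.
Qed.

(** If [A] is a primitive of [i w^2], the translation identity says that [w - A] is invariant under
    each shift. The exceptional set varies with [t], so invariance is expressed through segment
    integrals, which suffices to make [w - A] constant. *)
Lemma projection_cac : exists2 W, cac W (fun x => ci * (W x * W x)) &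
  {ae mu, forall x, w x = W x}.
Proof.
have [A ca] : exists A, cac A (fun x => ci * (w x * w x)).
  by eexists; exact: (cacZ ci (cac_cprim lww)).
pose k x := w x - A x.
have lA := cac_cloc_integrable ca; have lw := L2_cloc_integrable Lw.
have lk : cloc_integrable k by exact: cloc_integrableB.
have [t a b t0|c kc] := ae_cst_shift lk.
  rewrite (cseg_shift a b t lk); apply: ae_eq_cseg_int.
  - exact/cloc_measurable/cloc_integrable_shift.
  - exact: cloc_measurable.
  apply: (ae_imply _ (projection_translation t0)) => x e.
  have xt : x <= x + t by rewrite lerDl.
  have := cacB ca xt; rewrite csegZ// -e /k => e'.
  have -> : w (x + t) = A (x + t) - A x + w x by rewrite e' subrK.
  ring.
have E : {ae mu, forall x, w x = A x + c}.
  by apply: (ae_imply _ kc) => x <-; rewrite /k addrC subrK.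
have cA := cac_addr c ca.
have mA := cloc_measurable (cac_cloc_integrable cA).
exists (fun x => A x + c) => //; apply: ae_cac cA.
  by apply: cmeasurableM; [exact: cmeasurable_cst|exact: cmeasurableM].
by apply: (ae_imply _ E) => x ->.
Qed.

End Solution.

End HardyEquation.

(** * Uniqueness for linear equations, and the Riccati equation *)

Section HardyODE.
Context {R : realType}.
Local Open Scope complex_scope.
Local Notation C := R[i].
Local Notation mu := (@lebesgue_measure R).
Implicit Types (u v w U V W : R -> C) (a b t x y : R).

Lemma ac_cancel (F : R -> R) x y : ac F (fun=> 0) -> F x = F y.
Proof.
move=> [_ F0]; wlog xy : x y / x <= y.
  by move=> H; have [/H//|/ltW/H ->] := leP x y.
apply/eqP; rewrite eq_sym -subr_eq0 (F0 _ _ xy).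
by rewrite /Rintegral integral0.
Qed.

(** The integrating factor [expR (- prim b t)] makes the product constant, and the exponential never
    vanishes. *)
Lemma linear_ode_eq0 (N b : R -> R) x1 : continuous b ->
  ac N (fun x => b x * N x) -> N x1 = 0 -> forall x, N x = 0.
Proof.
move=> cb aN N0 x.
have lb : loc_integrable b by move=> ? ?; exact: integrable_continuous_segment.
have dG (t : R) : is_derive t (1 : R) (fun t => expR (- prim b t)) (- b t * expR (- prim b t)).
  have db : is_derive t (1 : R) (prim b) (b t) by apply: continuous_derive_prim => //; exact: cb.
  by apply: is_derive_eq; rewrite /GRing.scale/= mulrC.
have cG := is_derive_continuous dG.
have cdG : continuous (fun t => - b t * expR (- prim b t)).
  by move=> t; apply: cvgM; [apply: cvgN; exact: cb|exact: cG].
have aG := ac_C1 dG cdG.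
have aNG : ac (fun t => N t * expR (- prim b t)) (fun=> 0).
  by have := acM aN aG; congr ac; apply/funext => t; ring.
have := ac_cancel x x1 aNG; rewrite N0 mul0r => /eqP.
by rewrite mulf_eq0 (gt_eqF (expR_gt0 _)) orbF => /eqP.
Qed.

Lemma cac_affine (c k : C) : cac (fun x => c + k * x%:C) (fun=> k).
Proof.
have a1 : ac (fun x : R => x) (fun=> 1).
  by apply: ac_C1 => x; exact: cvg_cst.
have ax : cac (fun x : R => x%:C) (fun=> 1) by split; [exact: a1|exact: ac_cst].
have := cac_addr c (cacZ k ax).
by congr cac; apply/funext => x; rewrite ?mulr1 ?(addrC c).
Qed.

Lemma riccati W x1 : cac W (fun x => ci * (W x * W x)) -> W x1 != 0 ->
  exists c : C, forall x, W x * (c - ci * x%:C) = 1.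
Proof.
move=> aW W1.
have [k Wk] : exists k, W x1 * k = 1 by exists (W x1)^-1; rewrite divff.
(* Chosen so that [c - i x] equals [1 / W x1] at [x = x1]. *)
exists (k + ci * x1%:C) => x.
set c := k + _.
have aV : cac (fun x => c - ci * x%:C) (fun=> - ci).
  by have := cac_affine c (- ci); congr cac; apply/funext => y; rewrite mulNr.
(* [E' = i W E] is a linear equation for [E], which vanishes at [x1]. *)
pose E x := W x * (c - ci * x%:C) - 1.
have aE : cac E (fun x => ci * W x * E x).
  have := cac_addr (-1) (cacM aW aV).
  by congr cac; apply/funext => y; rewrite /E; ring.
have [aN _] := cac_nsq aE.
(* This coefficient is twice the real part of [i W]: taking squared moduli turns the complex linear
   equation into a real one. *)
have cb : continuous (fun x => - 2 * complex.Im (W x)).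
  by move=> y; apply: cvgM; [exact: cvg_cst|exact: ac_continuous (proj2 aW) y].
have aN' : ac (fun x => nsq (E x)) (fun x => (- 2 * complex.Im (W x)) * nsq (E x)).
  move: aN; congr ac; apply/funext => y; rewrite /ci /nsq.
  by case: (W y) (E y) => [p q] [r s] /=; ring.
have E1 : nsq (E x1) = 0.
  rewrite /E (_ : c - ci * x1%:C = k); last by rewrite /c; ring.
  by rewrite Wk subrr nsq0.
have := linear_ode_eq0 cb aN' E1 x => /nsq_eq0 /eqP.
by rewrite subr_eq0 => /eqP.
Qed.

Lemma cac_cancel U x y : cac U (fun=> 0) -> U x = U y.
Proof.
by move=> [a1 a2]; apply: complexP; [exact: ac_cancel a1|exact: ac_cancel a2].
Qed.

(** [acos] covers the upper half-circle, and [2 * pi - acos a] the lower one. There [b < 0] excludes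
    [acos a = 0], which keeps the angle strictly below [2 * pi]. *)
Lemma nsq1_expi (z : C) : nsq z = 1 ->
  exists2 theta : R, 0 <= theta < 2 * pi & expi theta = z.
Proof.
case: z => a b; rewrite /nsq /= => ab.
have pi0 := pi_gt0 R.
have a1 : -1 <= a <= 1.
  have b0 := sqr_ge0 b; have : a ^+ 2 <= 1 by lra.
  by move=> a2; rewrite -ler_norml -sqrtr_sqr -[leRHS]sqrtr1 ler_wsqrtr.
have ca : cos (acos a) = a by rewrite acosK// in_itv.
have sa : sin (acos a) = `|b|.
  by rewrite sin_acos// (_ : 1 - a ^+ 2 = b ^+ 2) ?sqrtr_sqr//; lra.
have t0 := acos_ge0 a1; have tpi := acos_lepi a1.
have [b0|b0] := leP 0 b.
  exists (acos a); first by apply/andP; split; lra.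
  by rewrite /expi ca sa ger0_norm.
exists (2 * pi - acos a).
  apply/andP; split; first by lra.
  suff : acos a != 0 by rewrite neq_lt => /orP[|]; lra.
  apply/eqP => e; move: sa; rewrite e sin0 => /esym/normr0_eq0 e'.
  by rewrite e' ltxx in b0.
rewrite /expi mulr_natl; congr (_ +i* _).
- by rewrite mulr2n addrC -mulr2n cosD2pi cosN.
- by rewrite addrC sinD2pi sinN sa ltr0_norm// opprK.
Qed.

End HardyODE.

(** * Solutions of the equation are rescaled solitons *)

Section Solutions.
Context {R : realType}.
Local Open Scope complex_scope.
Local Notation C := R[i].
Local Notation mu := (@lebesgue_measure R).
Implicit Types (u : R -> C) (x : R) (z d c K : C).

(** From [z * d = 1], [z] is the conjugate of [d] multiplied by [nsq z]. *)
Lemma Re_inverse z d : z * d = 1 -> complex.Re z = complex.Re d * nsq z.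
Proof.
case: z d => p q [r s] [] e1 e2; rewrite /nsq /=.
transitivity (p * (p * r - q * s) + q * (p * s + q * r)); last by ring.
by rewrite e1 e2; ring.
Qed.

Lemma solitonE (t : R) : soliton t * (t%:C + ci) = (Num.sqrt 2)%:C.
Proof.
rewrite /soliton -/ci divfK//.
by rewrite eq_complex/= add0r oner_eq0 andbF.
Qed.

Lemma soliton_form c K : 0 < complex.Re c -> nsq K = 2 * complex.Re c ->
  exists theta lambda y : R, [/\ 0 <= theta < 2 * pi, 0 < lambda &
    forall x z, z * (c - ci * x%:C) = K ->
      z = expi theta * (Num.sqrt lambda)%:C * soliton (lambda * x + y)].
Proof.
case: c => c1 c2 /= c1_gt0 nK.
pose s := Num.sqrt c1; have s0 : s != 0 by rewrite gt_eqF ?sqrtr_gt0.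
have s2 : c1 = s * s by rewrite -expr2 sqr_sqrtr// ltW.
pose r : R := Num.sqrt 2; have r0 : r != 0 by rewrite gt_eqF ?sqrtr_gt0.
have r2 : 2 = r * r by rewrite -expr2 sqr_sqrtr.
have nz : nsq (ci * K * ((r * s)^-1)%:C) = 1.
  rewrite !nsqM nsq_real nK s2 r2 /nsq /=; field.
  by rewrite s0 r0.
have [theta th e] := nsq1_expi nz.
(* The values are read off [c - i x = - i c1 (lambda x + y + i)]. The remaining factor
   [i K / (sqrt 2 sqrt c1)] is unimodular because [nsq K = 2 c1], and it is the phase. *)
exists theta, c1^-1, (- c2 / c1); split=> //; first by rewrite invr_gt0.
move=> x z; set t := c1^-1 * x + - c2 / c1.
have tE : t * c1 = x - c2 by rewrite /t; field; rewrite gt_eqF.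
have -> : c1 +i* c2 - ci * x%:C = - ci * c1%:C * (t%:C + ci).
  by apply: complexP; rewrite /= ?mulr0; lra.
move=> zK; have d0 : t%:C + ci != 0.
  by rewrite eq_complex/= add0r oner_eq0 andbF.
apply: (mulIf d0); rewrite -[RHS]mulrA -/t solitonE e.
rewrite sqrtrV ?(ltW c1_gt0)// -/s -/r.
have q : (c1 * ((r * s)^-1 * (s^-1 * r)))%:C = 1 :> C.
  by rewrite -[RHS]/(1%:C); congr (_%:C); rewrite s2; field; rewrite s0 r0.
transitivity (z * (t%:C + ci) * (c1 * ((r * s)^-1 * (s^-1 * r)))%:C).
  by rewrite q mulr1.
rewrite !rmorphM/= -zK.
set A := (_ ^-1)%:C; set B := (_ ^-1)%:C.
transitivity (- (ci * ci) * (z * (t%:C + ci) * (c1%:C * (A * (B * r%:C))))).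
  by rewrite ciM opprK mul1r.
ring.
Qed.

Lemma equation_soliton u : H1 u -> nonzero u ->
  {ae mu, forall x, D u x - Pi_plus (sqr_modulus u) x * u x = 0} ->
  exists theta lambda y : R, [/\ 0 <= theta < 2 * pi, 0 < lambda &
    {ae mu, forall x, u x = expi theta * (Num.sqrt lambda)%:C *
                            soliton (lambda * x + y)}].
Proof.
move=> Hu nu; have [Hw wJ] := Pi_plus_sqr_modulus Hu.
move: (Pi_plus _) Hw wJ => w Hw wJ Du.
have u_eq : {ae mu, forall x, partial u x = ci * w x * u x}.
  apply: (ae_imply _ Du) => x; rewrite /D -/ci => /eqP; rewrite subr_eq0 => /eqP e.
  transitivity (- (ci * ci) * partial u x); first by rewrite ciM opprK mul1r.
  by transitivity (ci * (- ci * partial u x)); [ring|rewrite e; ring].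
have [W aW wW] := projection_cac Hu Hw wJ u_eq.
have [U Uv uU] := H1_cac Hu.
have mW := cloc_measurable (cac_cloc_integrable aW).
have mU := cloc_measurable (cac_cloc_integrable Uv).
have aU : cac U (fun x => ci * W x * U x).
  apply: ae_cac Uv.
    by apply: cmeasurableM => //; apply: cmeasurableM => //; exact: cmeasurable_cst.
  have h : {ae mu, forall x, w x = W x /\ u x = U x} by exact: ae_imply2 wW uU.
  by apply: (ae_imply2 _ h u_eq) => x [e1 e2]; rewrite -e1 -e2.
have UW : {ae mu, forall x, nsq (U x) = 2 * complex.Re (W x)}.
  have h : {ae mu, forall x, w x = W x /\ u x = U x} by exact: ae_imply2 wW uU.
  apply: (ae_imply2 _ h wJ) => x [-> e]; rewrite sqr_modulusE e => /(congr1 (@complex.Re R)).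
  by rewrite /= cReD cReJ mulr_natl mulr2n.
(* If [W] vanished everywhere, so would [nsq U = 2 Re W] almost everywhere, against [nonzero u]. *)
have [x1 W1] : exists x1, W x1 != 0.
  apply: contrapT => nW; apply: nu.
  apply: (ae_imply2 _ uU UW) => x -> e; apply: nsq_eq0.
  rewrite e; have -> : W x = 0 by apply/eqP/negPn/negP => W0; apply: nW; exists x.
  by rewrite mulr0.
have [c Wc] := riccati aW W1.
have aV : cac (fun x => c - ci * x%:C) (fun=> - ci).
  by have := cac_affine c (- ci); congr cac; apply/funext => y; rewrite mulNr.
(* The derivative of the left side is [i U (W (c - i x) - 1)], which is 0 by [Wc]. *)
have UK x : U x * (c - ci * x%:C) = U 0 * (c - ci * 0%:C).
  have aZ : cac (fun x => U x * (c - ci * x%:C)) (fun=> 0).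
    have := cacM aU aV; congr cac; apply/funext => y.
    by transitivity (ci * U y * (W y * (c - ci * y%:C) - 1)); [ring|rewrite Wc subrr mulr0].
  exact: (cac_cancel x 0 aZ).
set K := U 0 * _ in UK.
have Wn0 x : 0 < nsq (W x).
  rewrite lt_neqAle nsq_ge0 andbT eq_sym; apply/negP => /eqP/nsq_eq0 W0.
  by have /eqP := Wc x; rewrite W0 mul0r eq_sym oner_eq0.
have ReW x : complex.Re (W x) = complex.Re c * nsq (W x).
  by rewrite (Re_inverse (Wc x)); congr (_ * _); case: c {Wc aV UK K} => a b /=; ring.
have [x0 Ux0] := ae_exists UW.
have c_ge0 : 0 <= complex.Re c.
  by have := nsq_ge0 (U x0); rewrite Ux0 ReW pmulr_rge0// pmulr_lge0.
(* With a zero real part, [c - i x] would vanish at [x = Im c], against [Wc]. *)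
have c_gt0 : 0 < complex.Re c.
  rewrite lt_neqAle c_ge0 andbT eq_sym; apply/negP => /eqP c0.
  have := Wc (complex.Im c); rewrite (_ : c - _ = 0) ?mulr0.
    by move/eqP; rewrite eq_sym oner_eq0.
  by apply: complexP; rewrite !ReImE/= ?c0; ring.
(* At one good point, [nsq U] is both [nsq K * nsq W] and [2 Re c * nsq W]. *)
have nK : nsq K = 2 * complex.Re c.
  have UKW : U x0 = K * W x0.
    transitivity (U x0 * (W x0 * (c - ci * x0%:C))); first by rewrite Wc mulr1.
    by rewrite mulrCA UK mulrC.
  apply: (mulIf (lt0r_neq0 (Wn0 x0))).
  by rewrite -nsqM -UKW Ux0 ReW mulrA.
have [theta [lambda [y [th l0 h]]]] := soliton_form c_gt0 nK.
exists theta, lambda, y; split=> //.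
by apply: (ae_imply _ uU) => x ->; apply: h; exact: UK.
Qed.

End Solutions.

(** * Minimizers *)

Section Minimizers.
Context {R : realType}.
Local Open Scope complex_scope.
Local Notation C := R[i].
Local Notation mu := (@lebesgue_measure R).
Implicit Types (u : R -> C) (x : R) (z d c K : C).

Let q x : R := (1 + x ^+ 2)^-1.

Let q0 x : 1 + x ^+ 2 != 0.
Proof. by rewrite gt_eqF// ltr_wpDr ?sqr_ge0. Qed.

(** [i / (x + i)], equivalently [1 / (1 - i x)], in Cartesian form. *)
Let w0 x : C := q x +i* (x * q x).

Let w0E x : w0 x * (x%:C + ci) = ci.
Proof. by have := q0 x => h; apply: complexP; rewrite /= /q; field. Qed.

Let nsq_w0 x : nsq (w0 x) = q x.
Proof. by have := q0 x => h; rewrite /nsq /= /q; field. Qed.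

Let q_poisson x : q x = 2^-1 * poisson 1 x.
Proof. by rewrite /q /poisson expr1n; field. Qed.

Let is_derive_q x : is_derive x (1 : R) q (- (2 * x * (q x * q x))).
Proof.
have h := q0 x; rewrite /q.
have d1 : is_derive x (1 : R) (fun x : R => 1 + x ^+ 2) (2 * x).
  by apply: is_derive_eq; rewrite /GRing.scale/=; ring.
have d2 := @is_deriveV _ (fun x : R => 1 + x ^+ 2) _ _ _ h d1.
apply: is_derive_eq; rewrite /GRing.scale/=; field.
by [].
Qed.

Let is_derive_xq x : is_derive x (1 : R) (fun x => x * q x) (q x * q x - x * q x * (x * q x)).
Proof.
have h := q0 x; have d := is_derive_q x.
apply: is_derive_eq; rewrite /GRing.scale/= /q; field.
by [].
Qed.

Let cq : continuous q := is_derive_continuous is_derive_q.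
Let cxq : continuous (fun x => x * q x) := is_derive_continuous is_derive_xq.

Let cac_w0 : cac w0 (fun x => ci * (w0 x * w0 x)).
Proof.
split.
- have -> : (fun x => complex.Re (ci * (w0 x * w0 x))) = (fun x => - (2 * x * (q x * q x))).
    by apply/funext => x /=; ring.
  apply: ac_C1 => // x; apply: cvgN; apply: cvgM.
    by apply: cvgM; [exact: cvg_cst|exact: cvg_id].
  by apply: cvgM; exact: cq.
- have -> : (fun x => complex.Im (ci * (w0 x * w0 x))) =
      (fun x => q x * q x - x * q x * (x * q x)).
    by apply/funext => x /=; ring.
  apply: ac_C1 => // x; apply: cvgB; apply: cvgM; first [exact: cq|exact: cxq].
Qed.

Let w0_L2 : L2 w0.
Proof.
apply: (@le_L2 _ _ (fun x => 2^-1 * poisson 1 x)).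
- exact: cloc_measurable (cac_cloc_integrable cac_w0).
- exact/integrableZ_EFin/integrable_poisson.
- by move=> x; rewrite nsq_w0 q_poisson.
Qed.

(** [1 / (1 - i x)] is the transform of [exp xi] restricted to []-oo, 0]], and left support gives a
    Hardy function. *)
Let w0_Hardy : Hardy w0.
Proof.
pose phi xi : C := (halfexp 1 (- xi))%:C.
have Iphi : cintegrable phi by exact: cintegrable_halfexpN.
have Lphi : L2 phi.
  apply: (bounded_L2 (M := 1)) => // xi; rewrite normc_real ger0_norm ?halfexp_ge0//.
  rewrite /halfexp indicE; case: (boolP (_ \in _)) => [|_]; last by rewrite mul0r.
  by rewrite inE/= in_itv/= andbT !mul1r => h; rewrite -expR0 ler_expR oppr_le0.
have -> : w0 = ft phi.
  apply/funext => x; rewrite /ft -(cint_preserving (@opp_preserving R)).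
    under eq_cint => xi do rewrite /phi opprK mulNr -mulrN.
    rewrite cint_halfexp// /halfexp_ft; apply: complexP => /=.
      by rewrite sqrrN expr1n mul1r.
    by rewrite sqrrN expr1n opprK.
  exact: cintegrable_chr.
apply: (is_fourier_Hardy Lphi); first exact: is_fourier_ft.
move=> xi xi0; rewrite /phi /halfexp indicE memNset ?mul0r//=.
by rewrite in_itv/= andbT oppr_ge0; apply/negP; rewrite -ltNge.
Qed.

Let k : C := - ci * (Num.sqrt 2)%:C.

Let solitonK x : soliton x = k * w0 x.
Proof.
have d0 : x%:C + ci != 0 :> C by rewrite eq_complex/= add0r oner_eq0 andbF.
apply: (mulIf d0); rewrite solitonE -mulrA w0E /k.
transitivity (- (ci * ci) * (Num.sqrt 2)%:C : C); last by ring.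
by rewrite ciM opprK mul1r.
Qed.

(** The soliton is a constant multiple of [w0], and [w0' = i w0^2]; so [w0] is also its logarithmic
    derivative divided by [i]. *)
Let cac_soliton : cac (@soliton R) (fun x => ci * w0 x * soliton x).
Proof.
have := cacZ k cac_w0; congr cac; apply/funext => x; rewrite solitonK//.
ring.
Qed.

Let dsoliton_L2 : L2 (fun x => ci * w0 x * soliton x).
Proof.
apply: (@L2M _ _ _ 1); first by rewrite (funext solitonK); exact: L2Z w0_L2.
  by apply: cmeasurableM; [exact: cmeasurable_cst|exact: L2_measurable w0_L2].
move=> x; rewrite nsqM nsq_w0 (_ : nsq ci = 1); last by rewrite /nsq /=; ring.
by rewrite mul1r invf_le1 ?lerDl ?sqr_ge0// ltr_wpDr ?sqr_ge0.
Qed.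

Let soliton_H1 : H1 (@soliton R).
Proof.
split; first by rewrite (funext solitonK); exact: L2Z w0_L2.
by exists (fun x => ci * w0 x * soliton x); last exact: cac_weak_derivative.
Qed.

Let soliton_nonzero : nonzero (@soliton R).
Proof.
move=> /ae_exists[x sx]; have := solitonE x; rewrite sx mul0r => -[/esym/eqP].
by rewrite sqrtr_eq0 leNgt ltr0n.
Qed.

(** The squared modulus is [2 q = w0 + conj w0]. Its projection has the same real part as [w0], so
    the difference is an imaginary Hardy function and vanishes; no integral is computed. *)
Let soliton_Pi : {ae mu, forall x, Pi_plus (sqr_modulus (@soliton R)) x = w0 x}.
Proof.
have [Hw wJ] := Pi_plus_sqr_modulus soliton_H1.
have := Hardy_imaginary (HardyB Hw w0_Hardy) => /(_ _)/ae_imply; apply.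
  by move=> x /eqP; rewrite subr_eq0 => /eqP.
apply: (ae_imply _ wJ) => x; rewrite sqr_modulusE solitonK nsqM nsq_w0.
rewrite (_ : nsq k = 2); last first.
  by rewrite /k nsqM nsqN nsq_real sqr_sqrtr// /nsq/=; ring.
move=> e; transitivity ((2 * q x)%:C - (w0 x + (w0 x)^*)).
  rewrite e; apply: complexP; rewrite !ReImE; ring.
by apply: complexP; rewrite !ReImE /=; ring.
Qed.

Lemma cmeasurable_residual u : H1 u ->
  cmeasurable (fun x => partial u x - ci * Pi_plus (sqr_modulus u) x * u x).
Proof.
move=> Hu; have [Lp _] := partialP Hu; have [Hw _] := Pi_plus_sqr_modulus Hu.
apply: cmeasurableB; first exact: L2_measurable.
apply: cmeasurableM; last exact: L2_measurable (proj1 Hu).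
apply: cmeasurableM; first exact: cmeasurable_cst.
exact/L2_measurable/Hardy_L2.
Qed.

(** [partial] and [Pi_plus] return chosen representatives, so both are first identified almost
    everywhere, by uniqueness of the weak derivative and by [soliton_Pi]; the integrand is then
    null. *)
Lemma energy_soliton : energy (@soliton R) = 0%E.
Proof.
have [Lp sp] := partialP soliton_H1.
have pE := weak_derivative_unique Lp dsoliton_L2 sp (cac_weak_derivative cac_soliton).
pose g x := partial (@soliton R) x - ci * Pi_plus (sqr_modulus (@soliton R)) x * soliton x.
have mg : cmeasurable g := cmeasurable_residual soliton_H1.
have g0 : {ae mu, forall x, 0 = g x}.
  by apply: (ae_imply2 _ pE soliton_Pi) => x e1 e2; rewrite /g e1 e2 subrr.
have Lg0 := ae_L2 mg g0 (@L20 R).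
rewrite /energy (_ : L2norm_sqr _ = L2norm_sqr g)// L2norm_sqr_n2//.
rewrite -(ae_n2 (L2_measurable (@L20 R)) mg g0) /n2.
under eq_Rintegral do rewrite nsq0.
by rewrite /Rintegral integral0 mule0.
Qed.

Lemma minimizer_equation u : is_minimizer u ->
  {ae mu, forall x, D u x - Pi_plus (sqr_modulus u) x * u x = 0}.
Proof.
move=> [Hu _ /(_ _ soliton_H1 soliton_nonzero)]; rewrite energy_soliton => E0.
pose g x := partial u x - ci * Pi_plus (sqr_modulus u) x * u x.
have mg : cmeasurable g := cmeasurable_residual Hu.
have g0 : L2norm_sqr g = 0%E.
  have h : (0 <= L2norm_sqr g)%E.
    by apply: integral_ge0 => x _; rewrite lee_fin sqr_ge0.
  apply/eqP; rewrite eq_le h andbT.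
  by move: E0; rewrite /energy (_ : L2norm_sqr _ = L2norm_sqr g)// pmule_rle0.
apply: (ae_imply _ (L2norm_sqr_eq0 mg g0)) => x gx.
transitivity (- ci * g x); last by rewrite gx mulr0.
rewrite /D -/ci /g.
transitivity (- ci * partial u x + (ci * ci) * (Pi_plus (sqr_modulus u) x * u x)); last by ring.
by rewrite ciM mulN1r.
Qed.

End Minimizers.

Theorem lemma4p1 (R : realType) :
  (forall u : R -> R[i], H1 u -> nonzero u ->
     {ae @lebesgue_measure R, forall x,
        D u x - Pi_plus (sqr_modulus u) x * u x = 0} ->
     exists theta lambda y : R,
       [/\ 0 <= theta < 2 * pi, 0 < lambda &
           {ae @lebesgue_measure R, forall x,
              u x = expi theta * (Num.sqrt lambda)%:C%C *
                    soliton (lambda * x + y)}]) /\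
  (forall u : R -> R[i], is_minimizer u ->
     exists theta lambda y : R,
       [/\ 0 <= theta < 2 * pi, 0 < lambda &
           {ae @lebesgue_measure R, forall x,
              u x = expi theta * (Num.sqrt lambda)%:C%C *
                    soliton (lambda * x + y)}]).
Proof.
split=> [u Hu nu|u Mu]; first exact: equation_soliton.
by have [Hu nu _] := Mu; apply: equation_soliton => //; exact: minimizer_equation.
Qed.
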